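(* Let $\gamma\in[0,\pi)$ and let $\mathcal{M}_0^{(\gamma)}:=\{g\in\operatorname{assoc}\mathcal{B}:\langle g,h\rangle_{\mathcal{F}}=0\text{ for all }h\in\operatorname{dom}(S_\gamma)\}$. Every element $\mathfrak{F}\in\operatorname{assoc}\mathcal{B}/\mathcal{M}_0^{(\gamma)}$ defines a unique element in $\mathcal{B}_{-2}^{(\gamma)}$ by the rule $$\langle\mathfrak{F},h\rangle_2:=\langle f,h\rangle_{\mathcal{F}},\qquad h\in\mathcal{B}_{+2}^{(\gamma)},$$ where $f\in\operatorname{assoc}\mathcal{B}$ is any representative of $\mathfrak{F}$. Conversely, to every $\varphi\in\mathcal{B}_{-2}^{(\gamma)}$ there corresponds a unique $\mathfrak{F}\in\operatorname{assoc}\mathcal{B}/\mathcal{M}_0^{(\gamma)}$ such that $$\langle\varphi,h\rangle_2=\langle\mathfrak{F},h\rangle_2\qquad\text{for all }h\in\mathcal{B}_{+2}^{(\gamma)},$$ where $\langle\mathfrak{F},h\rangle_2$ is given by the rule displayed first.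
   Context: Inner products are conjugate linear in the left argument. For an entire function $f$, $f^\#(z):=\overline{f(\overline z)}$. A Hilbert space of entire functions is a de Branges (dB) space if it has a reproducing kernel and is isometrically invariant under $f\mapsto f^\#$ and under $f(z)\mapsto \frac{z-\overline w}{z-w}f(z)$ whenever $w$ is a non-real zero of $f$. The Hermite-Biehler class consists of entire $e$ with $|e(z)|>|e(\overline z)|$ for all $z$ with $\operatorname{Im} z>0$; for such $e$, $\mathcal{B}(e)$ is the space of entire $f$ with $f/e,\,f^\#/e\in H^2(\mathbb{C}_+)$ (Hardy space of the upper half plane), with inner product $\langle f,g\rangle=\int_{\mathbb{R}}\frac{\overline{f(x)}g(x)}{|e(x)|^2}dx$. Every nonzero dB space equals some $\mathcal{B}(e)$ isometrically. Fix a nonzero dB space $\mathcal{B}=\mathcal{B}(e)$ with $e$ in the Hermite-Biehler class and without real zeros (standing assumption). Its reproducing kernel is $k(z,w)$, so $f(w)=\langle k(\cdot,w),f\rangle$. The set $\operatorname{assoc}\mathcal{B}$ of associated functions consists of the entire functions $h$ such that $\frac{h(w)f(z)-h(z)f(w)}{z-w}\in\mathcal{B}$ for all $f\in\mathcal{B}$ and all $w$ with $h(w)\neq0$; equivalently $\operatorname{assoc}\mathcal{B}=z\mathcal{B}+\mathcal{B}$. Put $s_\gamma(z)=\frac{i}{2}[e^{i\gamma}e(z)-e^{-i\gamma}e^\#(z)]$. $S$ is the operator of multiplication by the independent variable on its maximal domain in $\mathcal{B}$; it is assumed throughout that $\operatorname{dom}(S)$ is dense. One has $k(\cdot,w)\in\ker(S^*-\overline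 wI)$ for every $w\in\mathbb{C}$. The canonical selfadjoint extensions of $S$ are $S_\gamma$, $\gamma\in[0,\pi)$: with any $w\in\mathbb{C}\setminus\mathbb{R}$ (the result does not depend on $w$), $$\operatorname{dom}(S_\gamma)=\left\{g(z)=\frac{f(z)-\frac{s_\gamma(z)}{s_\gamma(w)}f(w)}{z-w}: f\in\mathcal{B}\right\},\qquad S_\gamma g(z)=zg(z)+f(w)\frac{s_\gamma(z)}{s_\gamma(w)}.$$ $\mathcal{B}_{+2}^{(\gamma)}$ is $\operatorname{dom}(S_\gamma)$ with inner product $\langle f,g\rangle_{+2}:=\langle S_\gamma f,S_\gamma g\rangle+\langle f,g\rangle$; $\mathcal{B}_{-2}^{(\gamma)}$ is its dual, realized as the completion of $\mathcal{B}$ under the norm of $\langle f,g\rangle_{-2}:=\langle f,(S_\gamma^2+I)^{-1}g\rangle$; the pairing $\langle\cdot,\cdot\rangle_2:\mathcal{B}_{-2}^{(\gamma)}\times\mathcal{B}_{+2}^{(\gamma)}\to\mathbb{C}$ is the continuous extension of the inner product of $\mathcal{B}$. $\mathcal{F}_{+1}$ is $\operatorname{dom}(S^* )$ with inner product $\langle f,g\rangle_{+\mathcal{F}}:=\langle S^*f,S^*g\rangle+\langle f,g\rangle$. $\mathcal{F}_{-1}$ is its dual, realized as the completion of $\mathcal{B}$ with respect to $\|f\|_{-\mathcal{F}}:=\sup_{g\in\operatorname{dom}(S^* )\setminus\{0\}}\frac{|\langle f,g\rangle|}{\|g\|_{+\mathcal{F}}}$. The pairing $\langle\cdot,\cdot\rangle_{\mathcal{F}}:\mathcal{F}_{-1}\times\mathcal{F}_{+1}\to\mathbb{C}$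 is the continuous extension of the inner product of $\mathcal{B}$, and $\langle f,\phi\rangle_{\mathcal{F}}:=\overline{\langle\phi,f\rangle_{\mathcal{F}}}$ for $f\in\mathcal{F}_{+1}$, $\phi\in\mathcal{F}_{-1}$. The map sending $\psi\in\mathcal{F}_{-1}$ to $f(z)=\langle k(\cdot,z),\psi\rangle_{\mathcal{F}}$ is a bijection onto $\operatorname{assoc}\mathcal{B}$, through which $\mathcal{F}_{-1}$ is identified with $\operatorname{assoc}\mathcal{B}$; for $f\in\operatorname{assoc}\mathcal{B}$ corresponding to $\psi$ one sets $\langle f,g\rangle_{\mathcal{F}}:=\langle\psi,g\rangle_{\mathcal{F}}$, $g\in\operatorname{dom}(S^* )$. *)

(* Defs.v *)
From HB Require Import structures.
From mathcomp Require Import all_boot all_order all_algebra.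
From mathcomp Require Import complex.
From mathcomp Require Import all_classical all_reals all_analysis.

Set Implicit Arguments.
Unset Strict Implicit.
Unset Printing Implicit Defensive.

Import Order.TTheory GRing.Theory Num.Theory.
Import numFieldNormedType.Exports.

Local Open Scope classical_set_scope.
Local Open Scope ring_scope.

Section deBranges.
Variable R : realType.
Local Notation C := R[i].
Local Notation modulus := (@Normc.normc R).

Definition holomorphic_at (f : C -> C) (z : C) : Prop :=
  derivable (f : C^o -> C^o) z 1.

Definition entire (f : C -> C) : Prop := forall z, holomorphic_at f z.

Definition sharp (f : C -> C) : C -> C := fun z => conjc (f (conjc z)).

(* Linear spaces of functions on the plane with an inner product; [inner] is
   only meaningful on [carrier], and is conjugate linear on the left. *)
Record fspace := FSpace {
  carrier :> (C -> C) -> Prop;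
  inner : (C -> C) -> (C -> C) -> C }.

Definition ipnorm (ip : (C -> C) -> (C -> C) -> C) (f : C -> C) : R :=
  Num.sqrt (complex.Re (ip f f)).

Definition subspace (V : set (C -> C)) : Prop :=
  V (cst 0) /\ forall a f g, V f -> V g -> V ((a \*o f) \+ g).

Definition inner_product (B : fspace) : Prop :=
  [/\ forall a f g h, B f -> B g -> B h ->
        inner B h ((a \*o f) \+ g) = a * inner B h f + inner B h g,
      forall f g, B f -> B g -> inner B g f = conjc (inner B f g),
      forall f, B f -> 0 <= inner B f f
    & forall f, B f -> inner B f f = 0 -> f = cst 0].

Definition complete_space (B : fspace) : Prop :=
  forall u : nat -> C -> C, (forall n, B (u n)) ->
    (forall eps : R, 0 < eps -> exists N, forall m n, (N <= m)%N -> (N <= n)%N ->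
       ipnorm (inner B) (u m \- u n) < eps) ->
    exists2 f, B f & forall eps : R, 0 < eps -> exists N, forall n, (N <= n)%N ->
       ipnorm (inner B) (u n \- f) < eps.

Definition reproducing_kernel (B : fspace) (k : C -> C -> C) : Prop :=
  forall w, B (k^~ w) /\ forall f, B f -> f w = inner B (k^~ w) f.

Definition dB_space (B : fspace) : Prop :=
  [/\ forall f, B f -> entire f,
      [/\ subspace (carrier B), inner_product B & complete_space B],
      exists k, reproducing_kernel B k,
      forall f, B f ->
        B (sharp f) /\ ipnorm (inner B) (sharp f) = ipnorm (inner B) f
    & forall f w, B f -> complex.Im w != 0 -> f w = 0 ->
        exists g, [/\ forall z, (z - w) * g z = (z - conjc w) * f z, B g
                    & ipnorm (inner B) g = ipnorm (inner B) f]].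

Definition nonzero_space (B : fspace) : Prop := exists2 f, B f & f <> cst 0.

(* Hardy space of the upper half-plane; values of [F] elsewhere are ignored. *)
Definition hardy2 (F : C -> C) : Prop :=
  (forall z, 0 < complex.Im z -> holomorphic_at F z) /\
  exists M : R, forall y : R, 0 < y ->
    (\int[@lebesgue_measure R]_(x in setT) (modulus (F (x +i* y)%C) ^+ 2)%:E
       <= M%:E)%E.

Definition Cintegral (F : R -> C) : C :=
  (Rintegral (@lebesgue_measure R) setT (fun x => complex.Re (F x)) +i*
   Rintegral (@lebesgue_measure R) setT (fun x => complex.Im (F x)))%C.

Definition hermite_biehler (e : C -> C) : Prop :=
  entire e /\ forall z, 0 < complex.Im z -> `|e (conjc z)| < `|e z|.

Definition dBe (e : C -> C) : fspace := FSpace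
  [set f | [/\ entire f, hardy2 (fun z => f z / e z)
             & hardy2 (fun z => sharp f z / e z)]]
  (fun f g => Cintegral (fun x => conjc (f x%:C%C) * g x%:C%C / `|e x%:C%C| ^+ 2)).

Definition same_fspace (B B' : fspace) : Prop :=
  carrier B = carrier B' /\ forall f g, B f -> B g -> inner B f g = inner B' f g.

Definition assoc (B : fspace) : set (C -> C) := [set h | entire h /\
  forall f w, B f -> h w != 0 ->
    exists2 g, B g & forall z, (z - w) * g z = h w * f z - h z * f w].

(* Partial operators; [app] is only meaningful on [dom]. *)
Record oper := Oper { dom : set (C -> C); app :> (C -> C) -> C -> C }.

(* The operator with graph [G]. *)
Definition oper_of (G : (C -> C) -> (C -> C) -> Prop) : oper :=
  Oper [set g | exists u, G g u] (fun g => xget (cst 0) [set u | G g u]).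

Definition mult (B : fspace) : oper :=
  Oper [set f | B f /\ B (fun z => z * f z)] (fun f z => z * f z).

Definition densely_defined (B : fspace) (A : oper) : Prop :=
  forall f, B f -> forall eps : R, 0 < eps ->
    exists2 g, dom A g & ipnorm (inner B) (f \- g) < eps.

Definition adjoint (B : fspace) (A : oper) : oper :=
  oper_of (fun g u =>
    [/\ B g, B u & forall f, dom A f -> inner B g (A f) = inner B u f]).

Definition cis (t : R) : C := (cos t +i* sin t)%C.

Definition s_ (e : C -> C) (gamma : R) (z : C) : C :=
  'i%C / 2 * (cis gamma * e z - cis (- gamma) * sharp e z).

(* The quotient by z - w is the entire function obtained by removing the
   singularity at w. *)
Definition S_ (B : fspace) (e : C -> C) (w : C) (gamma : R) : oper :=
  oper_of (fun g u => exists2 f, B f &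
    [/\ entire g,
        forall z, (z - w) * g z = f z - s_ e gamma z / s_ e gamma w * f w
      & u = fun z => z * g z + f w * (s_ e gamma z / s_ e gamma w)]).

Definition graph_inner (B : fspace) (A : oper) (f g : C -> C) : C :=
  inner B (A f) (A g) + inner B f g.

Definition graph_space (B : fspace) (A : oper) : fspace :=
  FSpace (dom A) (graph_inner B A).

(* (A^2 + I)^-1 *)
Definition inv_sqr1 (A : oper) : (C -> C) -> C -> C := fun g =>
  xget (cst 0) [set u | [/\ dom A u, dom A (A u) & A (A u) \+ u = g]].

(* Norm of <f, g>_{-2} = <f, (A^2 + I)^-1 g>. *)
Definition norm_m2 (B : fspace) (A : oper) : (C -> C) -> R :=
  ipnorm (fun f g => inner B f (inv_sqr1 A g)).

(* Norm of f as a functional on the space P. *)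
Definition dual_norm (B P : fspace) (f : C -> C) : R :=
  sup [set modulus (inner B f g) / ipnorm (inner P) g
      | g in [set g | P g /\ g <> cst 0]].

(* Completions of V under the norm N.  Any two are isometrically isomorphic by
   a unique map compatible with the embeddings. *)
Record completion (V : set (C -> C)) (N : (C -> C) -> R) := Completion {
  cspace :> completeNormedModType C;
  emb : (C -> C) -> cspace;
  emb_linear : forall a f g, V f -> V g ->
    emb ((a \*o f) \+ g) = a *: emb f + emb g;
  emb_norm : forall f, V f -> `|emb f| = (N f)%:C%C;
  emb_dense : dense [set emb f | f in V] }.

(* p is a continuous function on X x P extending the inner product of B. *)
Definition continuous_extension (B P : fspace) (N : (C -> C) -> R)
    (X : completion (carrier B) N) (p : X -> (C -> C) -> C) : Prop :=
  (forall f h, B f -> P h -> p (emb X f) h = inner B f h) /\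
  (forall phi h, P h -> forall eps : R, 0 < eps ->
     exists2 del : R, 0 < del & forall phi' h', P h' ->
       `|phi' - phi| < del%:C%C -> ipnorm (inner P) (h' \- h) < del ->
       modulus (p phi' h' - p phi h) < eps).

(* That extension; it is unique on X x P, as B is dense in X. *)
Definition pairing (B P : fspace) (N : (C -> C) -> R) (X : completion (carrier B) N) :
    X -> (C -> C) -> C :=
  xget (fun _ _ => 0) [set p | continuous_extension P p].

(* F_{+1}, the norm of F_{-1}, B_{+2}, and the norm of B_{-2} *)
Definition Fplus (B : fspace) : fspace := graph_space B (adjoint B (mult B)).
Definition Fminus_norm (B : fspace) : (C -> C) -> R := dual_norm B (Fplus B).
Definition Bplus2 (B : fspace) e w gamma : fspace :=
  graph_space B (S_ B e w gamma).
Definition Bminus2_norm (B : fspace) e w gamma : (C -> C) -> R :=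
  norm_m2 B (S_ B e w gamma).

Definition pairF (B : fspace) (Fm : completion (carrier B) (Fminus_norm B)) :
    Fm -> (C -> C) -> C :=
  pairing (Fplus B) (X := Fm).

Definition pair2 (B : fspace) e w gamma
    (Bm : completion (carrier B) (Bminus2_norm B e w gamma)) : Bm -> (C -> C) -> C :=
  pairing (Bplus2 B e w gamma) (X := Bm).

(* z |-> <k(.,z), psi>_F *)
Definition Fm_fun (B : fspace) (k : C -> C -> C)
    (Fm : completion (carrier B) (Fminus_norm B)) (psi : Fm) : C -> C :=
  fun z => conjc (pairF psi (k^~ z)).

(* The element of F_{-1} identified with f in assoc B, and <f, h>_F. *)
Definition Fm_of (B : fspace) (k : C -> C -> C)
    (Fm : completion (carrier B) (Fminus_norm B)) (f : C -> C) : Fm :=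
  xget 0 [set psi | Fm_fun k psi = f].

Definition assoc_pairF (B : fspace) (k : C -> C -> C)
    (Fm : completion (carrier B) (Fminus_norm B)) (f h : C -> C) : C :=
  pairF (Fm_of k Fm f) h.

Definition M0 (B : fspace) e (k : C -> C -> C) w gamma
    (Fm : completion (carrier B) (Fminus_norm B)) : set (C -> C) :=
  [set g | assoc B g /\
     forall h, dom (S_ B e w gamma) h -> assoc_pairF k Fm g h = 0].

(* V / W, as the set of cosets *)
Definition quotient (V W : set (C -> C)) : set (set (C -> C)) :=
  [set F | exists2 f, V f & F = [set f' | V f' /\ W (f' \- f)]].

(* <phi, h>_2 = <f, h>_F for every h in B_{+2} and every representative f of F *)
Definition represents (B : fspace) e (k : C -> C -> C) w gamma
    (Fm : completion (carrier B) (Fminus_norm B))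
    (Bm : completion (carrier B) (Bminus2_norm B e w gamma))
    (F : set (C -> C)) (phi : Bm) : Prop :=
  forall f h, F f -> Bplus2 B e w gamma h ->
    pair2 phi h = assoc_pairF k Fm f h.

End deBranges.

(* Main.v *)
Require Import Defs.
From HB Require Import structures.
From mathcomp Require Import all_boot all_order all_algebra.
From mathcomp Require Import complex ring lra.
From mathcomp Require Import all_classical all_reals all_analysis.
From mathcomp Require Import measurable_realfun.
Set Implicit Arguments.
Unset Strict Implicit.
Unset Printing Implicit Defensive.
Import Order.TTheory GRing.Theory Num.Theory.
Import numFieldNormedType.Exports.
Local Open Scope classical_set_scope.
Local Open Scope ring_scope.

(** Both dual spaces are Hilbert spaces of functions in disguise. By the Riesz
    representation theorem, the completion of [B] under the dual norm of a Hilbert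
    space [P] contained in [B] is [P] itself, and the continuous extension of the inner
    product of [B] becomes the inner product of [P] ([completion_dual], which rests on
    [pairing_spec]). With the graph norm of [S^*] this identifies [F_{-1}] with
    [dom S^*], and with the graph norm of [S_gamma] it identifies [B_{-2}] with
    [dom S_gamma] ([Fminus_dual], [Bminus2_dual]). In this picture a vector [v] of
    [dom S^*] corresponds to the associated function [z (S^* v) + v], because the kernel
    functions are eigenvectors of [S^*] ([assoc_of], [assoc_pairF_of]); that all
    associated functions arise in this way follows from [assoc B = z B + B]
    ([assoc_of_onto]).

    As [S_gamma] is a restriction of [S^*], a functional on [dom S^*] restricts to one on
    [dom S_gamma]. The restriction map is onto, because the functional of a vector
    [v] of [dom S_gamma] extends to that of the same [v] in [dom S^*], and its kernel
    is [M_0]. This is the theorem ([dual_quotient]).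

    The analytic content is that the operator given by the explicit formula for [S_gamma]
    is selfadjoint ([ext_sym], [ext_max]) and contained in [S^*] ([ext_adjoint]). Its
    elements are the [g] of [B] for which [z g + c s] lies in [B] for some scalar [c]. Two
    facts about the space [B(e)] suffice. First, [B] contains the quotients
    [(f - c s) / (z - w)] with vanishing numerator at [w] ([B_div]), which provides the
    resolvents. Second, [c s] is formally orthogonal to the domain of multiplication
    ([mult_defect]), since the integral over the real line of a function [G] vanishes
    when both [G] and [z G] belong to the Hardy class ([line_integral_zero]).
    Complex analysis enters through Goursat's theorem on rectangles ([goursat]), which
    yields the mean value property on discs, removable singularities ([removable]), and
    the shift of contour behind [line_integral_zero]. *)

(** * Moduli and complex differentiability in epsilon-delta form *)

Section Modulus.
Variable R : realType.
Local Notation C := R[i].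
Local Notation nc := (@Normc.normc R).
Local Notation Re := (@complex.Re R).
Local Notation Im := (@complex.Im R).

Lemma normE (z : C) : `|z| = (nc z)%:C%C. Proof. by []. Qed.

Lemma nc_ge0 (z : C) : 0 <= nc z.
Proof. by case: z => a b; apply: sqrtr_ge0. Qed.

Lemma nc0 : nc 0 = 0. Proof. exact: Normc.normc0. Qed.

Lemma ncM (x y : C) : nc (x * y) = nc x * nc y.
Proof. exact: Normc.normcM. Qed.

Lemma ncV (x : C) : nc x^-1 = (nc x)^-1.
Proof. exact: Normc.normcV. Qed.

Lemma nc_div (x y : C) : nc (x / y) = nc x / nc y.
Proof. by rewrite ncM ncV. Qed.

Lemma ncN (x : C) : nc (- x) = nc x.
Proof. by case: x => a b /=; rewrite !sqrrN. Qed.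

Lemma ncD (x y : C) : nc (x + y) <= nc x + nc y.
Proof. exact: (@le_normcD R x y). Qed.

Lemma ncB (x y : C) : nc (x - y) <= nc x + nc y.
Proof. by rewrite -(ncN y); apply: ncD. Qed.

Lemma ncC (x y : C) : nc (x - y) = nc (y - x).
Proof. by rewrite -ncN opprB. Qed.

Lemma nc_eq0 (z : C) : (nc z == 0) = (z == 0).
Proof.
by apply/eqP/eqP => [/Normc.eq0_normc//|->]; rewrite nc0.
Qed.

Lemma nc_gt0 (z : C) : (0 < nc z) = (z != 0).
Proof. by rewrite lt_def nc_ge0 andbT nc_eq0. Qed.

Lemma nc_real (x : R) : nc x%:C%C = `|x|.
Proof. by rewrite /= expr0n /= addr0 sqrtr_sqr. Qed.

Lemma nc_conj (z : C) : nc (conjc z) = nc z.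
Proof. by case: z => a b /=; rewrite sqrrN. Qed.

Lemma nc_sqr (z : C) : nc z ^+ 2 = Re z ^+ 2 + Im z ^+ 2.
Proof. by case: z => a b /=; rewrite sqr_sqrtr // addr_ge0 // sqr_ge0. Qed.

Lemma Re_le (z : C) : `|Re z| <= nc z.
Proof.
rewrite -(@ler_pXn2r _ 2) ?nnegrE ?nc_ge0 // nc_sqr real_normK ?num_real //.
by rewrite lerDl sqr_ge0.
Qed.

Lemma Im_le (z : C) : `|Im z| <= nc z.
Proof.
rewrite -(@ler_pXn2r _ 2) ?nnegrE ?nc_ge0 // nc_sqr real_normK ?num_real //.
by rewrite lerDr sqr_ge0.
Qed.

Lemma nc_le_ReIm (z : C) : nc z <= `|Re z| + `|Im z|.
Proof.
rewrite -(@ler_pXn2r _ 2) ?nnegrE ?nc_ge0 ?addr_ge0 // nc_sqr sqrrD !real_normK ?num_real //.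
by rewrite addrAC lerDl mulrn_wge0 ?mulr_ge0.
Qed.

Lemma ReD (x y : C) : Re (x + y) = Re x + Re y.
Proof. by case: x y => a b [c d]. Qed.
Lemma ImD (x y : C) : Im (x + y) = Im x + Im y.
Proof. by case: x y => a b [c d]. Qed.
Lemma ReN (x : C) : Re (- x) = - Re x.
Proof. by case: x. Qed.
Lemma ImN (x : C) : Im (- x) = - Im x.
Proof. by case: x. Qed.
Lemma ReB (x y : C) : Re (x - y) = Re x - Re y.
Proof. by rewrite ReD ReN. Qed.
Lemma ImB (x y : C) : Im (x - y) = Im x - Im y.
Proof. by rewrite ImD ImN. Qed.
Lemma ReM (x y : C) : Re (x * y) = Re x * Re y - Im x * Im y.
Proof. by case: x y => a b [c d]. Qed.
Lemma ImM (x y : C) : Im (x * y) = Re x * Im y + Im x * Re y.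
Proof. by case: x y => a b [c d]. Qed.
Lemma Re_conj (x : C) : Re (conjc x) = Re x.
Proof. by case: x. Qed.
Lemma Im_conj (x : C) : Im (conjc x) = - Im x.
Proof. by case: x. Qed.
Definition ReImE := (ReB, ImB, ReD, ImD, ReN, ImN, ReM, ImM, Re_conj, Im_conj).

Lemma complex_ext (x y : C) : Re x = Re y -> Im x = Im y -> x = y.
Proof. by case: x y => a b [c d] /= -> ->. Qed.

Lemma conjcD (x y : C) : conjc (x + y) = conjc x + conjc y.
Proof. exact: rmorphD. Qed.
Lemma conjcB (x y : C) : conjc (x - y) = conjc x - conjc y.
Proof. exact: rmorphB. Qed.
Lemma conjcN (x : C) : conjc (- x) = - conjc x.
Proof. exact: rmorphN. Qed.
Lemma conjcM (x y : C) : conjc (x * y) = conjc x * conjc y.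
Proof. exact: rmorphM. Qed.
Lemma conjcV (x : C) : conjc x^-1 = (conjc x)^-1.
Proof. exact: fmorphV. Qed.
Lemma conjc_div (x y : C) : conjc (x / y) = conjc x / conjc y.
Proof. by rewrite conjcM conjcV. Qed.
Lemma conjcr (x : R) : conjc x%:C%C = x%:C%C :> C.
Proof. by apply: complex_ext => //=; rewrite oppr0. Qed.
Definition conjcE' := (conjcB, conjcD, conjcN, conjcM, conjcV, conjcr, conjcK).

Lemma conjc_eq0 (x : C) : (conjc x == 0) = (x == 0).
Proof. by rewrite -(nc_eq0 (conjc x)) nc_conj nc_eq0. Qed.

Lemma mulc_conj (z : C) : conjc z * z = (nc z ^+ 2)%:C%C.
Proof. by apply: complex_ext; rewrite ?ReImE ?nc_sqr /=; ring. Qed.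

(** The limit in [holomorphic_at] takes its radii in the complex field itself;
    all estimates below need real radii. *)
Lemma holoP (f : C -> C) (z : C) : holomorphic_at f z <->
  exists L : C, forall eps : R, 0 < eps -> exists2 del : R, 0 < del &
    forall h : C, nc h < del -> nc (f (z + h) - f z - L * h) <= eps * nc h.
Proof.
split=> [/cvg_ex [L /= /cvgrPdist_le H]|[L H]].
  exists L => eps e0.
  have e0' : 0 < eps%:C%C :> C by rewrite ltcR.
  move: (H _ e0'); rewrite near_withinE => /nbhs_ballP [d /= d0 Hd].
  have /andP[/eqP di dr] : (complex.Im d == 0) && (0 < complex.Re d).
    by move: d0; rewrite ltcE /= eq_sym.
  exists (complex.Re d) => // h hd.
  have [->|h0] := eqVneq h 0; first by rewrite addr0 subrr mulr0 subrr !nc0 mulr0.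
  have hb : ball (0 : C^o) d h.
    rewrite -ball_normE /ball_ /= sub0r normrN.
    have -> : d = (complex.Re d)%:C%C by apply: complex_ext.
    by rewrite normE ltcR.
  move: (Hd h hb h0); rewrite /= normE lecR => Hh.
  have -> : f (z + h) - f z - L * h = - ((L - h^-1 *: (f (h *: 1 + z) - f z)) * h).
    rewrite /GRing.scale /= mulr1 (addrC h).
    by field.
  by rewrite ncN ncM ler_wpM2r ?nc_ge0.
apply/cvg_ex; exists L; apply/cvgrPdist_le => /= e e0.
have /andP[/eqP di dr] : (complex.Im e == 0) && (0 < complex.Re e).
  by move: e0; rewrite ltcE /= eq_sym.
have [d d0 Hd] := H _ dr.
rewrite near_withinE; apply/nbhs_ballP; exists d%:C%C => /=; first by rewrite ltcR.
move=> h; rewrite -ball_normE /ball_ /= sub0r normrN normE ltcR => hd h0.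
have := Hd _ hd.
have -> : e = (complex.Re e)%:C%C by apply: complex_ext.
rewrite normE lecR => Hh.
have -> : L - h^-1 *: (f (h *: 1 + z) - f z) = - ((f (z + h) - f z - L * h) / h).
  rewrite /GRing.scale /= mulr1 (addrC h).
  by field.
by rewrite ncN nc_div ler_pdivrMr ?nc_gt0.
Qed.

Definition ccont (f : C -> C) (z : C) := forall eps : R, 0 < eps ->
  exists2 del : R, 0 < del & forall z' : C, nc (z' - z) < del -> nc (f z' - f z) < eps.

Lemma holo_ccont (f : C -> C) (z : C) : holomorphic_at f z -> ccont f z.
Proof.
move=> /holoP [L HL] eps e0.
have [d d0 Hd] := HL 1 ltr01.
have k0 : 0 < 1 + nc L by rewrite ltr_pwDl ?nc_ge0.
exists (Num.min d (eps / (1 + nc L))); first by rewrite lt_min d0 divr_gt0.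
move=> z'; rewrite lt_min => /andP[h1 h2].
have := Hd _ h1; rewrite (addrC z) subrK mul1r => H.
have -> : f z' - f z = (f z' - f z - L * (z' - z)) + L * (z' - z) by ring.
apply: (le_lt_trans (ncD _ _)); rewrite ncM.
apply: (@le_lt_trans _ _ ((1 + nc L) * nc (z' - z))); first by rewrite mulrDl mul1r lerD2r.
by rewrite mulrC -ltr_pdivlMr.
Qed.

Lemma ccont_cvg (f : C -> C) (z : C) : ccont f z <-> {for z, continuous (f : C^o -> C^o)}.
Proof.
split=> [H|/cvgrPdist_lt H].
  apply: (proj2 (@cvgrPdist_lt C C^o C^o (nbhs (z : C^o)) _ f (f z))) => /= e e0.
  have /andP[/eqP di dr] : (complex.Im e == 0) && (0 < complex.Re e).
    by move: e0; rewrite ltcE /= eq_sym.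
  have [d d0 Hd] := H _ dr.
  apply/nbhs_ballP; exists d%:C%C => /=; first by rewrite ltcR.
  move=> h; rewrite -ball_normE /ball_ /= normE ltcR ncC => /Hd.
  have -> : e = (complex.Re e)%:C%C by apply: complex_ext.
  by rewrite normE ltcR ncC.
move=> eps e0.
have e0' : 0 < eps%:C%C :> C by rewrite ltcR.
move: (H _ e0') => /nbhs_ballP [d /= d0 Hd].
have /andP[/eqP di dr] : (complex.Im d == 0) && (0 < complex.Re d).
  by move: d0; rewrite ltcE /= eq_sym.
exists (complex.Re d) => // z' hz.
have : ball (z : C^o) d z'.
  rewrite -ball_normE /ball_ /=.
  have -> : d = (complex.Re d)%:C%C by apply: complex_ext.
  by rewrite normE ltcR ncC.
by move=> /Hd; rewrite normE ltcR ncC.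
Qed.

Lemma ccont_cst (c z : C) : ccont (fun=> c) z.
Proof. by move=> e e0; exists 1 => // z' _; rewrite subrr nc0. Qed.
Lemma ccont_id (z : C) : ccont id z.
Proof. by move=> e e0; exists e. Qed.
Lemma ccontD (f g : C -> C) (z : C) : ccont f z -> ccont g z -> ccont (fun x => f x + g x) z.
Proof. by move=> /ccont_cvg H1 /ccont_cvg H2; apply/ccont_cvg; exact: (@cvgD C C^o C^o (nbhs (z : C^o)) _ f g _ _ H1 H2). Qed.
Lemma ccontN (f : C -> C) (z : C) : ccont f z -> ccont (fun x => - f x) z.
Proof. by move=> /ccont_cvg H1; apply/ccont_cvg; exact: (@cvgN C C^o C^o (nbhs (z : C^o)) _ f _ H1). Qed.
Lemma ccontB (f g : C -> C) (z : C) : ccont f z -> ccont g z -> ccont (fun x => f x - g x) z.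
Proof. by move=> H1 H2; apply: ccontD => //; apply: ccontN. Qed.
Lemma ccontM (f g : C -> C) (z : C) : ccont f z -> ccont g z -> ccont (fun x => f x * g x) z.
Proof. by move=> /ccont_cvg H1 /ccont_cvg H2; apply/ccont_cvg; exact: (@cvgM C C^o (nbhs (z : C^o)) _ f g _ _ H1 H2). Qed.
Lemma ccontV (f : C -> C) (z : C) : f z != 0 -> ccont f z -> ccont (fun x => (f x)^-1) z.
Proof. by move=> h /ccont_cvg H1; apply/ccont_cvg; exact: (@cvgV C C^o (nbhs (z : C^o)) _ f _ h H1). Qed.

Lemma holo_cst (c z : C) : holomorphic_at (fun=> c) z.
Proof. exact: derivable_cst. Qed.
Lemma holo_id (z : C) : holomorphic_at id z.
Proof. exact: derivable_id. Qed.
Lemma holoD (f g : C -> C) (z : C) : holomorphic_at f z -> holomorphic_at g z ->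
  holomorphic_at (fun x => f x + g x) z.
Proof. by move=> h1 h2; exact: (@derivableD C C^o C^o f g z 1 h1 h2). Qed.
Lemma holoB (f g : C -> C) (z : C) : holomorphic_at f z -> holomorphic_at g z ->
  holomorphic_at (fun x => f x - g x) z.
Proof. by move=> h1 h2; exact: (@derivableB C C^o C^o f g z 1 h1 h2). Qed.
Lemma holoM (f g : C -> C) (z : C) : holomorphic_at f z -> holomorphic_at g z ->
  holomorphic_at (fun x => f x * g x) z.
Proof. by move=> h1 h2; exact: (@derivableM C C^o f g z 1 h1 h2). Qed.
Lemma holoV (f : C -> C) (z : C) : f z != 0 -> holomorphic_at f z -> holomorphic_at (fun x => (f x)^-1) z.
Proof. by move=> h1 h2; exact: (@derivableV C C^o f z 1 h1 h2). Qed.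
Lemma holo_div (f g : C -> C) (z : C) : g z != 0 -> holomorphic_at f z -> holomorphic_at g z ->
  holomorphic_at (fun x => f x / g x) z.
Proof. by move=> h1 h2 h3; exact: (@holoM f (fun x => (g x)^-1) z h2 (holoV h1 h3)). Qed.

Lemma holo_sharp (f : C -> C) (z : C) : holomorphic_at f (conjc z) -> holomorphic_at (sharp f) z.
Proof.
move=> /holoP [L HL]; apply/holoP; exists (conjc L) => e /HL [d d0 Hd].
exists d => // h hd; rewrite /sharp.
have := Hd (conjc h); rewrite nc_conj => /(_ hd).
suff -> : conjc (f (conjc (z + h))) - conjc (f (conjc z)) - conjc L * h =
  conjc (f (conjc z + conjc h) - f (conjc z) - L * conjc h) by rewrite nc_conj.
by rewrite !conjcE'.
Qed.

Lemma holo_near (f g : C -> C) (z : C) (r : R) : 0 < r -> (forall z', nc (z' - z) < r -> f z' = g z') ->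
  holomorphic_at f z -> holomorphic_at g z.
Proof.
move=> r0 fg /holoP [L HL]; apply/holoP; exists L => e /HL [d d0 Hd].
exists (Num.min d r); first by rewrite lt_min d0.
move=> h; rewrite lt_min => /andP[h1 h2].
rewrite -fg; last by rewrite addrC addKr.
by rewrite -(fg z) ?subrr ?nc0 //; apply: Hd.
Qed.

End Modulus.

(** * Integrals of continuous functions over compact intervals *)

Section Integral.
Variable R : realType.
Local Notation mu := (@lebesgue_measure R).

Definition cts (a b : R) (f : R -> R) :=
  forall x, a <= x <= b -> {for x, continuous f}.

Definition Iab (a b : R) (f : R -> R) : R := Rintegral mu `[a, b] f.

Lemma cts_within a b f : cts a b f -> {within `[a, b], continuous f}.
Proof.
move=> H; apply: continuous_in_subspaceT => x; rewrite inE /= in_itv /=; exact: H.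
Qed.

Lemma cts_sub a b c d f : a <= c -> d <= b -> cts a b f -> cts c d f.
Proof.
move=> ac db H x /andP[h1 h2]; apply: H.
by rewrite (le_trans ac h1) (le_trans h2 db).
Qed.

Lemma cts_int a b f : cts a b f -> mu.-integrable `[a, b] (EFin \o f).
Proof.
move=> /cts_within H; apply: continuous_compact_integrable => //.
exact: segment_compact.
Qed.

Lemma ctsD a b f g : cts a b f -> cts a b g -> cts a b (fun x => f x + g x).
Proof. move=> hf hg x hx; apply: cvgD; [exact: hf|exact: hg]. Qed.
Lemma ctsB a b f g : cts a b f -> cts a b g -> cts a b (fun x => f x - g x).
Proof. move=> hf hg x hx; apply: cvgB; [exact: hf|exact: hg]. Qed.
Lemma ctsM a b f g : cts a b f -> cts a b g -> cts a b (fun x => f x * g x).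
Proof. move=> hf hg x hx; apply: cvgM; [exact: hf|exact: hg]. Qed.
Lemma cts_cst a b c : cts a b (fun=> c).
Proof. move=> x hx; exact: cvg_cst. Qed.
Lemma cts_norm a b f : cts a b f -> cts a b (fun x => `|f x|).
Proof. move=> hf x hx; apply: cvg_norm; exact: hf. Qed.

Lemma IabD a b f g : cts a b f -> cts a b g ->
  Iab a b (fun x => f x + g x) = Iab a b f + Iab a b g.
Proof. by move=> /cts_int hf /cts_int hg; rewrite /Iab RintegralD. Qed.

Lemma IabB a b f g : cts a b f -> cts a b g ->
  Iab a b (fun x => f x - g x) = Iab a b f - Iab a b g.
Proof. by move=> /cts_int hf /cts_int hg; rewrite /Iab RintegralB. Qed.

Lemma IabZ a b k f : cts a b f -> Iab a b (fun x => k * f x) = k * Iab a b f.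
Proof. by move=> /cts_int hf; rewrite /Iab RintegralZl. Qed.

Lemma Iab_cst a b c : a <= b -> Iab a b (fun=> c) = c * (b - a).
Proof.
move=> ab; rewrite /Iab Rintegral_cst //= lebesgue_measure_itv /= lte_fin.
case: ltP => [//|ba]; have -> : a = b by apply/le_anti/andP.
by rewrite subrr.
Qed.

Lemma le_Iab a b f g : cts a b f -> cts a b g ->
  (forall x, a <= x <= b -> f x <= g x) -> Iab a b f <= Iab a b g.
Proof.
move=> /cts_int hf /cts_int hg H; exact: le_Rintegral.
Qed.

Lemma Iab_bound a b f k : a <= b -> cts a b f ->
  (forall x, a <= x <= b -> `|f x| <= k) -> `|Iab a b f| <= k * (b - a).
Proof.
move=> ab hf H; rewrite ler_norml -mulNr -!Iab_cst //.
apply/andP; split; apply: le_Iab => //; (try exact: cts_cst) => x /H; by rewrite ler_norml => /andP[].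
Qed.

Lemma eq_Iab a b f g : (forall x, a <= x <= b -> f x = g x) -> Iab a b f = Iab a b g.
Proof.
by move=> H; apply: eq_Rintegral => x; rewrite inE /= in_itv /=; exact: H.
Qed.

Lemma Iab_chasles a m b f : a <= m <= b -> cts a b f ->
  Iab a b f = Iab a m f + Iab m b f.
Proof.
move=> /andP[am mb] hf.
have h := cts_int hf.
have h1 := cts_int (cts_sub am (lexx b) hf).
have := @Rintegral_itvB R f (BLeft a) (BRight b) m h.
rewrite !bnd_simp => /(_ am mb).
rewrite Rintegral_itv_obnd_cbnd; first by rewrite /Iab => <-; rewrite addrC subrK.
apply: integrableS h1 => //; apply: subset_itvr; by rewrite bnd_simp.
Qed.

Lemma Iab_Nfun a b f : cts a b f -> Iab a b (fun x => - f x) = - Iab a b f.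
Proof.
by move=> hf; rewrite -mulN1r -IabZ //; apply: eq_Iab => x _; rewrite mulN1r.
Qed.

Lemma Iab_norm a b f : cts a b f -> `|Iab a b f| <= Iab a b (fun x => `|f x|).
Proof.
by move=> hf; apply: le_normr_Rintegral => //; exact: cts_int.
Qed.

End Integral.

(** * The Cauchy-Goursat theorem on rectangles *)

Section Goursat.
Variable R : realType.
Local Notation C := R[i].
Local Notation nc := (@Normc.normc R).
Local Notation Re := (@complex.Re R).
Local Notation Im := (@complex.Im R).

Lemma real_cvgP (f : R -> R) (x : R) : {for x, continuous f} <->
  forall eps : R, 0 < eps -> exists2 del : R, 0 < del &
    forall x', `|x' - x| < del -> `|f x' - f x| < eps.
Proof.
split=> [/cvgrPdist_lt H e /H /nbhs_ballP [d /= d0 Hd]|H].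
  exists d => // x' hx; rewrite distrC; apply: Hd.
  by rewrite -ball_normE /ball_ /= distrC.
apply/cvgrPdist_lt => e /H [d d0 Hd]; apply/nbhs_ballP; exists d => //= x'.
by rewrite /ball /= distrC => /Hd; rewrite distrC.
Qed.

Definition pcont (p : R -> C) (x : R) := forall eps : R, 0 < eps -> exists2 del : R, 0 < del &
    forall x', `|x' - x| < del -> nc (p x' - p x) < eps.

Lemma pcont_cts (F : C -> C) (p : R -> C) (x : R) : pcont p x -> ccont F (p x) ->
  {for x, continuous (fun t => Re (F (p t)))} /\
  {for x, continuous (fun t => Im (F (p t)))}.
Proof.
move=> Hp HF; split; apply/real_cvgP => e /HF [d d0 Hd];
  have [d' d'0 Hd'] := Hp _ d0; exists d' => // x' /Hd' /Hd;
  apply: le_lt_trans; rewrite -?ReB -?ImB ?Re_le ?Im_le //.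
Qed.

Lemma pcontP (p : R -> C) (x : R) : {for x, continuous (fun t => Re (p t))} ->
  {for x, continuous (fun t => Im (p t))} -> pcont p x.
Proof.
move=> /real_cvgP H1 /real_cvgP H2 e e0.
have e2 : 0 < e / 2 by rewrite divr_gt0.
have [d1 d10 Hd1] := H1 _ e2; have [d2 d20 Hd2] := H2 _ e2.
exists (Num.min d1 d2); first by rewrite lt_min d10.
move=> x'; rewrite lt_min => /andP[/Hd1 h1 /Hd2 h2].
apply: (le_lt_trans (nc_le_ReIm _)); rewrite ReB ImB; lra.
Qed.

Lemma pcont_h (y x : R) : pcont (fun x => x +i* y)%C x.
Proof. by apply: pcontP => /=; [exact: cvg_id|exact: cvg_cst]. Qed.
Lemma pcont_v (y x : R) : pcont (fun y => x +i* y)%C y.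
Proof. by apply: pcontP => /=; [exact: cvg_cst|exact: cvg_id]. Qed.

(** The real part of the integral of [F] along the boundary of the rectangle
    with corners [a + ic] and [b + id], up to sign. *)
Definition rect (F : C -> C) (a b c d : R) : R :=
  Iab a b (fun x => Re (F (x +i* d)%C) - Re (F (x +i* c)%C)) +
  Iab c d (fun y => Im (F (b +i* y)%C) - Im (F (a +i* y)%C)).

Definition on_rect (P : C -> Prop) (a b c d : R) :=
  forall x y, a <= x <= b -> c <= y <= d -> P (x +i* y)%C.

Lemma on_rect_sub P a b c d a' b' c' d' : a <= a' -> b' <= b -> c <= c' -> d' <= d ->
  on_rect P a b c d -> on_rect P a' b' c' d'.
Proof.
move=> h1 h2 h3 h4 H x y /andP[h5 h6] /andP[h7 h8]; apply: H.
  by rewrite (le_trans h1 h5) (le_trans h6 h2).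
by rewrite (le_trans h3 h7) (le_trans h8 h4).
Qed.

Section Sides.
Variables (F : C -> C) (a b c d : R).
Hypothesis HF : on_rect (ccont F) a b c d.

Lemma cts_h y : c <= y <= d -> cts a b (fun x => Re (F (x +i* y)%C)).
Proof. by move=> hy x hx; apply: (pcont_cts (pcont_h y x) (HF hx hy)).1. Qed.

Lemma cts_v x : a <= x <= b -> cts c d (fun y => Im (F (x +i* y)%C)).
Proof. by move=> hx y hy; apply: (pcont_cts (pcont_v y x) (HF hx hy)).2. Qed.

Lemma rect_splitx m : a <= m <= b -> c <= d ->
  rect F a b c d = rect F a m c d + rect F m b c d.
Proof.
move=> hm cd; rewrite /rect.
have hc : c <= c <= d by rewrite lexx.
have hd : c <= d <= d by rewrite lexx cd.
have ab : a <= b by case/andP: hm => /le_trans; apply.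
rewrite (Iab_chasles hm); last by apply: ctsB; apply: cts_h.
rewrite !IabB; try by apply: cts_v; rewrite ?hm ?lexx ?ab.
  by ring.
all: case/andP: hm => am mb; apply: cts_sub (cts_h _) => //.
Qed.

Lemma rect_splity m : c <= m <= d -> a <= b ->
  rect F a b c d = rect F a b c m + rect F a b m d.
Proof.
move=> hm ab; rewrite /rect.
have ha : a <= a <= b by rewrite lexx.
have hb : a <= b <= b by rewrite lexx ab.
have cd : c <= d by case/andP: hm => /le_trans; apply.
rewrite [X in _ + X = _](Iab_chasles hm); last by apply: ctsB; apply: cts_v.
rewrite !IabB; try by apply: cts_h; rewrite ?hm ?lexx ?cd.
  by ring.
all: case/andP: hm => am mb; apply: cts_sub (cts_v _) => //.
Qed.

End Sides.

Lemma rect_quarters F a b c d m n : on_rect (ccont F) a b c d ->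
  a <= m <= b -> c <= n <= d ->
  rect F a b c d = rect F a m c n + rect F a m n d + (rect F m b c n + rect F m b n d).
Proof.
move=> HF hm hn; have [am mb] := andP hm; have [cn nd] := andP hn.
rewrite (rect_splitx HF hm (le_trans cn nd)); congr (_ + _).
  by apply: rect_splity => //; apply: on_rect_sub HF.
by apply: rect_splity => //; apply: on_rect_sub HF.
Qed.

(** Near a point of differentiability the affine part of [F] integrates to zero,
    so the contour integral is small compared with the area. *)
Lemma rect_small (F : C -> C) (p q : R) : holomorphic_at F (p +i* q)%C ->
  forall eps : R, 0 < eps -> exists2 del : R, 0 < del &
  forall a b c d, a <= p <= b -> c <= q <= d -> on_rect (ccont F) a b c d ->
    (b - a) + (d - c) < del ->
    `|rect F a b c d| <= 2 * eps * ((b - a) + (d - c)) ^+ 2.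
Proof.
move=> /holoP [L HL] eps /[dup] e0 /HL [del d0 Hd]; exists del => // a b c d hp hq HF hD.
have [ap pb] := andP hp; have [cq qd] := andP hq.
have ab := le_trans ap pb; have cd := le_trans cq qd.
set D := (b - a) + (d - c) in hD *.
have est x y : a <= x <= b -> c <= y <= d ->
    nc (F (x +i* y)%C - F (p +i* q)%C - L * ((x - p) +i* (y - q))%C) <= eps * D.
  move=> /andP[ax xb] /andP[cy yd].
  have hle : nc ((x - p) +i* (y - q))%C <= D.
    apply: (le_trans (nc_le_ReIm _)) => /=.
    by apply: lerD; rewrite ler_norml; apply/andP; split; lra.
  have := Hd _ (le_lt_trans hle hD).
  have -> : (p +i* q)%C + ((x - p) +i* (y - q))%C = (x +i* y)%C.
    by apply: complex_ext => /=; ring.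
  by move=> h; apply: (le_trans h); rewrite ler_wpM2l // ltW.
have ha : a <= a <= b by rewrite lexx.
have hb : a <= b <= b by rewrite lexx ab.
have hc : c <= c <= d by rewrite lexx.
have hd' : c <= d <= d by rewrite lexx cd.
have D0 : 0 <= D by rewrite addr_ge0 ?subr_ge0.
have hor : `|Iab a b (fun x => Re (F (x +i* d)%C) - Re (F (x +i* c)%C)) -
    (- Im L * (d - c)) * (b - a)| <= 2 * eps * D * (b - a).
  rewrite -(Iab_cst (- Im L * (d - c)) ab) -IabB; [|by apply: ctsB; apply: (cts_h HF)|exact: cts_cst].
  apply: Iab_bound => //.
    by apply: ctsB; [apply: ctsB; apply: (cts_h HF)|exact: cts_cst].
  move=> x hx.
  have := le_trans (Re_le _) (est x d hx hd').
  have := le_trans (Re_le _) (est x c hx hc).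
  rewrite !ReImE /= !ler_norml => /andP[? ?] /andP[? ?]; apply/andP; split; lra.
have ver : `|Iab c d (fun y => Im (F (b +i* y)%C) - Im (F (a +i* y)%C)) -
    (Im L * (b - a)) * (d - c)| <= 2 * eps * D * (d - c).
  rewrite -(Iab_cst (Im L * (b - a)) cd) -IabB; [|by apply: ctsB; apply: (cts_v HF)|exact: cts_cst].
  apply: Iab_bound => //.
    by apply: ctsB; [apply: ctsB; apply: (cts_v HF)|exact: cts_cst].
  move=> y hy.
  have := le_trans (Im_le _) (est b y hb hy).
  have := le_trans (Im_le _) (est a y ha hy).
  rewrite !ReImE /= !ler_norml => /andP[? ?] /andP[? ?]; apply/andP; split; lra.
rewrite /rect.
have := lerD hor ver => /(le_trans (ler_normD _ _)).
set I1 := Iab a b _; set I2 := Iab c d _ => h.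
rewrite (_ : I1 + I2 = I1 - - Im L * (d - c) * (b - a) + (I2 - Im L * (b - a) * (d - c))); last by ring.
apply: (le_trans h); rewrite le_eqVlt; apply/orP; left; apply/eqP; rewrite /D; ring.
Qed.

Section Bisection.
Variables (F : C -> C) (a b c d : R).
Hypotheses (ab : a <= b) (cd : c <= d).
Hypothesis HF : on_rect (holomorphic_at F) a b c d.

Let k0 : R := `|rect F a b c d|.
Let wd n : R := (b - a) * 2^-1 ^+ n.
Let ht n : R := (d - c) * 2^-1 ^+ n.

Definition large n (p : R * R) : Prop :=
  [/\ a <= p.1, p.1 + wd n <= b, c <= p.2, p.2 + ht n <= d &
      k0 * (4^-1) ^+ n <= `|rect F p.1 (p.1 + wd n) p.2 (p.2 + ht n)|].

Let refines n (p p' : R * R) : Prop :=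
  [/\ large n.+1 p', p.1 <= p'.1, p'.1 + wd n.+1 <= p.1 + wd n,
      p.2 <= p'.2 & p'.2 + ht n.+1 <= p.2 + ht n].

Lemma wdS n : wd n = wd n.+1 + wd n.+1.
Proof. by rewrite /wd exprS; field. Qed.
Lemma htS n : ht n = ht n.+1 + ht n.+1.
Proof. by rewrite /ht exprS; field. Qed.
Lemma wd_ge0 n : 0 <= wd n.
Proof. by rewrite mulr_ge0 ?subr_ge0 // exprn_ge0 // invr_ge0. Qed.
Lemma ht_ge0 n : 0 <= ht n.
Proof. by rewrite mulr_ge0 ?subr_ge0 // exprn_ge0 // invr_ge0. Qed.

Lemma large_refine n p : large n p -> exists p', refines n p p'.
Proof.
case: p => x y [/= h1 h2 h3 h4 h5].
have w0 := wd_ge0 n.+1; have t0 := ht_ge0 n.+1.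
rewrite (wdS n) in h2 h5; rewrite (htS n) in h4 h5.
have HC : on_rect (ccont F) x (x + (wd n.+1 + wd n.+1)) y (y + (ht n.+1 + ht n.+1)).
  apply: on_rect_sub (h1) (h2) (h3) (h4) _ => u v hu hv; exact/holo_ccont/HF.
move: h5; rewrite (rect_quarters (m := x + wd n.+1) (n := y + ht n.+1) HC); last 2 first.
  by apply/andP; split; lra.
  by apply/andP; split; lra.
set r1 := rect _ _ _ _ _; set r2 := rect _ _ _ _ _.
set r3 := rect _ _ _ _ _; set r4 := rect _ _ _ _ _ => h5.
have hk : k0 * 4^-1 ^+ n = 4 * (k0 * 4^-1 ^+ n.+1) by rewrite exprS; field.
have h6 : `|r1 + r2 + (r3 + r4)| <= `|r1| + `|r2| + `|r3| + `|r4|.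
  rewrite addrA.
  by rewrite (le_trans (ler_normD _ _)) // lerD2r (le_trans (ler_normD _ _)) // lerD2r ler_normD.
rewrite hk in h5.
set kn := k0 * _ in h5.
have [i1|i1] := lerP kn `|r1|.
  by exists (x, y); rewrite /refines /large /= (wdS n) (htS n); split=> //; (try split => //); rewrite ?lerD2l ?lerDl //; lra.
have [i2|i2] := lerP kn `|r2|.
  exists (x, y + ht n.+1); rewrite /refines /large /= (wdS n) (htS n) -!addrA.
  by split=> //; (try split => //); rewrite ?lerD2l ?lerDl //; lra.
have [i3|i3] := lerP kn `|r3|.
  exists (x + wd n.+1, y); rewrite /refines /large /= (wdS n) (htS n) -!addrA.
  by split=> //; (try split => //); rewrite ?lerD2l ?lerDl //; lra.
have [i4|i4] := lerP kn `|r4|.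
  exists (x + wd n.+1, y + ht n.+1); rewrite /refines /large /= (wdS n) (htS n) -!addrA.
  by split=> //; (try split => //); rewrite ?lerD2l ?lerDl //; lra.
lra.
Qed.

Let fix_seq : nat -> R * R := fix s n :=
  if n is m.+1 then xget (0, 0) (refines m (s m)) else (a, c).

Let fix_large n : large n (fix_seq n).
Proof.
elim: n => [|n IH].
  rewrite /large /wd /ht /= !expr0 !mulr1.
  have -> : a + (b - a) = b by ring.
  have -> : c + (d - c) = d by ring.
  by split=> //=.
by rewrite /=; case: (xgetPex (0, 0) (large_refine IH)).
Qed.

Let fix_refines n : refines n (fix_seq n) (fix_seq n.+1).
Proof. exact: (xgetPex (0, 0) (large_refine (fix_large n))). Qed.

Lemma nested_point (x w : nat -> R) : (forall n, x n <= x n.+1) ->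
  (forall n, x n.+1 + w n.+1 <= x n + w n) -> (forall n, 0 <= w n) ->
  exists p, forall n, x n <= p <= x n + w n.
Proof.
move=> h1 h2 w0.
have mon m n : (m <= n)%N -> x m <= x n.
  move=> /subnK <-; elim: (n - m)%N => [|k IH]; first by rewrite add0n.
  by rewrite addSn (le_trans IH).
have mon' m n : (m <= n)%N -> x n + w n <= x m + w m.
  move=> /subnK <-; elim: (n - m)%N => [|k IH]; first by rewrite add0n.
  by rewrite addSn (le_trans (h2 _)).
have ub m n : x n <= x m + w m.
  have [/mon'|/ltnW /mon] := leqP m n.
    by apply: le_trans; rewrite lerDl.
  by move=> /le_trans; apply; rewrite lerDl.
have hs : has_sup (range x).
  by split; [exists (x 0%N); exists 0%N|exists (x 0%N + w 0%N) => _ [n _ <-]].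
exists (sup (range x)) => n; apply/andP; split.
  by apply: ub_le_sup; [case: hs|exists n].
by apply: ge_sup; [case: hs|move=> _ [m _ <-]].
Qed.

(** Goursat: if the integral did not vanish, one quarter of the rectangle would carry
    a quarter of it, and so on; at the limit point this contradicts
    differentiability. *)
Theorem goursat : rect F a b c d = 0.
Proof.
apply/eqP; rewrite -normr_eq0 -/k0; apply/negPn/negP => kn0.
have kp : 0 < k0 by rewrite lt_def kn0 /k0 normr_ge0.
have [p hp] := nested_point (x := fun n => (fix_seq n).1) (w := wd)
  (fun n => let: And5 _ h _ _ _ := fix_refines n in h)
  (fun n => let: And5 _ _ h _ _ := fix_refines n in h) wd_ge0.
have [q hq] := nested_point (x := fun n => (fix_seq n).2) (w := ht)
  (fun n => let: And5 _ _ _ h _ := fix_refines n in h)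
  (fun n => let: And5 _ _ _ _ h := fix_refines n in h) ht_ge0.
have hol : holomorphic_at F (p +i* q)%C.
  apply: HF; [have := hp 0%N|have := hq 0%N]; rewrite /= /wd /ht expr0 mulr1;
  by rewrite (addrC _ (_ - _)) subrK.
set S := (b - a) + (d - c).
have S0 : 0 <= S by rewrite addr_ge0 ?subr_ge0.
have e0 : 0 < k0 / (4 * (S ^+ 2 + 1)).
  by rewrite divr_gt0 // mulr_gt0 // ltr_wpDl // sqr_ge0.
have [del d0 Hd] := rect_small hol e0.
have [n hn] : exists n, S * 2^-1 ^+ n < del.
  have : (S * 2^-1 ^+ n) @[n --> \oo] --> S * 0.
    apply: cvgMr; apply: cvg_expr; rewrite ger0_norm ?invr_ge0 //; lra.
  rewrite mulr0 => /cvgrPdist_lt /(_ _ d0) [N _ HN].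
  exists N; have := HN N (leqnn N); rewrite /= sub0r normrN ger0_norm //.
  by rewrite mulr_ge0 // exprn_ge0 // invr_ge0.
have [h1 h2 h3 h4 h5] := fix_large n.
have HC : on_rect (ccont F) (fix_seq n).1 ((fix_seq n).1 + wd n) (fix_seq n).2 ((fix_seq n).2 + ht n).
  by apply: on_rect_sub h1 h2 h3 h4 _ => u v hu hv; exact/holo_ccont/HF.
have := Hd _ _ _ _ (hp n) (hq n) HC.
rewrite (_ : _ + wd n - _ + (_ + ht n - _) = S * 2^-1 ^+ n); last by rewrite /wd /ht /S; ring.
move=> /(_ hn).
move=> /(le_trans h5).
rewrite exprMn -exprM mulnC exprM.
have -> : (2^-1 : R) ^+ 2 = 4^-1 by field.
rewrite [_ * (S ^+ 2 * _)]mulrA ler_pM2r ?exprn_gt0 ?invr_gt0 //.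
have -> : 2 * (k0 / (4 * (S ^+ 2 + 1))) * S ^+ 2 = (k0 / 2) * (S ^+ 2 / (S ^+ 2 + 1)).
  by field; have := sqr_ge0 S; lra.
have : S ^+ 2 / (S ^+ 2 + 1) <= 1 by rewrite ler_pdivrMr ?mul1r ?lerDl // ltr_wpDl // sqr_ge0.
move=> hh; have : k0 / 2 * (S ^+ 2 / (S ^+ 2 + 1)) <= k0 / 2 by rewrite ler_piMr // ltW // divr_gt0.
lra.
Qed.

End Bisection.
End Goursat.

(** * The mean value property and removable singularities *)

Section Uniformity.
Variable R : realType.
Local Notation C := R[i].
Local Notation nc := (@Normc.normc R).
Local Notation Re := (@complex.Re R).
Local Notation Im := (@complex.Im R).

(** A choice of radius that is possible near each point of a segment is possible on the
    whole segment, by compactness in its near-covering form. *)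
Lemma seg_unif (a b : R) (P : R -> R -> Prop) :
  (forall x, a <= x <= b -> exists2 d : R, 0 < d &
     forall x', `|x' - x| < d -> forall del, 0 < del < d -> P del x') ->
  exists2 d : R, 0 < d & forall del, 0 < del < d -> forall x, a <= x <= b -> P del x.
Proof.
move=> H.
have /compact_near_coveringP cov := @segment_compact R a b.
have [x|d /= d0 Hd] := cov R (0^'+) P _.
  rewrite /= in_itv /= => /H [d d0 Hd].
  exists (ball x d, [set del : R | 0 < del < d]); last first.
    by case=> x' del [/= h1 h2]; apply: Hd => //; rewrite distrC.
  split=> /=; first exact: nbhsx_ballx.
  exists d => //= del h1 h2; rewrite h2 /=.
  have : `|0 - del| < d by exact: h1.
  by rewrite sub0r normrN; apply: le_lt_trans (ler_norm _).
exists d => // del /andP[h1 h2] x hx.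
by apply: (Hd del _ h1) => /=; rewrite ?in_itv //= sub0r normrN gtr0_norm.
Qed.

Lemma rect_unif (a b c d : R) (P : R -> R -> R -> Prop) :
  (forall x y, a <= x <= b -> c <= y <= d -> exists2 e : R, 0 < e &
     forall x' y', `|x' - x| < e -> `|y' - y| < e -> forall del, 0 < del < e -> P del x' y') ->
  exists2 e : R, 0 < e & forall del, 0 < del < e ->
    forall x y, a <= x <= b -> c <= y <= d -> P del x y.
Proof.
move=> H.
have [x hx|e e0 He] := @seg_unif a b (fun del x => forall y, c <= y <= d -> P del x y).
  have [y hy|e e0 He] := @seg_unif c d (fun del y => forall x', `|x' - x| < del ->
      forall del', 0 < del' < del -> P del' x' y).
    have [e e0 He] := H x y hx hy; exists e => // y' hy' del /andP[del0 h1] x' hx' del' /andP[h2 h3].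
    by apply: He => //; [exact: lt_trans hx' _|rewrite h2 (lt_trans h3)].
  exists (e / 2); first by rewrite divr_gt0.
  move=> x' hx' del /andP[h1 h2] y hy; apply: (He (e / 2)) => //; rewrite ?h1 //; lra.
by exists e => // del hdel x y hx hy; apply: He.
Qed.

Lemma rect_bounded (F : C -> C) (a b c d : R) : on_rect (ccont F) a b c d ->
  exists2 K : R, 0 < K & on_rect (fun z => nc (F z) <= K) a b c d.
Proof.
move=> HF.
have [x y hx hy|e e0 He] := @rect_unif a b c d (fun del x y => nc (F (x +i* y)%C) <= del^-1).
  have [e e0 He] := HF x y hx hy _ ltr01.
  have m0 : 0 < nc (F (x +i* y)%C) + 1 by rewrite ltr_wpDl ?nc_ge0.
  exists (Num.min (e / 2) (nc (F (x +i* y)%C) + 1)^-1).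
    by rewrite lt_min divr_gt0 // invr_gt0.
  move=> x' y'; rewrite !lt_min => /andP[h1 _] /andP[h2 _] del /andP[del0].
  rewrite lt_min => /andP[_ h3].
  have : nc (F (x' +i* y')%C - F (x +i* y)%C) < 1.
    apply: He; apply: (le_lt_trans (nc_le_ReIm _)) => /=; lra.
  move=> h4; have := ncD (F (x' +i* y')%C - F (x +i* y)%C) (F (x +i* y)%C); rewrite subrK => h5.
  apply: (@le_trans _ _ (nc (F (x +i* y)%C) + 1)); first by lra.
  by rewrite -[leLHS]invrK lef_pV2 ?posrE ?invr_gt0 // ltW.
exists (e / 2)^-1; first by rewrite invr_gt0 divr_gt0.
move=> x y hx hy; apply: He => //; apply/andP; split; lra.
Qed.

Lemma is_derive_eps (f : R -> R) (x L : R) : is_derive x 1 f L ->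
  forall eps : R, 0 < eps -> exists2 del : R, 0 < del &
  forall h, `|h| < del -> `|f (x + h) - f x - L * h| <= eps * `|h|.
Proof.
move=> [/cvg_ex [l /= Hl] dfL] e e0.
have lL : l = L by rewrite -dfL; apply/esym/cvg_lim.
move: Hl => /cvgrPdist_le /(_ _ e0); rewrite near_withinE => /nbhs_ballP [d /= d0 Hd].
exists d => // h hd.
have [->|h0] := eqVneq h 0; first by rewrite addr0 subrr mulr0 subrr normr0 mulr0.
have := Hd h; rewrite /ball /= sub0r normrN => /(_ hd h0); rewrite lL.
have -> : f (x + h) - f x - L * h = - ((L - h^-1 *: (f (h *: 1 + x) - f x)) * h).
  by rewrite /GRing.scale /= mulr1 (addrC h); field.
by rewrite normrN normrM => Hh; rewrite ler_wpM2r.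
Qed.

Lemma holo_comp (F G : C -> C) (z : C) : holomorphic_at G z -> holomorphic_at F (G z) ->
  holomorphic_at (fun x => F (G x)) z.
Proof.
move=> /[dup] /holo_ccont cG /holoP [M HM] /holoP [L HL]; apply/holoP; exists (L * M) => e e0.
have k0 : 0 < 2 * (1 + nc M) by rewrite mulr_gt0 // ltr_pwDl ?nc_ge0.
have l0 : 0 < 2 * (1 + nc L) by rewrite mulr_gt0 // ltr_pwDl ?nc_ge0.
have [d1 d10 H1] := HL _ (divr_gt0 e0 k0).
have [d2 d20 H2] := HM _ (divr_gt0 e0 l0).
have [d3 d30 H3] := HM _ ltr01.
have [d4 d40 H4] := cG _ d10.
exists (Num.min (Num.min d2 d3) d4); first by rewrite !lt_min d20 d30.
move=> h; rewrite !lt_min => /andP[/andP[h2 h3] h4].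
set k := G (z + h) - G z.
have hk : nc k <= (1 + nc M) * nc h.
  have -> : k = (k - M * h) + M * h by ring.
  apply: (le_trans (ncD _ _)); rewrite ncM mulrDl lerD2r; exact: H3.
have kd : nc k < d1 by apply: H4; rewrite addrC addKr.
have := H1 _ kd; rewrite (addrC (G z)) subrK => h5.
have h6 := H2 _ h2.
have -> : F (G (z + h)) - F (G z) - L * M * h =
   (F (G (z + h)) - F (G z) - L * k) + L * (k - M * h) by ring.
apply: (le_trans (ncD _ _)); rewrite (ncM L).
have h7 : e / (2 * (1 + nc M)) * nc k <= e / 2 * nc h.
  apply: (@le_trans _ _ (e / (2 * (1 + nc M)) * ((1 + nc M) * nc h))).
    by rewrite ler_wpM2l // ltW // divr_gt0.
  rewrite le_eqVlt; apply/orP; left; apply/eqP; field; have := nc_ge0 M; lra.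
have h8 : nc L * nc (k - M * h) <= e / 2 * nc h.
  apply: (@le_trans _ _ ((1 + nc L) * (e / (2 * (1 + nc L)) * nc h))).
    by apply: ler_pM => //; rewrite ?nc_ge0 // lerDr.
  rewrite le_eqVlt; apply/orP; left; apply/eqP; field; have := nc_ge0 L; lra.
lra.
Qed.

(** The exponential is only needed as a map that sends rectangles to annuli, so it is
    introduced by its real and imaginary parts. *)
Definition cexp (z : C) : C := (expR (Re z) * cos (Im z) +i* (expR (Re z) * sin (Im z)))%C.

Lemma cexpD (y z : C) : cexp (y + z) = cexp y * cexp z.
Proof.
by apply: complex_ext; rewrite /cexp ?ReImE /= ?expRD ?cosD ?sinD; ring.
Qed.

Lemma cexp_holo (z : C) : holomorphic_at cexp z.
Proof.
apply/holoP; exists (cexp z) => e e0.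
have n0 : 0 < nc (cexp z) + 1 by rewrite ltr_wpDl ?nc_ge0.
pose e1 := Num.min 1 (e / (nc (cexp z) + 1) / 8).
have e10 : 0 < e1 by rewrite lt_min ltr01 !divr_gt0.
have e11 : e1 <= 1 by rewrite ge_min lexx.
have e12 : e1 <= e / (nc (cexp z) + 1) / 8 by rewrite ge_min lexx orbT.
have [d1 d10 H1] := is_derive_eps (is_derive_expR 0) e10.
have [d2 d20 H2] := is_derive_eps (is_derive_cos 0) e10.
have [d3 d30 H3] := is_derive_eps (is_derive_sin 0) e10.
exists (Num.min (Num.min d1 d2) (Num.min d3 (e1 / 2))).
  by rewrite !lt_min d10 d20 d30 divr_gt0.
move=> h; rewrite !lt_min => /andP[/andP[h1 h2] /andP[h3 h4]].
have -> : cexp (z + h) - cexp z - cexp z * h = cexp z * (cexp h - 1 - h).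
  by rewrite cexpD; ring.
rewrite ncM.
suff Hs : nc (cexp h - 1 - h) <= 8 * e1 * nc h.
  apply: (@le_trans _ _ ((nc (cexp z) + 1) * ((8 * e1) * nc h))).
    by apply: ler_pM => //; rewrite ?nc_ge0 // lerDl.
  rewrite mulrA ler_wpM2r ?nc_ge0 //.
  have : (nc (cexp z) + 1) * (8 * e1) <= (nc (cexp z) + 1) * (8 * (e / (nc (cexp z) + 1) / 8)).
    by rewrite !ler_pM2l.
  move=> /le_trans; apply; rewrite le_eqVlt; apply/orP; left; apply/eqP; field; lra.
case: h h1 h2 h3 h4 => a b h1 h2 h3 h4.
have ra : `|a| <= nc (a +i* b)%C by exact: (Re_le (a +i* b)%C).
have rb : `|b| <= nc (a +i* b)%C by exact: (Im_le (a +i* b)%C).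
set n := nc _ in h1 h2 h3 h4 ra rb *.
have := H1 a (le_lt_trans ra h1); have := H2 b (le_lt_trans rb h2).
have := H3 b (le_lt_trans rb h3).
rewrite !add0r expR0 cos0 sin0 oppr0 mul0r !(subr0, addr0) !mul1r => k3 k2 k1.
have n0' : 0 <= n by rewrite nc_ge0.
have k1' : `|expR a - 1 - a| <= e1 * n by apply: (le_trans k1); rewrite ler_wpM2l // ltW.
have k2' : `|cos b - 1| <= e1 * n by apply: (le_trans k2); rewrite ler_wpM2l // ltW.
have k3' : `|sin b - b| <= e1 * n by apply: (le_trans k3); rewrite ler_wpM2l // ltW.
have n1 : n <= e1 / 2 by rewrite ltW.
have e1n : 0 <= e1 * n by rewrite mulr_ge0 // ltW.
apply: (le_trans (nc_le_ReIm _)); rewrite !ReImE /= subr0.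
have hexp : `|expR a - 1| <= 2 * n.
  have -> : expR a - 1 = (expR a - 1 - a) + a by ring.
  apply: (le_trans (ler_normD _ _)).
  have : e1 * n <= 1 * n by rewrite ler_wpM2r.
  by move=> ?; lra.
have hre : `|expR a * cos b - 1 - a| <= 4 * e1 * n.
  have -> : expR a * cos b - 1 - a = (expR a - 1 - a) + (expR a - 1) * (cos b - 1) + (cos b - 1) by ring.
  apply: (le_trans (ler_normD _ _)); apply: (le_trans (lerD (ler_normD _ _) (lexx _))).
  rewrite normrM.
  have : `|expR a - 1| * `|cos b - 1| <= (2 * n) * (e1 * n) by apply: ler_pM.
  have : (2 * n) * (e1 * n) <= 1 * (e1 * n).
    by rewrite ler_wpM2r ?mulr_ge0 // ?ltW //; lra.
  by move=> ? ?; lra.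
have him : `|expR a * sin b - b| <= 4 * e1 * n.
  have -> : expR a * sin b - b = (expR a - 1) * (sin b - b) + (expR a - 1) * b + (sin b - b) by ring.
  apply: (le_trans (ler_normD _ _)); apply: (le_trans (lerD (ler_normD _ _) (lexx _))).
  rewrite !normrM.
  have : `|expR a - 1| * `|sin b - b| <= (2 * n) * (e1 * n) by apply: ler_pM.
  have : (2 * n) * (e1 * n) <= 1 * (e1 * n).
    by rewrite ler_wpM2r ?mulr_ge0 // ?ltW //; lra.
  have : `|expR a - 1| * `|b| <= (2 * n) * (e1 / 2) by apply: ler_pM => //; lra.
  by move=> ? ? ?; lra.
lra.
Qed.

End Uniformity.
Section Circles.
Variable R : realType.
Local Notation C := R[i].
Local Notation nc := (@Normc.normc R).
Local Notation Re := (@complex.Re R).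
Local Notation Im := (@complex.Im R).

Definition circ (w : C) (r t : R) : C := w + (r * cos t +i* (r * sin t))%C.

Lemma nc_polar (r t : R) : nc (r * cos t +i* (r * sin t))%C = `|r|.
Proof.
rewrite /= !exprMn -mulrDr cos2Dsin2 mulr1; exact: sqrtr_sqr.
Qed.

Lemma nc_circ w r t : nc (circ w r t - w) = `|r|.
Proof. by rewrite /circ addrC addKr nc_polar. Qed.

Lemma circ_pcont w r t : pcont (circ w r) t.
Proof.
apply: pcontP; rewrite /circ.
  rewrite (_ : (fun t0 => _) = (fun t0 => Re w + r * cos t0)); last first.
    by apply/funext => t0; rewrite ReImE.
  apply: cvgD; first exact: cvg_cst.
  by apply: cvgM; [exact: cvg_cst|exact: continuous_cos].
rewrite (_ : (fun t0 => _) = (fun t0 => Im w + r * sin t0)); last first.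
  by apply/funext => t0; rewrite ReImE.
apply: cvgD; first exact: cvg_cst.
by apply: cvgM; [exact: cvg_cst|exact: continuous_sin].
Qed.

Local Notation twopi := (2 * @pi R).

Lemma twopi_ge0 : 0 <= twopi. Proof. by rewrite mulr_ge0 // pi_ge0. Qed.

(** The integral in the angle, not divided by [2 pi]. *)
Definition avg (f : C -> C) (w : C) (r : R) : C :=
  (Iab 0 twopi (fun t => Re (f (circ w r t))) +i* Iab 0 twopi (fun t => Im (f (circ w r t))))%C.

Lemma circ_cts (f : C -> C) w r : (forall z, nc (z - w) = `|r| -> ccont f z) ->
  cts 0 twopi (fun t => Re (f (circ w r t))) /\ cts 0 twopi (fun t => Im (f (circ w r t))).
Proof.
move=> H; split=> t _; have := pcont_cts (@circ_pcont w r t) (H _ (nc_circ _ _ _));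
by case.
Qed.

Lemma eq_avg (f g : C -> C) w r : (forall z, nc (z - w) = `|r| -> f z = g z) ->
  avg f w r = avg g w r.
Proof.
by move=> H; apply: complex_ext; rewrite /=; apply: eq_Iab => t _; rewrite H ?nc_circ.
Qed.

Lemma avgB (f g : C -> C) w r : (forall z, nc (z - w) = `|r| -> ccont f z) ->
  (forall z, nc (z - w) = `|r| -> ccont g z) ->
  avg (fun z => f z - g z) w r = avg f w r - avg g w r.
Proof.
move=> /circ_cts [f1 f2] /circ_cts [g1 g2]; apply: complex_ext; rewrite !ReImE /= -IabB //;
by apply: eq_Iab => t _; rewrite !ReImE.
Qed.

Lemma avgZ (k : C) (f : C -> C) w r : (forall z, nc (z - w) = `|r| -> ccont f z) ->
  avg (fun z => k * f z) w r = k * avg f w r.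
Proof.
move=> /circ_cts [f1 f2]; apply: complex_ext; rewrite !ReImE /= -!IabZ //.
  rewrite -IabB; try by apply: ctsM => //; exact: cts_cst.
  by apply: eq_Iab => t _; rewrite !ReImE.
rewrite -IabD; try by apply: ctsM => //; exact: cts_cst.
by apply: eq_Iab => t _; rewrite !ReImE.
Qed.

Lemma avg_bound (f : C -> C) w r K : (forall z, nc (z - w) = `|r| -> ccont f z) ->
  (forall z, nc (z - w) = `|r| -> nc (f z) <= K) -> nc (avg f w r) <= 2 * (K * twopi).
Proof.
move=> /circ_cts [f1 f2] H; apply: (le_trans (nc_le_ReIm _)) => /=.
rewrite (_ : 2 * _ = K * (twopi - 0) + K * (twopi - 0)); last by ring.
by apply: lerD; apply: Iab_bound; rewrite ?twopi_ge0 // => t _;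
  [apply: (le_trans (Re_le _))|apply: (le_trans (Im_le _))]; apply: H; rewrite nc_circ.
Qed.

(** In the logarithmic coordinate [z = w + e^(s + it)] an annulus is a rectangle
    whose horizontal sides carry equal values. *)
Lemma avg_annulus (f : C -> C) (w : C) (r1 r2 : R) : 0 < r1 -> r1 <= r2 ->
  (forall z, r1 <= nc (z - w) <= r2 -> holomorphic_at f z) -> avg f w r1 = avg f w r2.
Proof.
move=> r10 r12; have r20 := lt_le_trans r10 r12.
have im g : (forall z, r1 <= nc (z - w) <= r2 -> holomorphic_at g z) ->
    Im (avg g w r1) = Im (avg g w r2).
  move=> Hg.
  have cE r t : 0 < r -> w + cexp (ln r +i* t)%C = circ w r t.
    by move=> r0; rewrite /cexp /circ /= lnK // posrE.
  have l12 : ln r1 <= ln r2 by rewrite ler_ln ?posrE.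
  have HG : on_rect (holomorphic_at (fun z => g (w + cexp z))) (ln r1) (ln r2) 0 twopi.
    move=> x y /andP[h1 h2] _; apply: (@holo_comp R g (fun z => w + cexp z)).
      by apply: holoD; [exact: holo_cst|exact: cexp_holo].
    apply: Hg; rewrite -(expRK x) cE ?expR_gt0 // nc_circ ger0_norm ?expR_ge0 //.
    by rewrite -(@lnK _ r1) ?posrE // -(@lnK _ r2) ?posrE // !ler_expR h1.
  have := goursat l12 twopi_ge0 HG; rewrite /rect.
  rewrite (_ : (fun x => _ - _) = (fun=> 0)); last first.
    apply/funext => x.
    have -> : cexp (x +i* twopi)%C = cexp (x +i* 0)%C.
      by rewrite /cexp /= mulr_natl cos2pi sin2pi cos0 sin0.
    by rewrite subrr.
  rewrite Iab_cst // mul0r add0r.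
  rewrite (_ : (fun y => _ - _) = (fun t => Im (g (circ w r2 t)) - Im (g (circ w r1 t)))); last first.
    by apply/funext => t; rewrite !cE.
  have c1 := (@circ_cts g w r1 _).2; have c2 := (@circ_cts g w r2 _).2.
  rewrite IabB; [|apply: c2|apply: c1].
    by move=> /eqP; rewrite subr_eq0 => /eqP /= ->.
  - by move=> z hz; apply: holo_ccont; apply: Hg; rewrite hz (gtr0_norm r20) r12 lexx.
  by move=> z hz; apply: holo_ccont; apply: Hg; rewrite hz (gtr0_norm r10) r12 lexx.
move=> Hf; apply: complex_ext; last exact: im.
have := im (fun z => 'i%C * f z) (fun z hz => holoM (@holo_cst R 'i%C z) (Hf z hz)).
rewrite /= => h.
have eqI r : Iab 0 twopi (fun t => Im ('i%C * f (circ w r t))) = Iab 0 twopi (fun t => Re (f (circ w r t))).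
  by apply: eq_Iab => t _; rewrite ReImE /=; ring.
by rewrite -!eqI.
Qed.

Lemma avg_cont (f : C -> C) (w : C) (rho r0 : R) : 0 <= r0 <= rho ->
  (forall z, nc (z - w) <= rho -> ccont f z) ->
  forall eps : R, 0 < eps -> exists2 del : R, 0 < del &
  forall r, 0 <= r <= rho -> `|r - r0| < del -> nc (avg f w r - avg f w r0) <= eps.
Proof.
move=> hr0 Hf eps eps0.
have [r00 r0r] := andP hr0.
pose e1 := eps / (2 * (twopi + 1)).
have tp := twopi_ge0.
have e10 : 0 < e1 by rewrite divr_gt0 // mulr_gt0 // ltr_wpDl.
have cc r : 0 <= r <= rho -> forall z, nc (z - w) = `|r| -> ccont f z.
  by move=> /andP[h1 h2] z hz; apply: Hf; rewrite hz ger0_norm.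
have [t _|d d0 Hd] := @seg_unif R 0 twopi (fun del t => forall r, 0 <= r <= rho -> `|r - r0| < del ->
    nc (f (circ w r t) - f (circ w r0 t)) <= e1).
  have [d d0 Hd] := cc _ hr0 (circ w r0 t) (nc_circ _ _ _) _ (divr_gt0 e10 (ltr0Sn _ 1)).
  have [d' d'0 Hd'] := @circ_pcont w r0 t _ (divr_gt0 d0 (ltr0Sn _ 1)).
  exists (Num.min d' (d / 2)); first by rewrite lt_min d'0 divr_gt0.
  move=> t'; rewrite lt_min => /andP[ht' _] del /andP[_]; rewrite lt_min => /andP[_ hdel] r hr hrr.
  have k1 : nc (circ w r0 t' - circ w r0 t) < d / 2 by apply: Hd'.
  have k2 : nc (circ w r t' - circ w r0 t') < d / 2.
    have -> : circ w r t' - circ w r0 t' = ((r - r0) * cos t' +i* ((r - r0) * sin t'))%C.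
      by apply: complex_ext; rewrite /circ !ReImE /=; ring.
    by rewrite nc_polar (lt_trans hrr).
  have k3 : nc (circ w r t' - circ w r0 t) < d.
    have -> : circ w r t' - circ w r0 t = (circ w r t' - circ w r0 t') + (circ w r0 t' - circ w r0 t) by ring.
    apply: (le_lt_trans (ncD _ _)); lra.
  have k4 : nc (circ w r0 t' - circ w r0 t) < d by lra.
  have := Hd _ k3; have := Hd _ k4 => k5 k6.
  have -> : f (circ w r t') - f (circ w r0 t') =
    (f (circ w r t') - f (circ w r0 t)) - (f (circ w r0 t') - f (circ w r0 t)) by ring.
  apply: (le_trans (ncB _ _)); lra.
exists (d / 2); first by rewrite divr_gt0.
move=> r hr hrd.
have hdd : 0 < d / 2 < d by apply/andP; split; lra.
have H := fun t ht => Hd _ hdd t ht _ hr hrd.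
have [c1 c2] := circ_cts (cc _ hr); have [c3 c4] := circ_cts (cc _ hr0).
apply: (le_trans (nc_le_ReIm _)); rewrite !ReImE /= -!IabB //.
have b1 : `|Iab 0 twopi (fun t => Re (f (circ w r t)) - Re (f (circ w r0 t)))| <= e1 * (twopi - 0).
  apply: Iab_bound => //; first exact: ctsB.
  by move=> t ht; rewrite -ReB; apply: le_trans (Re_le _) (H t ht).
have b2 : `|Iab 0 twopi (fun t => Im (f (circ w r t)) - Im (f (circ w r0 t)))| <= e1 * (twopi - 0).
  apply: Iab_bound => //; first exact: ctsB.
  by move=> t ht; rewrite -ImB; apply: le_trans (Im_le _) (H t ht).
apply: (le_trans (lerD b1 b2)).
rewrite subr0 /e1.
have -> : eps / (2 * (twopi + 1)) * twopi + eps / (2 * (twopi + 1)) * twopi = eps * (twopi / (twopi + 1)).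
  field; lra.
rewrite ler_piMr ?ltW // ltr_pdivrMr ?mul1r ?ltrDl //; lra.
Qed.

(** The closed range of radii is reached from the open one by continuity of the average. *)
Lemma avg_interval (f : C -> C) (w : C) (rho a b : R) : 0 <= a -> a < b -> b <= rho ->
  (forall z, nc (z - w) <= rho -> ccont f z) ->
  (forall z, a < nc (z - w) < b -> holomorphic_at f z) -> avg f w a = avg f w b.
Proof.
move=> a0 ab bR Hc Hh.
have lim r0 : a <= r0 <= b -> avg f w r0 = avg f w ((a + b) / 2).
  move=> /andP[h1 h2]; apply/eqP; rewrite -subr_eq0 -nc_eq0; apply/negPn/negP => hn.
  have p0 : 0 < nc (avg f w r0 - avg f w ((a + b) / 2)) by rewrite lt_def hn nc_ge0.
  have hr0 : 0 <= r0 <= rho by rewrite (le_trans a0 h1) (le_trans h2 bR).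
  have [d d0 Hd] := avg_cont hr0 Hc (divr_gt0 p0 (ltr0Sn _ 1)).
  have [r hr hrr] : exists2 r, a < r < b & `|r - r0| < d.
    have [k|k] := leP r0 ((a + b) / 2).
      exists (r0 + Num.min (d / 2) ((b - a) / 4)).
        have : 0 < Num.min (d / 2) ((b - a) / 4) by rewrite lt_min; apply/andP; split; lra.
        have : Num.min (d / 2) ((b - a) / 4) <= (b - a) / 4 by rewrite ge_min lexx orbT.
        by move=> ? ?; apply/andP; split; lra.
      rewrite addrC addKr ger0_norm; last by rewrite le_min; apply/andP; split; lra.
      by rewrite gt_min; apply/orP; left; lra.
    exists (r0 - Num.min (d / 2) ((b - a) / 4)).
      have : 0 < Num.min (d / 2) ((b - a) / 4) by rewrite lt_min; apply/andP; split; lra.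
      have : Num.min (d / 2) ((b - a) / 4) <= (b - a) / 4 by rewrite ge_min lexx orbT.
      by move=> ? ?; apply/andP; split; lra.
    rewrite addrAC subrr add0r normrN ger0_norm; last by rewrite le_min; apply/andP; split; lra.
    by rewrite gt_min; apply/orP; left; lra.
  have [hr1 hr2] := andP hr.
  have hr' : 0 <= r <= rho by apply/andP; split; lra.
  have := Hd _ hr' hrr.
  have -> : avg f w r = avg f w ((a + b) / 2).
    have [k|k] := leP r ((a + b) / 2).
      apply: avg_annulus => //; first lra.
      by move=> z /andP[? ?]; apply: Hh; apply/andP; split; lra.
    apply/esym; apply: avg_annulus; [lra|lra|].
    by move=> z /andP[? ?]; apply: Hh; apply/andP; split; lra.
  rewrite ncC; lra.
by rewrite (lim a) ?lexx ?ltW // (lim b) // lexx ltW.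
Qed.

(** A single point where only continuity is known does no harm: on either side of its
    radius the circular average is constant, and the average is continuous in
    the radius. *)
Theorem mean_value (f : C -> C) (w p : C) (rho : R) : 0 < rho ->
  (forall z, nc (z - w) <= rho -> ccont f z) ->
  (forall z, nc (z - w) <= rho -> z != p -> holomorphic_at f z) ->
  avg f w rho = twopi%:C%C * f w.
Proof.
move=> rho0 Hc Hh.
have -> : twopi%:C%C * f w = avg f w 0.
  have c0 t : circ w 0 t = w by apply: complex_ext; rewrite /circ !ReImE /= mul0r addr0.
  apply: complex_ext; rewrite !ReImE /= mul0r ?subr0 ?addr0.
    rewrite (@eq_Iab _ _ _ _ (fun=> Re (f w))); last by move=> t _; rewrite c0.
    by rewrite Iab_cst ?twopi_ge0 // subr0 mulrC.
  rewrite (@eq_Iab _ _ _ _ (fun=> Im (f w))); last by move=> t _; rewrite c0.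
  by rewrite Iab_cst ?twopi_ge0 // subr0 mulrC.
have Hq a b : 0 <= a -> a < b -> b <= rho -> (nc (p - w) <= a) || (b <= nc (p - w)) ->
    avg f w a = avg f w b.
  move=> a0 ab br hp; apply: (avg_interval a0 ab br Hc) => z /andP[h1 h2].
  apply: Hh; first by rewrite (le_trans (ltW h2)).
  by apply/eqP => zp; move: hp; rewrite -zp => /orP[]; lra.
have := nc_ge0 (p - w) => q0.
have [h|h] := leP (nc (p - w)) 0; first by apply/esym; apply: Hq; rewrite ?h.
have [h'|h'] := leP rho (nc (p - w)); first by apply/esym; apply: Hq; rewrite ?h' ?orbT.
have h0 := ltW h; have h1 := ltW h'.
by rewrite -(Hq (nc (p - w)) rho) ?lexx // (Hq 0 (nc (p - w))) ?lexx ?orbT.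
Qed.

Lemma ccont_near (f g : C -> C) (z : C) (r : R) : 0 < r ->
  (forall z', nc (z' - z) < r -> f z' = g z') -> ccont f z -> ccont g z.
Proof.
move=> r0 fg Hf e /Hf [d d0 Hd]; exists (Num.min d r); first by rewrite lt_min d0.
move=> z'; rewrite lt_min => /andP[h1 h2]; rewrite -!fg ?subrr ?nc0 //; exact: Hd.
Qed.

(** The difference quotient at [z], completed by the derivative [L]. *)
Definition quot (f : C -> C) (z L : C) : C -> C :=
  fun x => if x == z then L else (f x - f z) / (x - z).

Lemma quot_near (f : C -> C) (z L x : C) : x != z -> exists2 r : R, 0 < r &
  forall x', nc (x' - x) < r -> (f x' - f z) / (x' - z) = quot f z L x'.
Proof.
move=> xz; exists (nc (z - x)); first by rewrite nc_gt0 subr_eq0 eq_sym.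
by move=> x'; rewrite /quot; case: eqP => [->|//]; rewrite ltxx.
Qed.

Lemma quot_ccont_off (f : C -> C) (z L x : C) : x != z -> ccont f x -> ccont (quot f z L) x.
Proof.
move=> xz cf; have [r r0 Hr] := quot_near f L xz; apply: (ccont_near r0 Hr).
apply: ccontM; first by apply: ccontB => //; exact: ccont_cst.
apply: (@ccontV _ (fun x => x - z)); first by rewrite subr_eq0.
by apply: ccontB; [exact: ccont_id|exact: ccont_cst].
Qed.

Lemma quot_holo_off (f : C -> C) (z L x : C) : x != z -> holomorphic_at f x ->
  holomorphic_at (quot f z L) x.
Proof.
move=> xz cf; have [r r0 Hr] := quot_near f L xz; apply: (holo_near r0 Hr).
apply: (@holo_div _ (fun x => f x - f z) (fun x => x - z)); first by rewrite subr_eq0.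
  exact: (holoB cf (@holo_cst R (f z) x)).
exact: (holoB (@holo_id R x) (@holo_cst R z x)).
Qed.

Lemma quot_ccont (f : C -> C) (z L : C) :
  (forall eps : R, 0 < eps -> exists2 del : R, 0 < del &
    forall h : C, nc h < del -> nc (f (z + h) - f z - L * h) <= eps * nc h) ->
  ccont (quot f z L) z.
Proof.
move=> HL e e0; have [d d0 Hd] := HL _ (divr_gt0 e0 (ltr0Sn _ 1)).
exists d => // x hx; rewrite /quot eqxx.
have [_|xz] := eqVneq x z; first by rewrite subrr nc0.
have := Hd _ hx; rewrite (addrC z) subrK => h.
have xz0 : x - z != 0 by rewrite subr_eq0.
have -> : (f x - f z) / (x - z) - L = (f x - f z - L * (x - z)) / (x - z) by field.
rewrite nc_div ltr_pdivrMr ?nc_gt0 //; apply: (le_lt_trans h).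
by rewrite ltr_pM2r ?nc_gt0 // ltr_pdivrMr // ltr_pMr // ltr1n.
Qed.

(** On the unit circle around [w] the conjugate of [x - w] is its inverse. The integrand is
    thereby the conjugate of a function holomorphic on the closed disc with value 1 at
    the centre. *)
Lemma avg_kernel (z w : C) : nc (z - w) < 1 ->
  avg (fun x => (x - w) / (x - z)) w 1 = twopi%:C%C.
Proof.
move=> hz; set a := z - w in hz.
have ne x : nc (x - 0) <= 1 -> 1 - conjc a * x != 0.
  rewrite subr0 => hx; apply/eqP => /eqP; rewrite subr_eq0 => /eqP h.
  have : nc (conjc a * x) < 1.
    by rewrite ncM nc_conj; apply: (le_lt_trans (ler_wpM2l (nc_ge0 _) hx)); rewrite mulr1.
  by rewrite -h Normc.normc1 ltxx.
have hol x : nc (x - 0) <= 1 -> holomorphic_at (fun x => (1 - conjc a * x)^-1) x.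
  move=> /ne h; apply: holoV => //; apply: holoB; first exact: holo_cst.
  by apply: holoM; [exact: holo_cst|exact: holo_id].
have := @mean_value (fun x => (1 - conjc a * x)^-1) 0 0 1 ltr01
  (fun x hx => holo_ccont (hol x hx)) (fun x hx _ => hol x hx).
rewrite mulr0 subr0 invr1 mulr1 => <-.
have E t : (circ w 1 t - w) / (circ w 1 t - z) = conjc ((1 - conjc a * circ 0 1 t)^-1).
  have c0 : circ w 1 t - w != 0 by rewrite -nc_eq0 nc_circ normr1 oner_eq0.
  rewrite conjcV conjcB conjcM conjcK.
  have -> : circ w 1 t - z = (circ w 1 t - w) - a by rewrite /a; ring.
  have cc : conjc (circ 0 1 t) = (circ w 1 t - w)^-1.
    apply: (mulfI c0); rewrite divff //.
    have -> : circ w 1 t - w = circ 0 1 t by rewrite /circ addrC addKr add0r.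
    by rewrite mulrC mulc_conj -[circ 0 1 t]subr0 nc_circ normr1 expr1n.
  rewrite cc; set u := circ w 1 t - w in c0 *.
  have -> : (1)^*%C = 1 :> C by rewrite -[1]/((1:R)%:C%C) conjcr.
  have ua : u - a != 0.
    rewrite subr_eq0; apply/eqP => ua; move: hz; rewrite -ua /u nc_circ normr1 ltxx //.
  by field; rewrite ua c0.
apply: complex_ext; rewrite /avg /=.
  by apply: eq_Iab => t _; rewrite E ReImE.
have hI : cts 0 twopi (fun t => Im (1 - conjc a * circ 0 1 t)^-1).
  apply: (@circ_cts (fun x => (1 - conjc a * x)^-1) 0 1 _).2 => x hx.
  by apply/holo_ccont/hol; rewrite hx normr1.
rewrite (@eq_Iab _ _ _ _ (fun t => - Im (1 - conjc a * circ 0 1 t)^-1)); last first.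
  by move=> t _; rewrite E ReImE.
rewrite Iab_Nfun //.
have := @mean_value (fun x => (1 - conjc a * x)^-1) 0 0 1 ltr01
  (fun x hx => holo_ccont (hol x hx)) (fun x hx _ => hol x hx).
rewrite mulr0 subr0 invr1 mulr1 => /(congr1 Im) /= ->.
by rewrite oppr0.
Qed.

(** Cauchy's formula with one exceptional point [w]: the mean value property, applied to
    [x - w] times the difference quotient of [f] at [z]. *)
Lemma cauchy_formula (f : C -> C) (w z : C) : nc (z - w) < 1 ->
  (forall x, ccont f x) -> (forall x, x != w -> holomorphic_at f x) ->
  avg (fun x => (x - w) * f x / (x - z)) w 1 = twopi%:C%C * f z.
Proof.
move=> hz Hc Hh.
have off x : nc (x - w) = `|1| -> x - z != 0.
  rewrite normr1 subr_eq0 => hx; apply/eqP => xz; move: hz; rewrite -xz hx ltxx //.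
have [zw|zw] := eqVneq z w.
  rewrite zw -(@mean_value f w w 1) //; last by move=> x _; exact: Hh.
  apply: eq_avg => x hx; have := off x hx; rewrite zw => h.
  by field.
have [L HL] := (holoP f z).1 (Hh _ zw).
pose g x := (x - w) * quot f z L x.
have qc x : ccont (quot f z L) x.
  have [->|xz] := eqVneq x z; first exact: quot_ccont.
  exact: quot_ccont_off.
have cxw x : ccont (fun x => x - w) x by apply: ccontB; [exact: ccont_id|exact: ccont_cst].
have gc x : ccont g x by apply: ccontM.
(* At [w] the factor [x - w] supplies the derivative that [f] may lack there. *)
have gh x : nc (x - w) <= 1 -> x != z -> holomorphic_at g x.
  move=> _ xz; have [->|xw] := eqVneq x w.
    apply/holoP; exists (quot f z L w) => e /(qc w) [d d0 Hd]; exists d => // h hd.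
    have := Hd (w + h); rewrite (addrC w) addrK => /(_ hd) hq.
    rewrite /g subrr mul0r subr0 addrK [quot f z L w * h]mulrC -mulrBr ncM mulrC.
    by rewrite ler_wpM2r ?nc_ge0 // ltW.
  apply: holoM; first by apply: holoB; [exact: holo_id|exact: holo_cst].
  by apply: quot_holo_off => //; exact: Hh.
have := @mean_value g w z 1 ltr01 (fun x _ => gc x) gh.
rewrite {2}/g subrr mul0r mulr0.
rewrite (@eq_avg g (fun x => (x - w) * f x / (x - z) - f z * ((x - w) / (x - z)))); last first.
  move=> x hx; have h := off x hx; have xz : x != z by rewrite -subr_eq0.
  by rewrite /g /quot (negbTE xz); field.
have hv x : nc (x - w) = `|1| -> ccont (fun x => (x - z)^-1) x.
  move=> /off h; apply: (@ccontV _ (fun x => x - z)) => //.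
  by apply: ccontB; [exact: ccont_id|exact: ccont_cst].
rewrite avgB; last 2 first.
- by move=> x /hv h; apply: ccontM => //; apply: ccontM.
- by move=> x /hv h; apply: ccontM; [exact: ccont_cst|apply: ccontM].
rewrite avgZ; last by move=> x /hv h; apply: ccontM.
by rewrite avg_kernel // => /eqP; rewrite subr_eq0 => /eqP ->; rewrite mulrC.
Qed.

(** Riemann's theorem on removable singularities: Cauchy's formula represents [f] near
    [w] by an integral that is differentiable in the parameter. *)
Theorem removable (f : C -> C) (w : C) :
  (forall x, ccont f x) -> (forall x, x != w -> holomorphic_at f x) -> holomorphic_at f w.
Proof.
move=> Hc Hh.
have [K K0 HK] := @rect_bounded R f (Re w - 1) (Re w + 1) (Im w - 1) (Im w + 1) (fun x y _ _ => Hc _).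
have bd x : nc (x - w) = `|1| -> nc (f x) <= K.
  rewrite normr1 => hx; have := Re_le (x - w); have := Im_le (x - w).
  rewrite hx !ReImE !ler_norml => /andP[h1 h2] /andP[h3 h4].
  by case: x h1 h2 h3 h4 {hx} => u v /= h1 h2 h3 h4; apply: HK; apply/andP; split; lra.
have tp : 0 < twopi by rewrite mulr_gt0 // pi_gt0.
have tpC : twopi%:C%C != 0 :> C by rewrite -nc_eq0 nc_real normr_eq0 gt_eqF.
have off z x : nc (z - w) < 1 -> nc (x - w) = `|1| -> x - z != 0.
  by rewrite normr1 subr_eq0 => hz hx; apply/eqP => xz; move: hz; rewrite -xz hx ltxx.
have w1 : nc (w - w) < 1 by rewrite subrr nc0.
have hv z x : nc (z - w) < 1 -> nc (x - w) = `|1| -> ccont (fun x => (x - z)^-1) x.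
  move=> hz /(off _ _ hz) h; apply: (@ccontV _ (fun x => x - z)) => //.
  by apply: ccontB; [exact: ccont_id|exact: ccont_cst].
have cxw x : ccont (fun x => x - w) x by apply: ccontB; [exact: ccont_id|exact: ccont_cst].
pose D z := avg (fun x => f x / (x - z)) w 1.
have hD z : nc (z - w) < 1 -> twopi%:C%C * (f z - f w) = (z - w) * D z.
  move=> hz; rewrite mulrBr -(@cauchy_formula f w z) // -(@cauchy_formula f w w) //.
  rewrite -avgB; last 2 first.
  - by move=> x hx; apply: ccontM; [apply: ccontM|exact: hv hz hx].
  - by move=> x hx; apply: ccontM; [apply: ccontM|exact: hv w1 hx].
  rewrite -avgZ; last by move=> x hx; apply: ccontM; [|exact: hv hz hx].
  apply: eq_avg => x hx; have h1 := off _ _ hz hx; have h2 := off _ _ w1 hx.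
  by field; rewrite ?h1 ?h2.
have hDD z : nc (z - w) <= 1 / 2 -> nc (D z - D w) <= 8 * K * twopi * nc (z - w).
  move=> hz2; have hz : nc (z - w) < 1 by lra.
  rewrite -avgB; last 2 first.
  - by move=> x hx; apply: ccontM; [|exact: hv hz hx].
  - by move=> x hx; apply: ccontM; [|exact: hv w1 hx].
  have -> : 8 * K * twopi * nc (z - w) = 2 * ((4 * K * nc (z - w)) * twopi) by ring.
  apply: avg_bound.
    move=> x hx; apply: ccontB; apply: ccontM => //; [exact: hv hz hx|exact: hv w1 hx].
  move=> x hx; have h1 := off _ _ hz hx; have h2 := off _ _ w1 hx.
  have -> : f x / (x - z) - f x / (x - w) = f x * (z - w) / ((x - z) * (x - w)) by field; rewrite ?h1 ?h2.
  rewrite nc_div !ncM hx normr1 mulr1 ler_pdivrMr ?nc_gt0 //.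
  have hxz : 1 / 2 <= nc (x - z).
    have := ncD (x - z) (z - w); rewrite addrA subrK hx normr1; lra.
  have := bd x hx => hb; have z0 := nc_ge0 (z - w).
  have Kz : 0 <= K * nc (z - w) by rewrite mulr_ge0 // ltW.
  have : nc (f x) * nc (z - w) <= K * nc (z - w) by rewrite ler_wpM2r.
  have : (2 * K * nc (z - w)) * 1 <= (2 * K * nc (z - w)) * (2 * nc (x - z)).
    by apply: ler_wpM2l; [rewrite -mulrA mulr_ge0|lra].
  by move=> ? ?; lra.
apply/holoP; exists (D w / twopi%:C%C) => e e0.
pose M := 8 * K + 1.
have M0 : 0 < M by rewrite /M; lra.
exists (Num.min (1 / 2) (e / M)); first by rewrite lt_min !divr_gt0.
move=> h; rewrite lt_min => /andP[h1 h2].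
have hw : w + h - w = h by ring.
have := hD (w + h); have := hDD (w + h); rewrite hw => /(_ (ltW h1)) k2 k1.
have k3 : f (w + h) - f w = h * D (w + h) / twopi%:C%C.
  by rewrite -k1 ?(mulrC _ (f _ - _)) ?mulfK //; lra.
rewrite k3.
have -> : h * D (w + h) / twopi%:C%C - D w / twopi%:C%C * h = h * (D (w + h) - D w) / twopi%:C%C.
  by rewrite mulrBr mulrBl [in RHS](mulrC h (D w)) (mulrAC (D w)).
rewrite nc_div nc_real (gtr0_norm tp) ncM ler_pdivrMr //.
have n0 := nc_ge0 h.
apply: (@le_trans _ _ (nc h * (8 * K * twopi * nc h))); first by rewrite ler_wpM2l.
have -> : e * nc h * twopi = nc h * (twopi * e) by ring.
rewrite ler_wpM2l //.
have : nc h * M <= e by rewrite -ler_pdivlMr // ltW.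
have -> : 8 * K * twopi * nc h = twopi * (nc h * (8 * K)) by ring.
move=> h3; rewrite ler_pM2l //; apply: le_trans h3; rewrite ler_wpM2l // /M; lra.
Qed.

(** The zero [w] of [f - f w] is divided out by removing a singularity. *)
Lemma quot_entire (f : C -> C) (w : C) : entire f ->
  exists g, entire g /\ forall z, (z - w) * g z = f z - f w.
Proof.
move=> Hf; have [L HL] := (holoP f w).1 (Hf w).
exists (quot f w L); split; last first.
  move=> z; rewrite /quot; case: eqVneq => [->|zw]; first by rewrite !subrr mul0r.
  by field; rewrite subr_eq0.
move=> z; have [->|zw] := eqVneq z w; last exact: quot_holo_off.
apply: removable => x; last by move=> xw; exact: quot_holo_off.
have [->|xw] := eqVneq x w; first exact: quot_ccont.
by apply: quot_ccont_off => //; apply: holo_ccont.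
Qed.

End Circles.

(** * Hilbert spaces of functions *)

Section PreHilbert.
Variable R : realType.
Local Notation C := R[i].
Local Notation nc := (@Normc.normc R).
Local Notation Re := (@complex.Re R).
Local Notation Im := (@complex.Im R).
Local Notation fn := (C -> C).

Lemma sub_scale_add (f g : fn) : f \- g = ((-1) \*o g) \+ f.
Proof. by apply/funext => x /=; ring. Qed.
Lemma add_scale1 (f g : fn) : f \+ g = (1 \*o f) \+ g.
Proof. by apply/funext => x /=; ring. Qed.
Lemma scale_add0 (a : C) (f : fn) : a \*o f = (a \*o f) \+ cst 0.
Proof. by apply/funext => x /=; ring. Qed.
Lemma subff (f : fn) : f \- f = cst 0.
Proof. by apply/funext => x /=; ring. Qed.

Section Subspace.
Variable V : set fn.
Hypothesis HV : Defs.subspace V.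
Lemma vs0 : V (cst 0). Proof. by case: HV. Qed.
Lemma vsL a f g : V f -> V g -> V ((a \*o f) \+ g).
Proof. by case: HV => _; apply. Qed.
Lemma vsD f g : V f -> V g -> V (f \+ g).
Proof. by move=> hf hg; rewrite add_scale1; apply: vsL. Qed.
Lemma vsB f g : V f -> V g -> V (f \- g).
Proof. by move=> hf hg; rewrite sub_scale_add; apply: vsL. Qed.
Lemma vsZ a f : V f -> V (a \*o f).
Proof. by move=> hf; rewrite scale_add0; apply: vsL => //; apply: vs0. Qed.
End Subspace.

Variable H : fspace R.
Hypotheses (HS : Defs.subspace H) (HI : inner_product H).
Local Notation ip := (inner H).
Local Notation norm := (ipnorm (inner H)).

Lemma ipLr a f g h : H f -> H g -> H h -> ip h ((a \*o f) \+ g) = a * ip h f + ip h g.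
Proof. by case: HI => h1 _ _ _; apply: h1. Qed.
Lemma ipC f g : H f -> H g -> ip g f = conjc (ip f g).
Proof. by case: HI => _ h1 _ _; apply: h1. Qed.
Lemma ip_ge0 f : H f -> 0 <= ip f f.
Proof. by case: HI => _ _ h1 _; apply: h1. Qed.
Lemma ip_eq0 f : H f -> ip f f = 0 -> f = cst 0.
Proof. by case: HI => _ _ _ h1; apply: h1. Qed.

Lemma ipLl a f g h : H f -> H g -> H h ->
  ip ((a \*o f) \+ g) h = conjc a * ip f h + ip g h.
Proof.
move=> hf hg hh; rewrite ipC //; last exact: vsL.
by rewrite ipLr // conjcD conjcM -!ipC.
Qed.

Lemma ip0r f : H f -> ip f (cst 0) = 0.
Proof.
move=> hf; have h0 := vs0 HS.
have := ipLr (-1) h0 h0 hf.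
by rewrite -sub_scale_add subff mulN1r addNr.
Qed.
Lemma ip0l f : H f -> ip (cst 0) f = 0.
Proof. by move=> hf; rewrite ipC //; [rewrite ip0r // conjc0|exact: vs0]. Qed.
Lemma ipDr f g h : H f -> H g -> H h -> ip h (f \+ g) = ip h f + ip h g.
Proof. by move=> *; rewrite add_scale1 ipLr // mul1r. Qed.
Lemma ipDl f g h : H f -> H g -> H h -> ip (f \+ g) h = ip f h + ip g h.
Proof. by move=> *; rewrite add_scale1 ipLl // conjc1 mul1r. Qed.
Lemma ipBr f g h : H f -> H g -> H h -> ip h (f \- g) = ip h f - ip h g.
Proof. by move=> *; rewrite sub_scale_add ipLr // mulN1r addrC. Qed.
Lemma ipBl f g h : H f -> H g -> H h -> ip (f \- g) h = ip f h - ip g h.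
Proof. by move=> *; rewrite sub_scale_add ipLl // conjcN conjc1 mulN1r addrC. Qed.
Lemma ipZr a f h : H f -> H h -> ip h (a \*o f) = a * ip h f.
Proof. by move=> hf hh; rewrite scale_add0 ipLr ?ip0r ?addr0 //; exact: vs0. Qed.
Lemma ipZl a f h : H f -> H h -> ip (a \*o f) h = conjc a * ip f h.
Proof. by move=> hf hh; rewrite scale_add0 ipLl ?ip0l ?addr0 //; exact: vs0. Qed.

Lemma norm_ge0 f : 0 <= norm f. Proof. exact: sqrtr_ge0. Qed.

Lemma ip_norm f : H f -> ip f f = (norm f ^+ 2)%:C%C.
Proof.
move=> /ip_ge0; rewrite lecE /= => /andP[/eqP hi hr].
apply: complex_ext; rewrite ?hi //=.
by rewrite /ipnorm sqr_sqrtr.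
Qed.

Lemma Re_ip f : H f -> Re (ip f f) = norm f ^+ 2.
Proof. by move=> /ip_norm ->. Qed.

Lemma norm_eq0 f : H f -> norm f = 0 -> f = cst 0.
Proof. by move=> hf h; apply: ip_eq0 => //; rewrite ip_norm // h expr0n. Qed.

Lemma norm0 : norm (cst 0) = 0.
Proof. by rewrite /ipnorm ip0l ?sqrtr0 //; exact: vs0. Qed.

Lemma ip_ext f g : H f -> H g -> (forall h, H h -> ip f h = ip g h) -> f = g.
Proof.
move=> hf hg E; have hd := vsB HS hf hg.
have : f \- g = cst 0.
  by apply: ip_eq0 => //; rewrite ipBl // E // subrr.
by move=> /(congr1 (fun u : fn => u \+ g)) => e; apply/funext => x;
  have := congr1 (fun u : fn => u x) e; rewrite /= subrK add0r.
Qed.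

Lemma norm2D f g : H f -> H g -> norm (f \+ g) ^+ 2 = norm f ^+ 2 + 2 * Re (ip f g) + norm g ^+ 2.
Proof.
move=> hf hg; rewrite -!Re_ip //; last exact: vsD.
rewrite ipDl ?ipDr //; try exact: vsD.
by rewrite (ipC hf hg) !ReImE; ring.
Qed.

Lemma normZ a f : H f -> norm (a \*o f) = nc a * norm f.
Proof.
move=> hf; apply/eqP; rewrite -(@eqrXn2 _ 2) ?norm_ge0 ?mulr_ge0 ?nc_ge0 ?norm_ge0 //.
rewrite exprMn -!Re_ip //; last exact: vsZ.
rewrite ipZl ?ipZr //; try exact: vsZ.
by rewrite mulrA mulc_conj ip_norm // !ReImE /= mul0r subr0.
Qed.

Lemma normB f g : H f -> H g -> norm (f \- g) = norm (g \- f).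
Proof.
move=> hf hg; have -> : f \- g = (-1) \*o (g \- f) by apply/funext => x /=; ring.
by rewrite normZ ?ncN ?Normc.normc1 ?mul1r //; exact: vsB.
Qed.

Lemma norm2B f g : H f -> H g -> norm (f \- g) ^+ 2 = norm f ^+ 2 - 2 * Re (ip f g) + norm g ^+ 2.
Proof.
move=> hf hg; have -> : f \- g = f \+ ((-1) \*o g) by apply/funext => x /=; ring.
rewrite norm2D //; last exact: vsZ.
by rewrite normZ // ncN Normc.normc1 mul1r ipZr // mulN1r !ReImE; ring.
Qed.

Lemma cauchy_schwarz f g : H f -> H g -> nc (ip f g) <= norm f * norm g.
Proof.
move=> hf hg; have [g0|g0] := eqVneq (norm g) 0.
  by rewrite (norm_eq0 hg g0) ip0r // nc0 mulr_ge0 ?norm_ge0.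
set b := ip g f.
have gp : 0 < norm g by rewrite lt_def g0 norm_ge0.
have hz : H ((b / (norm g ^+ 2)%:C%C) \*o g) by exact: vsZ.
have := sqr_ge0 (norm (f \- ((b / (norm g ^+ 2)%:C%C) \*o g))).
rewrite norm2B // normZ // ipZr //.
have -> : ip f g = conjc b by rewrite -ipC.
have -> : b / (norm g ^+ 2)%:C%C * conjc b = (nc b ^+ 2 / norm g ^+ 2)%:C%C.
  rewrite mulrAC [b * _]mulrC mulc_conj.
  by apply: complex_ext; rewrite -?rmorphV -?rmorphM //= ?unitfE ?expf_neq0.
rewrite nc_div nc_real (ger0_norm (sqr_ge0 _)) nc_conj /= => h.
rewrite -(@ler_pXn2r _ 2) ?nnegrE ?nc_ge0 ?mulr_ge0 ?norm_ge0 // exprMn.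
rewrite -ler_pdivrMr ?exprn_gt0 // -subr_ge0; move: h.
have -> : norm f ^+ 2 - 2 * (nc b ^+ 2 / norm g ^+ 2) + (nc b / norm g ^+ 2 * norm g) ^+ 2 =
  norm f ^+ 2 - nc b ^+ 2 / norm g ^+ 2 by field.
by [].
Qed.

Lemma normD_le f g : H f -> H g -> norm (f \+ g) <= norm f + norm g.
Proof.
move=> hf hg; rewrite -(@ler_pXn2r _ 2) ?nnegrE ?addr_ge0 ?norm_ge0 // norm2D //.
rewrite sqrrD lerD2r lerD2l mulr_natl ler_pMn2r //.
by apply: le_trans (cauchy_schwarz hf hg); apply: le_trans (Re_le _); exact: ler_norm.
Qed.

Lemma norm_triangle f g h : H f -> H g -> H h -> norm (f \- h) <= norm (f \- g) + norm (g \- h).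
Proof.
move=> hf hg hh; have -> : f \- h = (f \- g) \+ (g \- h) by apply/funext => x /=; ring.
by apply: normD_le; apply: vsB.
Qed.

Lemma parallelogram f g : H f -> H g ->
  norm (f \- g) ^+ 2 + norm (f \+ g) ^+ 2 = 2 * norm f ^+ 2 + 2 * norm g ^+ 2.
Proof. by move=> hf hg; rewrite norm2D // norm2B //; ring. Qed.

End PreHilbert.

Section Hilbert.
Variable R : realType.
Local Notation C := R[i].
Local Notation nc := (@Normc.normc R).
Local Notation Re := (@complex.Re R).
Local Notation Im := (@complex.Im R).
Local Notation fn := (C -> C).

Lemma inv_succ_small (eps : R) : 0 < eps -> exists N, forall n, (N <= n)%N -> n.+1%:R^-1 < eps.
Proof.
move=> e0; exists (Num.truncn eps^-1) => n hn.
rewrite -[ltRHS]invrK ltf_pV2 ?posrE ?invr_gt0 //.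
apply: (lt_le_trans (truncnS_gt _)).
by rewrite ler_nat.
Qed.

Lemma quadratic_ge0 (A B : R) : 0 <= B ->
  (forall t eps : R, 0 < eps -> - eps <= 2 * t * A + t ^+ 2 * B) -> A = 0.
Proof.
move=> B0 HT; apply/eqP/negPn/negP => A0.
have A2 : 0 < A ^+ 2 by rewrite lt_def sqrf_eq0 A0 sqr_ge0.
have B1 : 0 < B + 1 by lra.
have := HT (- A / (B + 1)) (A ^+ 2 / (2 * (B + 1))).
rewrite (divr_gt0 A2) ?(mulr_gt0 _ B1) // => /(_ isT).
have -> : 2 * (- A / (B + 1)) * A + (- A / (B + 1)) ^+ 2 * B = - (A ^+ 2 / (B + 1)) * ((B + 2) / (B + 1)) by field; lra.
have -> : A ^+ 2 / (2 * (B + 1)) = (A ^+ 2 / (B + 1)) / 2 by field; lra.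
have : 1 <= (B + 2) / (B + 1) by rewrite ler_pdivlMr // mul1r lerD2l ler1n.
have : 0 < A ^+ 2 / (B + 1) by rewrite divr_gt0.
set u := A ^+ 2 / _; set v := (B + 2) / _ => u0 v1.
have : u * 1 <= u * v by rewrite ler_pM2l.
lra.
Qed.

Variable H : fspace R.
Hypotheses (HS : Defs.subspace H) (HI : inner_product H) (HC : complete_space H).
Local Notation ip := (inner H).
Local Notation norm := (ipnorm (inner H)).

(** The Riesz representation by minimizing the energy [|f|^2 - 2 Re L f]. Minimizing
    over a subspace [W] that need not be closed yields in the same stroke a
    representing vector that lies in the closure of [W]. *)
Theorem riesz (W : set fn) (L : fn -> C) (K : R) :
  Defs.subspace W -> (forall f, W f -> H f) ->
  (forall a f g, W f -> W g -> L ((a \*o f) \+ g) = a * L f + L g) ->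
  (forall f, W f -> nc (L f) <= K * norm f) ->
  exists v, [/\ H v, forall w, W w -> L w = ip v w &
    forall eps : R, 0 < eps -> exists2 w, W w & norm (w \- v) < eps].
Proof.
move=> WS WH LL LB.
pose Q f := norm f ^+ 2 - 2 * Re (L f).
have LZ a f : W f -> L (a \*o f) = a * L f.
  move=> hf; rewrite scale_add0 LL //; last exact: vs0.
  suff -> : L (cst 0) = 0 by rewrite addr0.
  have := LL (-1) _ _ (vs0 WS) (vs0 WS).
  by rewrite -sub_scale_add subff mulN1r addNr.
have LD f g : W f -> W g -> L (f \+ g) = L f + L g.
  by move=> hf hg; rewrite add_scale1 LL // mul1r.
have Qlow f : W f -> - K ^+ 2 <= Q f.
  move=> hf; have := le_trans (Re_le _) (LB f hf); rewrite ler_norml => /andP[_ h].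
  have := sqr_ge0 (norm f - K); rewrite sqrrB /Q => h2.
  have : norm f ^+ 2 - norm f * K *+ 2 + K ^+ 2 = norm f ^+ 2 - 2 * (K * norm f) + K ^+ 2 by ring.
  by move=> e; rewrite e in h2; lra.
have hinf : has_inf [set Q f | f in W].
  split; first by exists (Q (cst 0)), (cst 0) => //; exact: vs0.
  by exists (- K ^+ 2) => _ [f hf <-]; exact: Qlow.
set m := inf [set Q f | f in W].
have mle f : W f -> m <= Q f.
  by move=> hf; apply: (ge_inf hinf.2); exists f.
have /choice [w Hw] : forall n : nat, exists f, W f /\ Q f < m + n.+1%:R^-1.
  move=> n; have [|_ [f hf <-] h] := @inf_adherent _ _ n.+1%:R^-1 _ hinf; last by exists f.
  by rewrite invr_gt0.
have wH n : H (w n) := WH _ (Hw n).1.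
have est i j : norm (w i \- w j) ^+ 2 <= 2 * (i.+1%:R^-1 + j.+1%:R^-1).
  have [wi qi] := Hw i; have [wj qj] := Hw j.
  have hh : W ((2^-1) \*o (w i \+ w j)) by apply: vsZ => //; apply: vsD.
  have hs : W (w i \+ w j) by apply: vsD.
  have := mle _ hh; rewrite /Q normZ ?LZ //; last exact: WH.
  rewrite LD // ncV.
  have -> : nc 2 = 2 by rewrite (_ : 2 = (2 : R)%:C%C) ?nc_real ?normr_nat // rmorph_nat.
  have -> : Re (2^-1 * (L (w i) + L (w j))) = 2^-1 * (Re (L (w i)) + Re (L (w j))).
    have -> : (2^-1 : C) = (2^-1 : R)%:C%C by rewrite fmorphV rmorph_nat.
    by rewrite !ReImE /= mul0r subr0.
  rewrite exprMn => h.
  have := parallelogram HS HI (wH i) (wH j).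
  rewrite /Q in qi qj.
  have q4 : (2^-1 : R) ^+ 2 = 4^-1 by field.
  move: h qi qj; rewrite q4.
  set p := norm (w i \+ w j) ^+ 2; set q := norm (w i \- w j) ^+ 2.
  set a1 := norm (w i) ^+ 2; set a2 := norm (w j) ^+ 2.
  move: (i.+1%:R^-1) (j.+1%:R^-1) => d1 d2 h qi qj hp; lra.
have cau : forall eps : R, 0 < eps -> exists N, forall i j, (N <= i)%N -> (N <= j)%N ->
    norm (w i \- w j) < eps.
  move=> eps e0.
  have e2 : 0 < eps ^+ 2 / 4 by rewrite divr_gt0 // exprn_gt0.
  have [N HN] := inv_succ_small e2; exists N => i j /HN hi /HN hj.
  rewrite -(@ltr_pXn2r _ 2) ?nnegrE ?norm_ge0 ?(ltW e0) //.
  apply: (le_lt_trans (est i j)).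
  by move: (i.+1%:R^-1) (j.+1%:R^-1) hi hj => d1 d2 hi hj; lra.
have [v Hv vlim] := HC wH cau.
exists v.
have close eps : 0 < eps -> exists2 f, W f & norm (f \- v) < eps /\ Q f < m + eps.
  move=> e0; have [N1 h1] := vlim _ e0; have [N2 h2] := inv_succ_small e0.
  exists (w (maxn N1 N2)); first exact: (Hw _).1.
  split; first by apply: h1; exact: leq_maxl.
  by apply: lt_trans (Hw _).2 _; rewrite ltrD2l; apply: h2; exact: leq_maxr.
split=> // [h hh|eps /close [f hf [h1 _]]]; last by exists f.
(* The first variation of the energy in a real direction. *)
have var g : W g -> Re (ip v g - L g) = 0.
  move=> hg; have gH := WH _ hg.
  apply: (@quadratic_ge0 _ (norm g ^+ 2)); first exact: sqr_ge0.
  move=> t eps e0.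
  pose d := eps / (2 * (1 + `|t| * norm g)).
  have k0 : 0 < 1 + `|t| * norm g by rewrite ltr_pwDl // mulr_ge0 ?norm_ge0.
  have d0 : 0 < d by rewrite divr_gt0 // mulr_gt0.
  have [f hf [f1 f2]] := close _ d0.
  have fH := WH _ hf.
  have hft : W (f \+ (t%:C%C \*o g)) by apply: vsD => //; exact: vsZ.
  have := mle _ hft; rewrite /Q norm2D //; last exact: vsZ.
  rewrite normZ // ipZr // LD //; last exact: vsZ.
  rewrite LZ // nc_real exprMn real_normK ?num_real //.
  move: f2; rewrite /Q !ReImE /= !mul0r !subr0 => f2.
  have e1 : Re (ip f g) * t <= Re (ip v g) * t + d * (`|t| * norm g).
    have := le_trans (Re_le _) (cauchy_schwarz HS HI (vsB HS fH Hv) gH).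
    rewrite ipBl // !ReImE => h3.
    have : (Re (ip f g) - Re (ip v g)) * t <= (d * norm g) * `|t|.
      apply: le_trans (ler_norm _) _; rewrite normrM ler_wpM2r //.
      by apply: le_trans h3 _; rewrite ler_wpM2r ?norm_ge0 // ltW.
    by move=> ?; lra.
  have : d * (1 + `|t| * norm g) = eps / 2 by rewrite /d; field; lra.
  have : 0 <= d * (`|t| * norm g) by apply: mulr_ge0; [exact: ltW|apply: mulr_ge0 => //; exact: norm_ge0].
  move=> h4 h5 h6.
  have := mulr_ge0 (ltW d0) (ltW k0); lra.
apply: complex_ext.
  by have := var _ hh; rewrite ReImE; lra.
have := var _ (vsZ WS 'i%C hh); have hH := WH _ hh.
rewrite ipZr // LZ // -mulrBr !ReImE /=; lra.
Qed.

End Hilbert.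

(** * Completions dual to a Hilbert space *)

Section Completion.
Variable R : realType.
Local Notation C := R[i].
Local Notation nc := (@Normc.normc R).
Local Notation Re := (@complex.Re R).
Local Notation Im := (@complex.Im R).
Local Notation fn := (C -> C).

Section RealNorm.
Variable X : completeNormedModType C.

Definition rn (x : X) : R := Re `|x|.

Lemma rnE (x : X) : `|x| = (rn x)%:C%C.
Proof.
have := normr_ge0 x; rewrite lecE => /andP[/eqP hi _].
by apply: complex_ext; rewrite //= hi.
Qed.

Lemma rnD (x y : X) : rn (x + y) <= rn x + rn y.
Proof. by have := ler_normD x y; rewrite !rnE -rmorphD lecR. Qed.

Lemma rnC (x y : X) : rn (x - y) = rn (y - x).
Proof. by rewrite /rn distrC. Qed.

Lemma rn_triangle (x y z : X) : rn (x - z) <= rn (x - y) + rn (y - z).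
Proof.
have -> : x - z = (x - y) + (y - z) by rewrite addrA subrK.
exact: rnD.
Qed.

Lemma rn_eq0 (x : X) : rn x = 0 -> x = 0.
Proof. by move=> h; apply/eqP; rewrite -normr_eq0 rnE h. Qed.

Lemma rn_complete (u : nat -> X) :
  (forall eps : R, 0 < eps -> exists N, forall m n, (N <= m)%N -> (N <= n)%N -> rn (u m - u n) < eps) ->
  exists x, forall eps : R, 0 < eps -> exists N, forall n, (N <= n)%N -> rn (u n - x) < eps.
Proof.
move=> Hu.
have : cvg (u @ \oo).
  apply: cauchy_cvg; apply: cauchy_exP => e e0.
  have /andP[/eqP di dr] : (Im e == 0) && (0 < Re e) by move: e0; rewrite ltcE /= eq_sym.
  have [N HN] := Hu _ dr; exists (u N), N => // n /= hn.
  rewrite -ball_normE /ball_ /= rnE.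
  have -> : e = (Re e)%:C%C by apply: complex_ext.
  by rewrite ltcR; apply: HN.
move=> /cvg_ex [x hx]; exists x => eps e0.
have e0' : 0 < eps%:C%C :> C by rewrite ltcR.
move/cvgrPdist_lt: hx => /(_ _ e0') [N _ HN]; exists N => n hn.
by have := HN n hn; rewrite /= rnE ltcR rnC.
Qed.

Lemma rn_dense (S : set X) : dense S -> forall x (eps : R), 0 < eps ->
  exists2 y, S y & rn (y - x) < eps.
Proof.
move=> HS x eps e0; have e0' : 0 < eps%:C%C :> C by rewrite ltcR.
have [||y [hy Sy]] := HS (ball x eps%:C%C).
- by exists x; exact: ballxx.
- exact: ball_open.
exists y => //; move: hy; rewrite -ball_normE /ball_ /= rnE ltcR.
by rewrite rnC.
Qed.

End RealNorm.

Variables (B P : fspace R) (N : fn -> R) (X : completion (carrier B) N) (J : fn -> fn).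
Hypotheses (BS : Defs.subspace B) (BI : inner_product B).
Hypotheses (PS : Defs.subspace P) (PI : inner_product P) (PC : complete_space P).
Hypothesis PB : forall f, P f -> B f.
Hypothesis JP : forall f, B f -> P (J f).
Hypothesis Jip : forall f g, B f -> P g -> inner P (J f) g = inner B f g.
Hypothesis NJ : forall f, B f -> N f = ipnorm (inner P) (J f).
Local Notation np := (ipnorm (inner P)).

Lemma J_linear a f g : B f -> B g -> J ((a \*o f) \+ g) = (a \*o J f) \+ J g.
Proof.
move=> hf hg; apply: (ip_ext PS PI); [exact: (JP (vsL BS a hf hg))|exact: (vsL PS a (JP hf) (JP hg))|].
move=> h hh; rewrite Jip //; last exact: vsL.
by rewrite (ipLl BS BI a hf hg (PB hh)) (ipLl PS PI a (JP hf) (JP hg) hh) !Jip.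
Qed.

Lemma J_B f g : B f -> B g -> J (f \- g) = J f \- J g.
Proof. by move=> hf hg; rewrite !sub_scale_add J_linear. Qed.

Lemma emb_B f g : B f -> B g -> emb X (f \- g) = emb X f - emb X g.
Proof. by move=> hf hg; rewrite sub_scale_add emb_linear // scaleN1r addrC. Qed.

Lemma emb_rn f : B f -> rn (emb X f) = np (J f).
Proof. by move=> hf; rewrite /rn emb_norm //= NJ. Qed.

(** A vector orthogonal to the range of [J] is orthogonal, in [B], to itself. *)
Lemma J_dense v (eps : R) : P v -> 0 < eps -> exists2 f, B f & np (J f \- v) < eps.
Proof.
move=> hv e0.
pose W := [set u | exists2 f, B f & u = J f].
have [||||v' [hv' e1 e2]] := @riesz _ P PS PI PC W (inner P v) (np v).
- split.
    exists (cst 0); first exact: vs0.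
    have h0 : B (cst 0) by exact: vs0.
    have := J_B h0 h0; rewrite !subff //.
  move=> a _ _ [f hf ->] [g hg ->]; exists ((a \*o f) \+ g); first exact: vsL.
  by rewrite J_linear.
- by move=> _ [f hf ->]; exact: JP.
- by move=> a _ _ [f hf ->] [g hg ->]; rewrite ipLr //; apply: JP.
- by move=> _ [f hf ->]; apply: cauchy_schwarz => //; apply: JP.
have hd : P (v \- v') by exact: vsB.
have vv : v \- v' = cst 0.
  apply: (ip_eq0 BI (PB hd)); rewrite -Jip //; last exact: PB.
  rewrite (ipC PI hd); last by apply: JP; exact: PB.
  rewrite ipBl //; last by apply: JP; exact: PB.
  by rewrite e1 ?subrr ?conjc0 //; exists (v \- v') => //; exact: PB.
have -> : v = v'.
  by apply/funext => x; have := congr1 (fun u : fn => u x) vv; rewrite /= => /eqP; rewrite subr_eq0 => /eqP.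
by have [_ [f hf ->] h] := e2 _ e0; exists f.
Qed.

(** [v] is the vector of [P] representing the functional [phi]. *)
Definition rep (phi : X) (v : fn) := P v /\ forall eps : R, 0 < eps ->
  exists f, [/\ B f, rn (emb X f - phi) < eps & np (J f \- v) < eps].

(** Both sides are limits of the same quantity along elements of [B]. *)
Lemma rep_isometry phi psi v u : rep phi v -> rep psi u -> rn (phi - psi) = np (v \- u).
Proof.
move=> [hv H1] [hu H2].
have key (eps : R) : 0 < eps -> `|rn (phi - psi) - np (v \- u)| <= eps.
  move=> e0; have e4 : 0 < eps / 4 by rewrite divr_gt0.
  have [f [hf f1 f2]] := H1 _ e4; have [g [hg g1 g2]] := H2 _ e4.
  have E : rn (emb X f - emb X g) = np (J f \- J g).
    by rewrite -emb_B // emb_rn ?J_B //; exact: vsB.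
  have Jf := JP hf; have Jg := JP hg.
  have a1 := rn_triangle phi (emb X f) psi; have a2 := rn_triangle (emb X f) (emb X g) psi.
  have a3 := rn_triangle (emb X f) phi (emb X g); have a4 := rn_triangle phi psi (emb X g).
  have b1 := norm_triangle PS PI hv Jf hu; have b2 := norm_triangle PS PI Jf Jg hu.
  have b3 := norm_triangle PS PI Jf hv Jg; have b4 := norm_triangle PS PI hv hu Jg.
  rewrite (rnC phi (emb X f)) in a1; rewrite (rnC psi (emb X g)) in a4.
  rewrite (normB PS PI hv Jf) in b1; rewrite (normB PS PI hu Jg) in b4.
  rewrite ler_norml; apply/andP; split; lra.
apply/eqP; rewrite -subr_eq0 -normr_eq0; apply/negPn/negP => h.
have h0 : 0 < `|rn (phi - psi) - np (v \- u)| by rewrite lt_def h normr_ge0.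
by have := key _ (divr_gt0 h0 (ltr0Sn _ 1)); lra.
Qed.

Lemma rep_ex phi : exists v, rep phi v.
Proof.
have /choice [f Hf] : forall n : nat, exists f, B f /\ rn (emb X f - phi) < n.+1%:R^-1.
  move=> n; have [|_ [f hf <-] h] := rn_dense (@emb_dense _ _ _ X) phi (_ : 0 < n.+1%:R^-1).
    by rewrite invr_gt0.
  by exists f.
have fB n : B (f n) := (Hf n).1.
have fJ n : P (J (f n)) := JP (fB n).
have [|v hv lim] := PC fJ.
  move=> eps e0; have [M HM] := inv_succ_small (divr_gt0 e0 (ltr0Sn _ 1)); exists M => m n hm hn.
  rewrite -J_B // -emb_rn; last exact: vsB.
  rewrite emb_B //; apply: le_lt_trans (rn_triangle _ phi _) _.
  rewrite (rnC phi).
  have := lt_trans (Hf m).2 (HM _ hm); have := lt_trans (Hf n).2 (HM _ hn); lra.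
exists v; split=> // eps e0.
have [M1 h1] := lim _ e0; have [M2 h2] := inv_succ_small e0.
exists (f (maxn M1 M2)); split; first exact: fB.
  by apply: lt_trans (Hf _).2 _; apply: h2; exact: leq_maxr.
by apply: h1; exact: leq_maxl.
Qed.

Lemma rep_onto v : P v -> exists phi, rep phi v.
Proof.
move=> hv.
have /choice [f Hf] : forall n : nat, exists f, B f /\ np (J f \- v) < n.+1%:R^-1.
  move=> n; have [|f hf h] := J_dense hv (_ : 0 < n.+1%:R^-1); last by exists f.
  by rewrite invr_gt0.
have fB n : B (f n) := (Hf n).1.
have fJ n : P (J (f n)) := JP (fB n).
have [|phi lim] := @rn_complete X (fun n => emb X (f n)).
  move=> eps e0; have [M HM] := inv_succ_small (divr_gt0 e0 (ltr0Sn _ 1)); exists M => m n hm hn.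
  rewrite -emb_B // emb_rn; last exact: vsB.
  rewrite J_B //; apply: le_lt_trans (norm_triangle PS PI (fJ m) hv (fJ n)) _.
  rewrite (normB PS PI hv) //.
  have := lt_trans (Hf m).2 (HM _ hm); have := lt_trans (Hf n).2 (HM _ hn); lra.
exists phi; split=> // eps e0.
have [M1 h1] := lim _ e0; have [M2 h2] := inv_succ_small e0.
exists (f (maxn M1 M2)); split; first exact: fB.
  by apply: h1; exact: leq_maxl.
by apply: lt_trans (Hf _).2 _; apply: h2; exact: leq_maxr.
Qed.

Lemma rep_fun phi v u : rep phi v -> rep phi u -> v = u.
Proof.
move=> h1 h2; have := rep_isometry h1 h2; rewrite subrr /rn normr0 /= => /esym h.
have := norm_eq0 PI (vsB PS h1.1 h2.1) h => /= e; apply/funext => x.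
by have := congr1 (fun u : fn => u x) e; rewrite /= => /eqP; rewrite subr_eq0 => /eqP.
Qed.

Lemma rep_inj phi psi v : rep phi v -> rep psi v -> phi = psi.
Proof.
move=> h1 h2; have := rep_isometry h1 h2; rewrite subff (norm0 PS PI) => /rn_eq0 h.
by apply/eqP; rewrite -subr_eq0 h.
Qed.

Lemma rep_emb f : B f -> rep (emb X f) (J f).
Proof.
move=> hf; split; first exact: JP.
move=> eps e0; exists f; split=> //; first by rewrite subrr /rn normr0.
by rewrite subff norm0.
Qed.

(** The continuous extension exists because [rep] is an isometry, and it is unique on
    [X * P] because [B] is dense in [X]. *)
Theorem pairing_spec phi v h : rep phi v -> P h -> pairing P phi h = inner P v h.
Proof.
move=> hphi hh; rewrite /pairing.
have [V HV] : {V : X -> fn & forall phi, rep phi (V phi)} by exact: choice rep_ex.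
have exP : continuous_extension P (fun phi h => inner P (V phi) h) (X := X).
  split.
    move=> f g hf hg /=; rewrite -Jip //; congr inner; exact: (rep_fun (HV _) (rep_emb hf)).
  move=> ph g hg eps e0 /=.
  have vP x := (HV x).1.
  have k0 : 0 < np (V ph) + np g + 1 by rewrite ltr_wpDl // addr_ge0 ?norm_ge0.
  exists (Num.min 1 (eps / (np (V ph) + np g + 1))); first by rewrite lt_min ltr01 divr_gt0.
  move=> ph' g' hg' h1 h2.
  set d := Num.min _ _ in h1 h2.
  have d1 : d <= 1 by rewrite ge_min lexx.
  have d0 : 0 < d by rewrite lt_min ltr01 divr_gt0.
  have dk : d * (np (V ph) + np g + 1) <= eps by rewrite -ler_pdivlMr // ge_min lexx orbT.
  rewrite rnE ltcR (rep_isometry (HV ph') (HV ph)) in h1.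
  have dV : P (V ph' \- V ph) by apply: vsB.
  have dg : P (g' \- g) by apply: vsB.
  have -> : inner P (V ph') g' - inner P (V ph) g =
     inner P (V ph' \- V ph) (g' \- g) + inner P (V ph' \- V ph) g + inner P (V ph) (g' \- g).
    by rewrite !ipBl ?ipBr //; ring.
  apply: le_lt_trans (ncD _ _) _; apply: le_lt_trans (lerD (ncD _ _) (lexx _)) _.
  have c1 := cauchy_schwarz PS PI dV dg; have c2 := cauchy_schwarz PS PI dV hg.
  have c3 := cauchy_schwarz PS PI (vP ph) dg.
  have n1 := norm_ge0 P (V ph' \- V ph); have n2 := norm_ge0 P (g' \- g).
  have n3 := norm_ge0 P (V ph); have n4 := norm_ge0 P g.
  set x := np (V ph' \- V ph) in h1 c1 c2 n1; set y := np (g' \- g) in h2 c1 c3 n2.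
  have m1 : x * y <= x * d by rewrite ler_wpM2l // ltW.
  have m1' : x * d < d * d by rewrite ltr_pM2r.
  have m1'' : d * d <= d * 1 by rewrite ler_pM2l.
  have m2 : x * np g <= d * np g by rewrite ler_wpM2r // ltW.
  have m3 : np (V ph) * y <= np (V ph) * d by rewrite ler_wpM2l // ltW.
  lra.
have : continuous_extension P (xget (fun _ _ => 0) [set p | continuous_extension P (X := X) p]) (X := X).
  by apply: (@xgetPex _ (fun _ _ => 0) [set p | continuous_extension P (X := X) p]); eexists; exact: exP.
move: (xget _ _) => p [p1 p2].
apply/eqP; rewrite -subr_eq0 -nc_eq0; apply/negPn/negP => h0.
have hp : 0 < nc (p phi h - inner P v h) by rewrite lt_def h0 nc_ge0.
set q := nc _ in hp.
have q2 : 0 < q / 2 by rewrite divr_gt0.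
have [del d0 Hd] := p2 phi h hh _ q2.
have k0 : 0 < np h + 1 by rewrite ltr_wpDl ?norm_ge0.
have m0 : 0 < Num.min del (q / 2 / (np h + 1)) by rewrite lt_min d0 divr_gt0.
have [f [hf f1 f2]] := hphi.2 _ m0.
have := Hd (emb X f) h hh; rewrite rnE ltcR (lt_le_trans f1) ?ge_min ?lexx // => /(_ isT).
rewrite subff norm0 // => /(_ d0); rewrite p1 // -Jip // => r1.
have hd : P (J f \- v) by apply: vsB => //; [exact: JP|exact: hphi.1].
have r2 := cauchy_schwarz PS PI hd hh; rewrite ipBl // in r2; [|exact: JP|exact: hphi.1].
have r3 : np (J f \- v) * np h <= q / 2.
  apply: le_trans (_ : (q / 2 / (np h + 1)) * (np h + 1) <= _); last by rewrite divfK ?gt_eqF.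
  apply: ler_pM; rewrite ?norm_ge0 ?lerDl //.
  by apply: ltW; apply: lt_le_trans f2 _; rewrite ge_min lexx orbT.
have : q <= nc (inner P (J f) h - p phi h) + nc (inner P (J f) h - inner P v h).
  rewrite (ncC _ (p phi h)); apply: le_trans (ncD _ _).
  by rewrite /q le_eqVlt; apply/orP; left; apply/eqP; congr nc; ring.
lra.
Qed.

End Completion.

(** * Graph norms and adjoints *)

Section Operators.
Variable R : realType.
Local Notation C := R[i].
Local Notation nc := (@Normc.normc R).
Local Notation Re := (@complex.Re R).
Local Notation Im := (@complex.Im R).
Local Notation fn := (C -> C).
Variable B : fspace R.
Hypotheses (BS : Defs.subspace B) (BI : inner_product B) (BC : complete_space B).
Local Notation ip := (inner B).
Local Notation nb := (ipnorm (inner B)).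

Section Dual.
Variable P : fspace R.
Hypotheses (PS : Defs.subspace P) (PI : inner_product P) (PC : complete_space P).
Hypothesis PB : forall f, P f -> B f.
Local Notation np := (ipnorm (inner P)).

(** On a space with a larger norm every element of [B] is a bounded functional. *)
Lemma dual_rep : (forall f, P f -> nb f <= np f) ->
  exists J : fn -> fn, (forall f, B f -> P (J f)) /\
    forall f g, B f -> P g -> inner P (J f) g = ip f g.
Proof.
move=> nbp.
have ex f : exists u, B f -> P u /\ forall g, P g -> inner P u g = ip f g.
  have [hf|hf] := pselect (B f); last by exists f.
  have [//|||u [hu E _]] := @riesz _ P PS PI PC P (ip f) (nb f) PS.
  - by move=> a g h hg hh; rewrite ipLr //; apply: PB.
  - move=> g hg; apply: le_trans (cauchy_schwarz BS BI hf (PB hg)) _.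
    by rewrite ler_wpM2l ?norm_ge0 ?nbp.
  by exists u => _; split=> // g hg; rewrite -E.
have [J HJ] := choice ex.
by exists J; split=> [f /HJ []//|f g /HJ [_]]; apply.
Qed.

(** The supremum is attained at [J f], unless this vector vanishes. *)
Lemma dual_normE (J : fn -> fn) f : (forall f, B f -> P (J f)) ->
  (forall f g, B f -> P g -> inner P (J f) g = ip f g) -> B f ->
  dual_norm B P f = np (J f).
Proof.
move=> JP Jip hf; have Jf := JP _ hf.
have ub : ubound [set nc (ip f g) / np g | g in [set g | P g /\ g <> cst 0]] (np (J f)).
  move=> _ [g [hg g0] <-].
  have gp : 0 < np g.
    by rewrite lt_def norm_ge0 andbT; apply/eqP => /(norm_eq0 PI hg).
  by rewrite ler_pdivrMr // -Jip // cauchy_schwarz.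
rewrite /dual_norm; apply/eqP; rewrite eq_le; apply/andP; split.
  have [ne|e] := pselect ([set nc (ip f g) / np g | g in [set g | P g /\ g <> cst 0]] !=set0).
    by apply: ge_sup.
  rewrite (_ : [set _ | _ in _] = set0) ?sup0 ?norm_ge0 //.
  by apply/eqP; rewrite -(negbK (_ == _)); apply/negP => /set0P.
have [J0|J0] := pselect (J f = cst 0).
  rewrite J0 norm0 // -[leLHS](sup0 R).
  have [ne|e] := pselect ([set nc (ip f g) / np g | g in [set g | P g /\ g <> cst 0]] !=set0).
    have [x [g [hg g0] gx]] := ne.
    rewrite sup0; apply: le_trans (_ : x <= _); last by apply: ub_le_sup; [exists (np (J f))|exists g].
    by rewrite -gx divr_ge0 ?nc_ge0 ?norm_ge0.
  rewrite (_ : [set _ | _ in _] = set0) //.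
  by apply/eqP; rewrite -(negbK (_ == _)); apply/negP => /set0P.
apply: ub_le_sup; first by exists (np (J f)).
exists (J f) => //=; rewrite -Jip // (ip_norm PI Jf) nc_real ger0_norm ?sqr_ge0 //.
rewrite expr2 mulfK //; apply/eqP => /(norm_eq0 PI Jf); exact: J0.
Qed.

End Dual.

Definition converges (u : nat -> fn) (f : fn) := forall eps : R, 0 < eps ->
  exists N, forall n, (N <= n)%N -> nb (u n \- f) < eps.

Lemma converges_ip u f h : (forall n, B (u n)) -> B f -> B h -> converges u f ->
  (forall eps : R, 0 < eps -> exists N, forall n, (N <= n)%N -> nc (ip (u n) h - ip f h) < eps).
Proof.
move=> hu hf hh Hc eps e0; have k0 : 0 < nb h + 1 by rewrite ltr_wpDl ?norm_ge0.
have [N HN] := Hc _ (divr_gt0 e0 k0); exists N => n /HN hn.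
rewrite -(ipBl BS BI (hu n) hf hh).
apply: le_lt_trans (cauchy_schwarz BS BI (vsB BS (hu n) hf) hh) _.
apply: le_lt_trans (_ : nb (u n \- f) * (nb h + 1) < _).
  by rewrite ler_wpM2l ?norm_ge0 // lerDl.
by rewrite -ltr_pdivlMr.
Qed.

Lemma converges_eq u v f g h k : (forall n, B (u n)) -> (forall n, B (v n)) -> B f -> B g ->
  B h -> B k -> converges u f -> converges v g -> (forall n, ip (u n) h = ip (v n) k) ->
  ip f h = ip g k.
Proof.
move=> hu hv hf hg hh hk cu cv E; apply/eqP; rewrite -subr_eq0 -nc_eq0; apply/negPn/negP => d.
have d0 : 0 < nc (ip f h - ip g k) by rewrite lt_def d nc_ge0.
have d2 : 0 < nc (ip f h - ip g k) / 2 by rewrite divr_gt0.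
have [N1 h1] := converges_ip hu hf hh cu d2; have [N2 h2] := converges_ip hv hg hk cv d2.
have := h1 _ (leq_maxl N1 N2); have := h2 _ (leq_maxr N1 N2).
set n := maxn _ _ => a1 a2.
have : nc (ip f h - ip g k) <= nc (ip (u n) h - ip f h) + nc (ip (v n) k - ip g k).
  rewrite (ncC _ (ip f h)); apply: le_trans (ncD _ _).
  by rewrite E le_eqVlt; apply/orP; left; apply/eqP; congr nc; ring.
lra.
Qed.

(** Closedness in terms of sequences, which makes the graph norm complete. *)
Definition closed_op (A : oper R) := [/\ Defs.subspace (dom A),
  (forall f, dom A f -> B f /\ B (A f)),
  (forall a f g, dom A f -> dom A g -> A ((a \*o f) \+ g) = (a \*o A f) \+ A g) &
  (forall u f g, (forall n, dom A (u n)) -> B f -> B g -> converges u f ->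
     converges (fun n => A (u n)) g -> dom A f /\ A f = g)].

Section Graph.
Variable A : oper R.
Hypothesis HA : closed_op A.
Local Notation P := (graph_space B A).

Lemma domB f : dom A f -> B f. Proof. by case: HA => _ h _ _ /h []. Qed.
Lemma imB f : dom A f -> B (A f). Proof. by case: HA => _ h _ _ /h []. Qed.
Lemma op_linear a f g : dom A f -> dom A g -> A ((a \*o f) \+ g) = (a \*o A f) \+ A g.
Proof. by case: HA => _ _ h _; apply: h. Qed.
Lemma op_B f g : dom A f -> dom A g -> A (f \- g) = A f \- A g.
Proof. by move=> hf hg; rewrite !sub_scale_add op_linear. Qed.

Lemma graph_subspace : Defs.subspace P. Proof. by case: HA. Qed.

Lemma graph_inner_product : inner_product P.
Proof.
have dB := domB; have iB := imB.
split.
- move=> a f g h hf hg hh /=; rewrite /graph_inner op_linear // !ipLr //; try by [apply: dB|apply: iB].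
  by ring.
- move=> f g hf hg /=; rewrite /graph_inner conjcD.
  by rewrite (ipC BI (iB _ hf) (iB _ hg)) (ipC BI (dB _ hf) (dB _ hg)).
- by move=> f hf; rewrite addr_ge0 ?ip_ge0 //; [apply: iB|apply: dB].
- move=> f hf /eqP; rewrite /= /graph_inner paddr_eq0 ?ip_ge0 //; try by [apply: dB|apply: iB].
  by move=> /andP[_ /eqP]; apply: ip_eq0 => //; apply: dB.
Qed.

Lemma graph_norm2 f : dom A f -> ipnorm (inner P) f ^+ 2 = nb (A f) ^+ 2 + nb f ^+ 2.
Proof.
move=> hf; rewrite -(Re_ip graph_inner_product) // /= /graph_inner ReD !Re_ip //.
  exact: domB.
exact: imB.
Qed.

Lemma graph_norm_dom f : dom A f -> nb f <= ipnorm (inner P) f.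
Proof.
move=> hf; rewrite -(@ler_pXn2r _ 2) ?nnegrE ?norm_ge0 // graph_norm2 //.
by rewrite lerDr sqr_ge0.
Qed.

Lemma graph_norm_im f : dom A f -> nb (A f) <= ipnorm (inner P) f.
Proof.
move=> hf; rewrite -(@ler_pXn2r _ 2) ?nnegrE ?norm_ge0 // graph_norm2 //.
by rewrite lerDl sqr_ge0.
Qed.

Lemma graph_complete : complete_space P.
Proof.
move=> u hu cau; have PS := graph_subspace.
have hB n : B (u n) := domB (hu n); have hI n : B (A (u n)) := imB (hu n).
have hd m n : dom A (u m \- u n) := vsB PS (hu m) (hu n).
have [|f hf cf] := BC hB.
  move=> eps /cau [N HN]; exists N => m n hm hn.
  exact: le_lt_trans (graph_norm_dom (hd m n)) (HN _ _ hm hn).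
have [|g hg cg] := BC hI.
  move=> eps /cau [N HN]; exists N => m n hm hn.
  have := graph_norm_im (hd m n); rewrite (op_B (hu m) (hu n)) => h.
  exact: (le_lt_trans h (HN _ _ hm hn)).
have [df Af] : dom A f /\ A f = g by case: HA => _ _ _ h; apply: (h u).
exists f => // eps e0; have e2 : 0 < eps / 2 by rewrite divr_gt0.
have [N1 h1] := cf _ e2; have [N2 h2] := cg _ e2; exists (maxn N1 N2) => n.
rewrite geq_max => /andP[/h1 a1 /h2 a2].
have hdn : dom A (u n \- f) := vsB PS (hu n) df.
rewrite -(@ltr_pXn2r _ 2) ?nnegrE ?norm_ge0 ?(ltW e0) // graph_norm2 // (op_B (hu n) df) Af.
have b1 : nb (u n \- f) ^+ 2 < (eps / 2) ^+ 2 by rewrite ltr_pXn2r ?nnegrE ?norm_ge0 ?(ltW e2).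
have b2 : nb (A (u n) \- g) ^+ 2 < (eps / 2) ^+ 2 by rewrite ltr_pXn2r ?nnegrE ?norm_ge0 ?(ltW e2).
have : (eps / 2) ^+ 2 = eps ^+ 2 / 4 by field.
have := exprn_gt0 2 e0; lra.
Qed.

End Graph.

Section Adjoint.
Variable A : oper R.
Hypothesis Adense : densely_defined B A.
Hypothesis AB : forall f, dom A f -> B f /\ B (A f).

Lemma orth_dense g : B g -> (forall f, dom A f -> ip g f = 0) -> g = cst 0.
Proof.
move=> hg E; apply: (norm_eq0 BI hg); apply/eqP/negPn/negP => n0.
have np : 0 < nb g by rewrite lt_def n0 norm_ge0.
have [f df h] := Adense hg np.
have := cauchy_schwarz BS BI hg (vsB BS hg (AB df).1).
rewrite (ipBr BI hg (AB df).1 hg) (E _ df) subr0 (ip_norm BI hg) nc_real ger0_norm ?sqr_ge0 //.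
by rewrite expr2 ler_pM2l // leNgt h.
Qed.

Lemma adjointP g u : B g -> B u -> (forall f, dom A f -> ip g (A f) = ip u f) ->
  dom (adjoint B A) g /\ adjoint B A g = u.
Proof.
move=> hg hu E; have G : [/\ B g, B u & forall f, dom A f -> ip g (A f) = ip u f] by [].
split; first by exists u.
have [_ h1 h2] := xgetPex (cst 0) (ex_intro (fun u => [/\ B g, B u & forall f, dom A f -> ip g (A f) = ip u f]) u G).
rewrite /adjoint /oper_of /=; move: h1 h2; move: (xget _ _) => v hv Ev.
have := orth_dense (vsB BS hv hu) => /(_ _) h.
have e : v \- u = cst 0.
  by apply: h => f df; rewrite (ipBl BS BI) -?E -?Ev ?subrr //; case: (AB df).
apply/funext => x; have := congr1 (fun u : fn => u x) e.
by rewrite /= => /eqP; rewrite subr_eq0 => /eqP.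
Qed.

Lemma adjointE g : dom (adjoint B A) g ->
  [/\ B g, B (adjoint B A g) & forall f, dom A f -> ip g (A f) = ip (adjoint B A g) f].
Proof. by case=> u [hg hu E]; have [_ ->] := adjointP hg hu E. Qed.

Lemma adjoint_closed : closed_op (adjoint B A).
Proof.
have lin a f g : dom (adjoint B A) f -> dom (adjoint B A) g ->
    dom (adjoint B A) ((a \*o f) \+ g) /\
    adjoint B A ((a \*o f) \+ g) = (a \*o adjoint B A f) \+ adjoint B A g.
  move=> /adjointE [f1 f2 f3] /adjointE [g1 g2 g3]; apply: adjointP; try exact: vsL.
  move=> h dh; have [h1 h2] := AB dh.
  by rewrite !(ipLl BS BI) // f3 // g3.
split.
- split; last by move=> a f g hf hg; case: (lin a f g hf hg).
  have h0 := vs0 BS; apply: (proj1 (adjointP h0 h0 _)) => f /AB [h1 h2].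
  by rewrite !ip0l.
- by move=> f /adjointE [].
- by move=> a f g hf hg; case: (lin a f g hf hg).
- move=> u f g hu hf hg cu cv; apply: adjointP => // h dh; have [h1 h2] := AB dh.
  have uB n := let: And3 a _ _ := adjointE (hu n) in a.
  have vB n := let: And3 _ a _ := adjointE (hu n) in a.
  by apply: (converges_eq uB vB) => // n; case: (adjointE (hu n)) => _ _; apply.
Qed.

End Adjoint.

Section SelfAdjoint.
Variable A : oper R.
Hypothesis AS : Defs.subspace (dom A).
Hypothesis AB : forall f, dom A f -> B f /\ B (A f).
Hypothesis AL : forall a f g, dom A f -> dom A g -> A ((a \*o f) \+ g) = (a \*o A f) \+ A g.
Hypothesis Asym : forall f g, dom A f -> dom A g -> ip f (A g) = ip (A f) g.
Hypothesis Amax : forall f g, B f -> B g ->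
  (forall h, dom A h -> ip f (A h) = ip g h) -> dom A f /\ A f = g.

Lemma selfadjoint_closed : closed_op A.
Proof.
split=> // u f g hu hf hg cu cv; apply: Amax => // h dh; have [h1 h2] := AB dh.
apply: (converges_eq (fun n => (AB (hu n)).1) (fun n => (AB (hu n)).2)) => // n.
exact: Asym.
Qed.

(** The solution of [A^2 u + u = f] is the vector representing [f] in the graph norm. *)
Lemma inv_sqr1P f : B f ->
  [/\ dom A (inv_sqr1 A f), dom A (A (inv_sqr1 A f)) & A (A (inv_sqr1 A f)) \+ inv_sqr1 A f = f].
Proof.
move=> hf; apply: (@xgetPex _ (cst 0) [set u | [/\ dom A u, dom A (A u) & A (A u) \+ u = f]]).
have HA := selfadjoint_closed.
have [J [JP Jip]] := dual_rep (graph_subspace HA) (graph_inner_product HA) (graph_complete HA)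
  (domB HA) (graph_norm_dom HA).
have dJ := JP _ hf; have [j1 j2] := AB dJ.
have [h1 h2] : dom A (A (J f)) /\ A (A (J f)) = f \- J f.
  apply: Amax => //; first exact: vsB.
  move=> h dh; have [k1 k2] := AB dh; rewrite (ipBl BS BI) //.
  by rewrite -(Jip f h) // /graph_inner addrK.
exists (J f); split=> //; rewrite h2; apply/funext => x /=; exact: subrK.
Qed.

(** Hence the norm of the space with index -2 is again a dual norm. *)
Lemma inv_sqr1_ip f g : B f -> dom A g -> graph_inner B A (inv_sqr1 A f) g = ip f g.
Proof.
move=> hf dg; have [h1 h2 h3] := inv_sqr1P hf.
have [k1 k2] := AB h1; have [k3 k4] := AB h2; have [g1 g2] := AB dg.
by rewrite /graph_inner Asym // -{3}h3 (ipDl BS BI).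
Qed.

End SelfAdjoint.
End Operators.

(** * Integrability on the real line and on horizontal lines *)

Section LineIntegrals.
Variable R : realType.
Local Notation C := R[i].
Local Notation nc := (@Normc.normc R).
Local Notation Re := (@complex.Re R).
Local Notation Im := (@complex.Im R).
Local Notation mu := (@lebesgue_measure R).

Definition integ (f : R -> R) := mu.-integrable setT (EFin \o f).

Lemma integ_le (f g : R -> R) : measurable_fun setT f -> (forall x, `|f x| <= g x) ->
  integ g -> integ f.
Proof.
move=> mf fg; apply: le_integrable => //; first exact/measurable_EFinP.
by move=> x _ /=; rewrite lee_fin (le_trans (fg x)) // ler_norm.
Qed.

Lemma integD f g : integ f -> integ g -> integ (fun x => f x + g x).
Proof. by move=> hf hg; exact: (integrableD measurableT hf hg). Qed.

Lemma integZ k f : integ f -> integ (fun x => k * f x).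
Proof. by move=> hf; exact: (integrableZl measurableT k hf). Qed.

Lemma integ_itv (a b : R) f : integ f -> mu.-integrable `[a, b] (EFin \o f).
Proof. by move=> hf; apply: integrableS hf. Qed.

Lemma integ_bounded (f : R -> R) (M : R) : measurable_fun setT f -> (forall x, 0 <= f x) ->
  (\int[mu]_x (f x)%:E <= M%:E)%E -> integ f.
Proof.
move=> mf f0 fM; apply/integrableP; split; first exact/measurable_EFinP.
apply: le_lt_trans (ltry M).
rewrite (_ : (fun x => _) = (fun x => (f x)%:E)) //.
by apply/funext => x /=; rewrite ger0_norm.
Qed.

Lemma cauchy_density_gt0 (x : R) : 0 < 1 + x ^+ 2.
Proof. by rewrite ltr_pwDl // sqr_ge0. Qed.

Lemma integ_cauchy_density : integ (fun x => (1 + x ^+ 2)^-1).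
Proof.
apply: (@integ_bounded _ pi).
- by apply: continuous_measurable_fun; exact: (@continuous_oneDsqrV R).
- by move=> x; rewrite invr_ge0 ltW // cauchy_density_gt0.
rewrite (@ge0_symfun_integralT _ (fun x => (1 + x ^+ 2)^-1)).
- have -> : [set x : R | 0 <= x] = `[0, +oo[%classic.
    by apply/seteqP; split => x /=; rewrite in_itv /= andbT.
  have := @integral0y_oneDsqr R; rewrite /oneDsqr => ->.
  by rewrite -EFinM lee_fin mulrC divfK.
- by move=> x; rewrite invr_ge0 ltW // cauchy_density_gt0.
- exact: continuous_oneDsqrV.
- by move=> x /=; rewrite sqrrN.
Qed.

(** Recentering the Cauchy density costs a constant. *)
Lemma cauchy_density_shift (u x : R) : (1 + (x - u) ^+ 2)^-1 <= 2 * (1 + u ^+ 2) * (1 + x ^+ 2)^-1.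
Proof.
rewrite -ler_pdivrMl ?mulr_gt0 ?cauchy_density_gt0 // -invfM lef_pV2 ?posrE ?cauchy_density_gt0 //; last first.
  by rewrite !mulr_gt0 ?cauchy_density_gt0.
have h1 := sqr_ge0 (x - u - u); have h2 := sqr_ge0 (u * (x - u)); have h3 := sqr_ge0 (x - u).
have : 2 * (1 + u ^+ 2) * (1 + (x - u) ^+ 2) - (1 + x ^+ 2) =
  (x - u - u) ^+ 2 + 2 * (u * (x - u)) ^+ 2 + 1 by ring.
lra.
Qed.

Definition sqn (F : C -> C) (z : C) : R := nc (F z) ^+ 2.

Lemma line_continuous (F : C -> C) (y : R) : (forall x, ccont F (x +i* y)%C) ->
  [/\ continuous (fun x => Re (F (x +i* y)%C)), continuous (fun x => Im (F (x +i* y)%C)) &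
   continuous (fun x => sqn F (x +i* y)%C)].
Proof.
move=> HF.
have h1 x := (pcont_cts (pcont_h y x) (HF x)).1.
have h2 x := (pcont_cts (pcont_h y x) (HF x)).2.
split=> //.
rewrite (_ : (fun x => _) = (fun x => Re (F (x +i* y)%C) * Re (F (x +i* y)%C) +
   Im (F (x +i* y)%C) * Im (F (x +i* y)%C))); last first.
  by apply/funext => x; rewrite /sqn nc_sqr !expr2.
by move=> x; apply: cvgD; apply: cvgM; [exact: h1|exact: h1|exact: h2|exact: h2].
Qed.

Lemma line_measurable (F : C -> C) (y : R) : (forall x, ccont F (x +i* y)%C) ->
  [/\ measurable_fun setT (fun x => Re (F (x +i* y)%C)),
      measurable_fun setT (fun x => Im (F (x +i* y)%C)) &
      measurable_fun setT (fun x => sqn F (x +i* y)%C)].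
Proof.
move=> /line_continuous [h1 h2 h3]; split; exact: continuous_measurable_fun.
Qed.

Lemma column_continuous (F : C -> C) (x : R) : (forall z, 0 <= Im z -> ccont F z) ->
  continuous (fun y : R => sqn F (x +i* `|y|)%C).
Proof.
move=> HF.
have pc y : pcont (fun y : R => (x +i* `|y|)%C) y.
  by apply: pcontP => /=; [exact: cvg_cst|exact: (@norm_continuous _ R^o y)].
have hF (y : R) : ccont F (x +i* `|y|)%C by apply: HF => /=.
have h1 y := (pcont_cts (pc y) (hF y)).1.
have h2 y := (pcont_cts (pc y) (hF y)).2.
rewrite (_ : (fun y => _) = (fun y : R => Re (F (x +i* `|y|)%C) * Re (F (x +i* `|y|)%C) +
   Im (F (x +i* `|y|)%C) * Im (F (x +i* `|y|)%C))); last first.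
  by apply/funext => y; rewrite /sqn nc_sqr !expr2.
by move=> y; apply: cvgD; apply: cvgM; [exact: h1|exact: h1|exact: h2|exact: h2].
Qed.

(** A function that is measurable in one variable and continuous in the other is
    jointly measurable: approximate the second variable from a countable grid. *)
Lemma separately_measurable (f : R -> R -> R) :
  (forall y, 0 <= y -> measurable_fun setT (f^~ y)) ->
  (forall x, continuous (fun y : R => f x `|y|)) ->
  measurable_fun setT (fun z : R * R => f z.1 `|z.2|).
Proof.
move=> mf cf.
pose g (n : nat) (y : R) : R := (Num.truncn (`|y| * n.+1%:R))%:R / n.+1%:R.
have g_ge0 n y : 0 <= g n y by rewrite /g divr_ge0.
have glim (y : R) : g n y @[n --> \oo] --> `|y|.
  apply/cvgrPdist_lt => e e0; have [N HN] := inv_succ_small e0; exists N => // n /= hn.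
  have n0 : 0 < n.+1%:R :> R by [].
  have p0 : 0 <= `|y| * n.+1%:R by rewrite mulr_ge0.
  have /andP[h1 h2] := truncn_itv p0.
  apply: le_lt_trans (HN n hn).
  have -> : `|y| - g n y = (`|y| * n.+1%:R - (Num.truncn (`|y| * n.+1%:R))%:R) / n.+1%:R.
    by rewrite /g mulrBl mulfK // gt_eqF.
  rewrite normrM [X in _ * X]ger0_norm ?invr_ge0 // -[leRHS]mul1r ler_pM2r ?invr_gt0 //.
  rewrite ger0_norm ?subr_ge0 // lerBlDl natr1; exact: ltW.
apply: (@measurable_fun_cvg _ _ _ _ (fun n (z : R * R) => f z.1 (g n z.2))); last first.
  move=> z _ /=.
  have h : (fun y : R => f z.1 `|y|) y @[y --> `|z.2|] --> f z.1 `|z.2|.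
    by have := cf z.1 `|z.2|; rewrite /continuous_at normr_id.
  have : (fun n => f z.1 `|g n z.2|) @ \oo --> f z.1 `|z.2|.
    exact: (cvg_comp _ _ (glim z.2) h).
  by rewrite (_ : (fun n => _) = (fun n => f z.1 (g n z.2))) //; apply/funext => n; rewrite ger0_norm.
move=> n.
pose E (k : nat) : set (R * R) := [set z | Num.truncn (`|z.2| * n.+1%:R) = k].
have mE k : measurable (E k).
  have -> : E k = setT `&` (fun z : R * R => `|z.2| * n.+1%:R) @^-1` `[k%:R, k.+1%:R[%classic.
    rewrite setTI; apply/seteqP; split => z; rewrite /E /= in_itv /=.
      by move=> <-; apply: truncn_itv; rewrite mulr_ge0.
    by move=> h; apply/eqP; rewrite truncn_eq // mulr_ge0.
  have mf2 : measurable_fun setT (fun z : R * R => `|z.2| * n.+1%:R).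
    apply: measurable_funM; last exact: measurable_cst.
    by apply: measurableT_comp => //; exact: measurable_snd.
  exact: (mf2 measurableT).
have -> : [set: R * R] = \bigcup_k E k.
  by apply/seteqP; split => // z _; exists (Num.truncn (`|z.2| * n.+1%:R)).
apply/measurable_fun_bigcup => // k.
apply: (eq_measurable_fun (fun z : R * R => f z.1 (k%:R / n.+1%:R))).
  by move=> z; rewrite inE /E /= /g => ->.
apply: measurable_funTS; apply: (measurableT_comp (mf (k%:R / n.+1%:R) _)); last exact: measurable_fst.
by rewrite divr_ge0.
Qed.

End LineIntegrals.

(** * Hardy-class estimates on horizontal lines *)

Section HardyLines.
Variable R : realType.
Local Notation C := R[i].
Local Notation nc := (@Normc.normc R).
Local Notation Re := (@complex.Re R).
Local Notation Im := (@complex.Im R).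
Local Notation mu := (@lebesgue_measure R).

Definition IR (f : R -> R) : R := Rintegral mu setT f.

Lemma IR_E f : integ f -> (\int[mu]_x (f x)%:E)%E = (IR f)%:E.
Proof. by move=> hf; rewrite /IR /Rintegral fineK //; exact: integrable_fin_num. Qed.

Lemma IRD f g : integ f -> integ g -> IR (fun x => f x + g x) = IR f + IR g.
Proof. by move=> hf hg; rewrite /IR RintegralD. Qed.

Lemma IRZ k f : integ f -> IR (fun x => k * f x) = k * IR f.
Proof. by move=> hf; rewrite /IR RintegralZl. Qed.

Lemma le_IR f g : integ f -> integ g -> (forall x, f x <= g x) -> IR f <= IR g.
Proof. by move=> hf hg fg; apply: le_Rintegral => // x _; exact: fg. Qed.

Lemma IR_ge0 f : (forall x, 0 <= f x) -> 0 <= IR f.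
Proof. by move=> f0; apply: fine_ge0; apply: integral_ge0 => x _; rewrite lee_fin. Qed.

Lemma Iab_le_IR a b f : integ f -> (forall x, 0 <= f x) -> Iab a b f <= IR f.
Proof.
move=> hf f0; rewrite /Iab /IR /Rintegral fine_le //.
- exact: integrable_fin_num (integ_itv a b hf).
- exact: integrable_fin_num.
apply: ge0_subset_integral => //; last by move=> x _; rewrite lee_fin.
by case/integrableP: hf.
Qed.

Lemma sqn_ge0 (F : C -> C) z : 0 <= sqn F z. Proof. exact: sqr_ge0. Qed.

Lemma hardy_intro (F : C -> C) (M : R) : (forall z, 0 < Im z -> holomorphic_at F z) ->
  (forall y, 0 < y -> integ (fun x => sqn F (x +i* y)%C) /\ IR (fun x => sqn F (x +i* y)%C) <= M) ->
  hardy2 F.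
Proof.
move=> hol H; split=> //; exists M => y y0; have [h1 h2] := H y y0.
by rewrite (IR_E h1) lee_fin.
Qed.

(** The boundary line is reached by Fatou's lemma. *)
Lemma hardy_lines (F : C -> C) : (forall z, 0 <= Im z -> ccont F z) -> hardy2 F ->
  exists2 M : R, 0 <= M & forall y, 0 <= y ->
    integ (fun x => sqn F (x +i* y)%C) /\ IR (fun x => sqn F (x +i* y)%C) <= M.
Proof.
move=> HF [_ [M0 HM0]]; pose M := Num.max 0 M0.
have Mge : 0 <= M by rewrite le_max lexx.
have HM (y : R) : 0 < y -> (\int[mu]_x (sqn F (x +i* y)%C)%:E <= M%:E)%E.
  by move=> /HM0 h; apply: le_trans h _; rewrite lee_fin le_max lexx orbT.
have mF (y : R) : 0 <= y -> measurable_fun setT (fun x : R => sqn F (x +i* y)%C).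
  by move=> y0; have [] := @line_measurable R F y (fun x => HF (x +i* y)%C y0).
have HM' (y : R) : 0 <= y -> (\int[mu]_x (sqn F (x +i* y)%C)%:E <= M%:E)%E.
  rewrite le_eqVlt => /predU1P[<-|/HM //].
  pose f (n : nat) (x : R) : \bar R := (sqn F (x +i* (n.+1%:R^-1))%C)%:E.
  have fl x : (f^~ x) @ \oo --> (sqn F (x +i* 0)%C)%:E.
    apply/fine_cvgP; split; first by apply: nearW.
    have h : (fun y : R => sqn F (x +i* `|y|)%C) y @[y --> (0:R)] --> sqn F (x +i* 0)%C.
      by have := @column_continuous R F x HF 0; rewrite /continuous_at normr0.
    have := cvg_comp _ _ (@cvg_harmonic R) h.
    rewrite (_ : _ \o _ = fun n => fine (f n x)) //.
    by apply/funext => n /=; rewrite /harmonic ger0_norm // invr_ge0.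
  rewrite (_ : (fun x => _) = (fun x => limn_einf (f^~ x))); last first.
    by apply/funext => x; rewrite (cvg_limn_einf_sup (fl x)).
  apply: le_trans (fatou mu measurableT _ _) _.
  - by move=> n; apply/measurable_EFinP; apply: mF; rewrite invr_ge0.
  - by move=> n x _; rewrite lee_fin sqn_ge0.
  rewrite limn_einf_lim; apply: lime_le; first exact: is_cvg_einfs.
  apply: nearW => n; apply: le_trans (HM n.+1%:R^-1 _); last by rewrite invr_gt0.
  by apply: ereal_inf_lbound; exists n => /=.
exists M => // y y0.
have h : integ (fun x => sqn F (x +i* y)%C).
  by apply: integ_bounded (HM' y y0); [exact: mF|move=> x; exact: sqn_ge0].
by split=> //; rewrite -lee_fin -IR_E // HM'.
Qed.

Section WithE.
Variable e : C -> C.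
Hypotheses (HB : hermite_biehler e) (Hreal : forall x : R, e x%:C%C != 0).

Lemma e_ne0 z : 0 <= Im z -> e z != 0.
Proof.
rewrite le_eqVlt => /predU1P[h|h].
  by have -> : z = (Re z)%:C%C; [apply: complex_ext|exact: Hreal].
have := HB.2 z h; rewrite !normE ltcR -nc_gt0; exact: le_lt_trans (nc_ge0 _).
Qed.

Lemma e_holo z : holomorphic_at e z. Proof. by case: HB. Qed.

Lemma quo_holo (g : C -> C) z : entire g -> 0 <= Im z -> holomorphic_at (fun z => g z / e z) z.
Proof. by move=> hg /e_ne0 h; apply: holo_div => //; exact: e_holo. Qed.

Lemma quo_ccont (g : C -> C) z : entire g -> 0 <= Im z -> ccont (fun z => g z / e z) z.
Proof. by move=> hg hz; apply/holo_ccont/quo_holo. Qed.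

Lemma sharp_entire (f : C -> C) : entire f -> entire (sharp f).
Proof. by move=> hf z; apply: holo_sharp. Qed.

(** Dividing by [z - w] costs nothing near [w], where [q / e] is bounded by compactness,
    and gains decay away from [w]. The decay turns the bounded term [K] of the
    hypothesis into a multiple of an integrable Cauchy density. *)
Lemma hardy_div (q f : C -> C) (w : C) (K : R) : entire q -> entire f -> 0 <= K ->
  hardy2 (fun z => f z / e z) ->
  (forall z, 0 < Im z -> sqn (fun z => (z - w) * q z / e z) z <= 2 * sqn (fun z => f z / e z) z + K) ->
  hardy2 (fun z => q z / e z).
Proof.
move=> hq hf K0 Hf Hle.
have [M M0 HM] := hardy_lines (fun z hz => quo_ccont hf hz) Hf.
set u := Re w; pose G z := q z / e z.
have cG : on_rect (ccont G) (u - 1) (u + 1) (Num.max 0 (Im w - 1)) (Im w + 1).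
  move=> x y _ /andP[hy _]; apply: quo_ccont => //=.
  by apply: le_trans hy; rewrite le_max lexx.
have [K1 K10 HK1] := rect_bounded cG.
pose K2 := Num.max (2 * K1 ^+ 2) (2 * K).
have K20 : 0 <= K2 by rewrite le_max mulr_ge0 ?sqr_ge0.
have dn x : 0 < 1 + (x - u) ^+ 2 := cauchy_density_gt0 _.
have key z : 0 < Im z -> sqn G z <= 2 * sqn (fun z => f z / e z) z + K2 / (1 + (Re z - u) ^+ 2).
  move=> hz; have s0 := sqn_ge0 (fun z => f z / e z) z.
  have [near|far] := pselect (`|Re z - u| <= 1 /\ `|Im z - Im w| <= 1).
    have [] := near; rewrite !ler_norml => /andP[a1 a2] /andP[b1 b2].
    have : sqn G z <= K1 ^+ 2.
      rewrite /sqn ler_pXn2r ?nnegrE ?nc_ge0 ?(ltW K10) //.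
      have := HK1 (Re z) (Im z); case: z hz s0 near a1 a2 b1 b2 => zr zi /= hz s0 near a1 a2 b1 b2.
      apply; apply/andP; split; try lra.
      by rewrite ge_max (ltW hz); lra.
    have : K1 ^+ 2 <= K2 / (1 + (Re z - u) ^+ 2).
      rewrite ler_pdivlMr //; apply: le_trans (_ : K1 ^+ 2 * 2 <= _).
        apply: ler_wpM2l; rewrite ?sqr_ge0 //.
        have : 0 <= (1 - (Re z - u)) * (1 + (Re z - u)) by apply: mulr_ge0; lra.
        lra.
      by rewrite mulrC le_max lexx.
    lra.
  have far1 : 1 <= nc (z - w) ^+ 2.
    rewrite expr_ge1 ?nc_ge0 // leNgt; apply/negP => h; apply: far.
    have h1 := Re_le (z - w); have h2 := Im_le (z - w); rewrite !ReImE in h1 h2.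
    by split; apply: ltW; [apply: le_lt_trans h1 h|apply: le_lt_trans h2 h].
  have d0 : 0 < nc (z - w) ^+ 2 by lra.
  have hle := Hle z hz.
  have eG : sqn (fun z => (z - w) * q z / e z) z = nc (z - w) ^+ 2 * sqn G z.
    by rewrite /sqn /G -mulrA ncM exprMn.
  rewrite eG in hle.
  have hG : sqn G z <= (2 * sqn (fun z => f z / e z) z + K) / nc (z - w) ^+ 2.
    by rewrite ler_pdivlMr // mulrC.
  apply: le_trans hG _; rewrite mulrDl; apply: lerD.
    by rewrite ler_pdivrMr // ler_peMr // mulr_ge0.
  rewrite ler_pdivrMr // mulrAC ler_pdivlMr //.
  apply: le_trans (_ : K * (2 * nc (z - w) ^+ 2) <= _).
    apply: ler_wpM2l => //.
    have : (Re z - u) ^+ 2 <= nc (z - w) ^+ 2.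
      by rewrite nc_sqr !ReImE lerDl sqr_ge0.
    lra.
  rewrite mulrCA mulrA ler_wpM2r ?sqr_ge0 //.
  by rewrite le_max lexx orbT.
apply: (@hardy_intro _ (2 * M + K2 * (2 * (1 + u ^+ 2) * IR (fun x => (1 + x ^+ 2)^-1)))).
  by move=> z hz; apply: quo_holo => //; exact: ltW.
move=> y y0; have [h1 h2] := HM y (ltW y0).
have i1 := integZ 2 h1; have i2 := integZ (K2 * (2 * (1 + u ^+ 2))) (@integ_cauchy_density R).
have le x : sqn G (x +i* y)%C <= 2 * sqn (fun z => f z / e z) (x +i* y)%C +
    K2 * (2 * (1 + u ^+ 2)) * (1 + x ^+ 2)^-1.
  apply: le_trans (key _ _) _; rewrite //= lerD2l -mulrA ler_wpM2l //; exact: cauchy_density_shift.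
have iG : integ (fun x => sqn G (x +i* y)%C).
  apply: integ_le (integD i1 i2).
    by have [] := @line_measurable R G y (fun x => @quo_ccont q (x +i* y)%C hq (ltW y0)).
  by move=> x; rewrite ger0_norm ?sqn_ge0.
split=> //; apply: le_trans (le_IR iG (integD i1 i2) le) _.
rewrite IRD // !IRZ //; last exact: integ_cauchy_density.
by rewrite [K2 * (_ * IR _)]mulrA lerD2r ler_wpM2l.
Qed.

End WithE.
End HardyLines.

(** * The vanishing line integral *)

Section LineZero.
Variable R : realType.
Local Notation C := R[i].
Local Notation nc := (@Normc.normc R).
Local Notation Re := (@complex.Re R).
Local Notation Im := (@complex.Im R).
Local Notation mu := (@lebesgue_measure R).

(** The parameter [a] is tuned so that a first power is paid for by a small multiple of its
    square; this plays the part of the Cauchy-Schwarz inequality for integrals. *)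
Lemma amgm (a t : R) : 0 < a -> t <= a * t ^+ 2 + a^-1.
Proof.
move=> a0; have ai : 0 < a^-1 by rewrite invr_gt0.
have -> : a * t ^+ 2 + a^-1 = a * (t - a^-1 / 2) ^+ 2 + t + (3 / 4) * a^-1.
  by field; rewrite gt_eqF.
have : 0 <= a * (t - a^-1 / 2) ^+ 2 by rewrite mulr_ge0 ?sqr_ge0 ?ltW.
lra.
Qed.

Section Columns.
Variables (F : C -> C) (M Y : R).
Hypothesis HF : forall z, 0 <= Im z -> ccont F z.
Hypothesis HM : forall y, 0 <= y -> integ (fun x => sqn F (x +i* y)%C) /\
  IR (fun x => sqn F (x +i* y)%C) <= M.
Hypothesis Y0 : 0 < Y.

Lemma column_cts x : cts 0 Y (fun y => sqn F (x +i* y)%C).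
Proof.
move=> y /andP[y0 _].
have h1 := (pcont_cts (pcont_v y x) (@HF (x +i* y)%C y0)).1.
have h2 := (pcont_cts (pcont_v y x) (@HF (x +i* y)%C y0)).2.
rewrite (_ : (fun y => _) = (fun y => Re (F (x +i* y)%C) * Re (F (x +i* y)%C) +
   Im (F (x +i* y)%C) * Im (F (x +i* y)%C))); last first.
  by apply/funext => x'; rewrite /sqn nc_sqr !expr2.
by apply: cvgD; apply: cvgM.
Qed.

(** Integrating first along lines, where the mass is at most [M], bounds the mass of a
    strip; Tonelli exchanges the order. The ordinate is replaced by its absolute value so
    that the integrand is defined and measurable on the whole plane. *)
Lemma column_mass :
  measurable_fun setT (fun x => (Iab 0 Y (fun y => sqn F (x +i* y)%C))%:E) /\
  (\int[mu]_x (Iab 0 Y (fun y => sqn F (x +i* y)%C))%:E <= (M * Y)%:E)%E.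
Proof.
pose H (z : R * R) : \bar R := (sqn F (z.1 +i* `|z.2|)%C * \1_(`[0, Y]%classic) z.2)%:E.
have H0 z : (0 <= H z)%E by rewrite lee_fin mulr_ge0 ?sqn_ge0 // indicE.
have mH : measurable_fun setT H.
  apply/measurable_EFinP; apply: measurable_funM.
    apply: (@separately_measurable R (fun x y => sqn F (x +i* y)%C)).
      by move=> y y0; have [] := @line_measurable R F y (fun x => @HF (x +i* y)%C y0).
    by move=> x; exact: (@column_continuous R F x HF).
  apply: (measurableT_comp _ (@measurable_snd _ _ _ _)).
  exact: measurable_indic.
have colE x : (\int[mu]_y H (x, y))%E = (Iab 0 Y (fun y => sqn F (x +i* y)%C))%:E.
  rewrite /Iab /Rintegral fineK; last first.
    exact: integrable_fin_num (cts_int (@column_cts x)).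
  rewrite [RHS]integral_mkcond; apply: eq_integral => y _.
  rewrite /H /patch /= indicE; case: ifPn => hy; last by rewrite mulr0.
  by rewrite mulr1 ger0_norm //; move: hy; rewrite inE /= in_itv /= => /andP[].
have colF : (fun x => \int[mu]_y H (x, y))%E = (fun x => (Iab 0 Y (fun y => sqn F (x +i* y)%C))%:E).
  exact/funext/colE.
have := @fubini_tonelli _ _ _ _ _ mu mu H mH H0; rewrite colF => tonelli.
split; last first.
  rewrite tonelli; apply: le_trans (_ : (\int[mu]_y (M * \1_(`[0, Y]%classic) y)%:E <= _)%E).
    apply: ge0_le_integral => //.
    - by move=> y _; apply: integral_ge0.
    - exact: (@measurable_fun_fubini_tonelli_G _ _ _ _ _ mu H mH H0).
    - apply/measurable_EFinP; apply: measurable_funM; first exact: measurable_cst.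
      exact: measurable_indic.
    move=> y _; rewrite /H /= indicE; case: (y \in _).
      rewrite mulr1 (_ : (fun x => _) = (fun x => (sqn F (x +i* `|y|)%C)%:E)).
        by have [h1 h2] := HM (normr_ge0 y); rewrite (IR_E h1) lee_fin.
      by apply/funext => x; rewrite mulr1.
    rewrite mulr0 (_ : (fun x => _) = cst 0%E) ?integral0 //.
    by apply/funext => x; rewrite mulr0.
  rewrite (_ : (fun y => _) = (fun y => (M%:E * (\1_(`[0, Y]%classic) y)%:E)%E)) //.
  have M0 : 0 <= M by have [_] := HM (lexx 0); apply: le_trans; apply: IR_ge0 => x; exact: sqn_ge0.
  rewrite ge0_integralZl //.
  - have mY : mu `[0, Y]%classic = Y%:E.
      by rewrite lebesgue_measure_itv /= lte_fin Y0 -EFinD subr0.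
    have mI : measurable (`[0, Y]%classic : set R) by exact: measurable_itv.
    have hi : (\int[mu]_x (\1_(`[0, Y]%classic) x)%:E)%E = Y%:E.
      rewrite -mY -[in RHS](setIT `[0, Y]%classic).
      exact: (@integral_indic _ _ _ mu setT measurableT _ mI).
    apply: (@le_trans _ _ (M%:E * Y%:E)%E); last by rewrite -EFinM.
    by rewrite -hi.
  - apply/measurable_EFinP; exact: measurable_indic.
have := @measurable_fun_fubini_tonelli_F _ _ _ _ _ mu H mH H0.
by rewrite /fubini_F colF.
Qed.

(** By Tonelli the total mass of the columns is finite, so a long interval cannot
    consist of heavy columns only. *)
Lemma good_column (a b d : R) : 0 < d -> (M * Y + 1) / d <= b - a ->
  exists x, a <= x <= b /\ Iab 0 Y (fun y => sqn F (x +i* y)%C) <= d.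
Proof.
move=> d0 hab; apply: contrapT => hN.
have [mf hi] := column_mass.
have M0 : 0 <= M by have [_] := HM (lexx 0); apply: le_trans; apply: IR_ge0 => x; exact: sqn_ge0.
have ab : a < b.
  by rewrite -subr_gt0; apply: lt_le_trans hab; rewrite divr_gt0 // ltr_wpDl // mulr_ge0 // ltW.
have big x : a <= x <= b -> d <= Iab 0 Y (fun y => sqn F (x +i* y)%C).
  by move=> hx; rewrite leNgt; apply/negP => h; apply: hN; exists x; split=> //; exact: ltW.
have pos x : 0 <= Iab 0 Y (fun y => sqn F (x +i* y)%C).
  by apply: fine_ge0; apply: integral_ge0 => y _; rewrite lee_fin sqn_ge0.
have : (\int[mu]_(x in `[a, b]) (cst d%:E) x <= (M * Y)%:E)%E.
  apply: le_trans hi.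
  apply: le_trans (_ : (\int[mu]_(x in `[a, b]) (Iab 0 Y (fun y => sqn F (x +i* y)%C))%:E <= _)%E).
    apply: ge0_le_integral => //.
    - by move=> x _; rewrite /= lee_fin ltW.
    - exact: measurable_funTS.
  by apply: ge0_subset_integral => // x _; rewrite lee_fin.
have mab : mu `[a, b]%classic = (b - a)%:E by rewrite lebesgue_measure_itv /= lte_fin ab -EFinD.
have -> : (\int[mu]_(x in `[a, b]) (cst d%:E) x)%E = (d%:E * (b - a)%:E)%E.
  by rewrite -mab; exact: (@integral_cst _ _ _ mu _ (measurable_itv _)).
rewrite -EFinM lee_fin.
move: hab; rewrite ler_pdivrMr // mulrC; lra.
Qed.

End Columns.

(** The constant is independent of the interval; [arctan (x / Y) / Y] is a primitive. *)
Lemma atan_bound (a b Y : R) : 0 < Y -> a < b ->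
  Iab a b (fun x => (x ^+ 2 + Y ^+ 2)^-1) <= pi / Y.
Proof.
move=> Y0 ab.
pose G (x : R) := Y^-1 * atan (x * Y^-1).
have dG (x : R) : is_derive x 1 G (x ^+ 2 + Y ^+ 2)^-1.
  have d1 : is_derive x 1 (fun x : R => x * Y^-1) Y^-1.
    have := @is_deriveM R _ id (cst Y^-1) x 1 1 0 _ _ => /(_ _ _).
    rewrite scaler0 add0r; rewrite /GRing.scale /= mulr1; exact.
  have d2 : is_derive x 1 (fun x : R => atan (x * Y^-1)) ((1 + (x * Y^-1) ^+ 2)^-1 * Y^-1).
    exact: (@is_derive1_comp R atan (fun x : R => x * Y^-1) x).
  have := @is_deriveZ R _ _ (fun x : R => atan (x * Y^-1)) Y^-1 x 1 _ d2.
  congr is_derive; rewrite /GRing.scale /=.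
  have h : 0 < x ^+ 2 + Y ^+ 2 by rewrite ltr_wpDl ?sqr_ge0 ?exprn_gt0.
  field; rewrite ?gt_eqF //.
have cf (x : R) : {for x, continuous (fun x : R => (x ^+ 2 + Y ^+ 2)^-1)}.
  apply: cvgV; first by rewrite gt_eqF // ltr_wpDl ?sqr_ge0 ?exprn_gt0.
  by apply: cvgD; [exact: exprn_continuous|exact: cvg_cst].
have cG (x : R) : {for x, continuous G}.
  by apply: differentiable_continuous; apply/derivable1_diffP; case: (dG x).
rewrite /Iab /Rintegral (@continuous_FTC2 R _ G) //.
- rewrite -EFinB /= /G -mulrBr mulrC ler_pM2r ?invr_gt0 //.
  have := atan_ltpi2 (b * Y^-1); have := atan_gtNpi2 (a * Y^-1); lra.
- by apply: continuous_in_subspaceT => x _; exact: cf.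
- split.
  + by move=> x _; case: (dG x).
  + exact: cvg_at_right_filter (cG a).
  + exact: cvg_at_left_filter (cG b).
- by move=> x _; rewrite derive1E; case: (dG x).
Qed.

Section Zero.
Variables (G : C -> C) (M : R).
Hypothesis hol : forall z, 0 <= Im z -> holomorphic_at G z.
Hypothesis HM1 : forall y, 0 <= y -> integ (fun x => sqn G (x +i* y)%C) /\
  IR (fun x => sqn G (x +i* y)%C) <= M.
Hypothesis HM2 : forall y, 0 <= y -> integ (fun x => sqn (fun z => z * G z) (x +i* y)%C) /\
  IR (fun x => sqn (fun z => z * G z) (x +i* y)%C) <= M.

Let cG z : 0 <= Im z -> ccont G z.
Proof. by move=> h; apply/holo_ccont/hol. Qed.

Lemma sqn_weight z : sqn (fun z => z * G z) z = nc z ^+ 2 * sqn G z.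
Proof. by rewrite /sqn ncM exprMn. Qed.

Lemma integ_real : integ (fun x => Re (G (x +i* 0)%C)).
Proof.
have h0 : 0 <= 0 :> R by [].
have [h1 _] := HM1 h0; have [h2 _] := HM2 h0.
apply: integ_le (integD (integD h1 h2) (@integ_cauchy_density R)).
  by have [] := @line_measurable R G 0 (fun x => @cG (x +i* 0)%C h0).
move=> x; apply: le_trans (Re_le _) _.
apply: le_trans (@amgm (1 + x ^+ 2) _ (cauchy_density_gt0 x)) _.
rewrite lerD2r sqn_weight nc_sqr /= expr0n addr0 mulrDl mul1r.
by [].
Qed.

(** Shift the segment up to height [Y]: the top side is small because [z G] is square
    integrable, the vertical sides because of the choice of columns. *)
Lemma segment_small (eps : R) (n : nat) : 0 < eps ->
  exists a b, [/\ a <= - n%:R, n%:R <= b & `|Iab a b (fun x => Re (G (x +i* 0)%C))| <= eps].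
Proof.
move=> e0.
have M0 : 0 <= M by have [_] := HM1 (lexx 0); apply: le_trans; apply: IR_ge0 => x; exact: sqn_ge0.
pose eta := eps / (4 * (M + 1)).
have eta0 : 0 < eta by rewrite divr_gt0 // mulr_gt0 // ltr_wpDl.
pose Y := 4 * pi / (eta * eps).
have p0 : 0 < (pi : R) := pi_gt0 R.
have Y0 : 0 < Y by apply: divr_gt0; apply: mulr_gt0.
pose th := eps / (8 * Y); have th0 : 0 < th by apply: divr_gt0 => //; apply: mulr_gt0.
pose d := th * eps / 8; have d0 : 0 < d by apply: divr_gt0 => //; apply: mulr_gt0.
pose T := (M * Y + 1) / d.
have T0 : 0 < T by rewrite divr_gt0 // ltr_wpDl // mulr_ge0 // ltW.
have Tb : T <= n%:R + 1 + T - (n%:R + 1) by rewrite addrAC subrr add0r.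
have Ta : T <= - n%:R - 1 - (- n%:R - 1 - T) by rewrite opprB addrC subrK.
have [b [/andP[b1 b2] hb]] := good_column cG HM1 Y0 d0 Tb.
have [a [/andP[a1 a2] ha]] := good_column cG HM1 Y0 d0 Ta.
have n0 : 0 <= n%:R :> R by [].
have ab : a < b by lra.
exists a, b; split; [lra|lra|].
have cR : on_rect (ccont G) a b 0 Y by move=> x y _ /andP[y0 _]; apply: cG.
have hR : on_rect (holomorphic_at G) a b 0 Y by move=> x y _ /andP[y0 _]; apply: hol.
have := goursat (ltW ab) (ltW Y0) hR; rewrite /rect.
have i0 : (0 : R) <= 0 <= Y by rewrite lexx ltW.
have iY : 0 <= Y <= Y by rewrite lexx ltW.
have ia : a <= a <= b by rewrite lexx ltW.
have ib : a <= b <= b by rewrite lexx ltW.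
rewrite (IabB (cts_h cR iY) (cts_h cR i0)) (IabB (cts_v cR ib) (cts_v cR ia)) => hE.
have col x : a <= x <= b -> Iab 0 Y (fun y => sqn G (x +i* y)%C) <= d ->
    `|Iab 0 Y (fun y => Im (G (x +i* y)%C))| <= eps / 4.
  move=> hx hd; apply: le_trans (Iab_norm (cts_v cR hx)) _.
  have cs := @column_cts G Y cG x.
  have c1 := ctsM (@cts_cst R 0 Y th^-1) cs.
  apply: (@le_trans _ _ (Iab 0 Y (fun y => th^-1 * sqn G (x +i* y)%C + th))).
    apply: le_Iab; [exact: cts_norm (cts_v cR hx)|by apply: ctsD => //; exact: cts_cst|].
    move=> y _; apply: le_trans (Im_le _) _.
    by have := @amgm th^-1 (nc (G (x +i* y)%C)); rewrite invrK invr_gt0; apply.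
  rewrite (IabD c1) ?(IabZ _ cs) ?Iab_cst ?(ltW Y0) //; try exact: cts_cst.
  have : th^-1 * Iab 0 Y (fun y => sqn G (x +i* y)%C) <= th^-1 * d by rewrite ler_pM2l ?invr_gt0.
  have -> : th^-1 * d = eps / 8 by rewrite /d; field; rewrite gt_eqF.
  have : th * (Y - 0) = eps / 8 by rewrite /th; field; rewrite gt_eqF.
  lra.
have top : `|Iab a b (fun x => Re (G (x +i* Y)%C))| <= eps / 2.
  apply: le_trans (Iab_norm (cts_h cR iY)) _.
  have [h2 h3] := HM2 (ltW Y0).
  have cs : cts a b (fun x => sqn (fun z => z * G z) (x +i* Y)%C).
    have [_ _ h] := @line_continuous R (fun z => z * G z) Y (fun x =>
      ccontM (@ccont_id R _) (@cG (x +i* Y)%C (ltW Y0))).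
    by move=> x _; exact: h.
  have ci : cts a b (fun x => (x ^+ 2 + Y ^+ 2)^-1).
    move=> x _; apply: cvgV; first by rewrite gt_eqF // ltr_wpDl ?sqr_ge0 ?exprn_gt0.
    by apply: cvgD; [exact: exprn_continuous|exact: cvg_cst].
  have c1 := ctsM (@cts_cst R a b eta) cs; have c2 := ctsM (@cts_cst R a b eta^-1) ci.
  apply: (@le_trans _ _ (Iab a b (fun x => eta * sqn (fun z => z * G z) (x +i* Y)%C +
      eta^-1 * (x ^+ 2 + Y ^+ 2)^-1))).
    apply: le_Iab; [exact: cts_norm (cts_h cR iY)|exact: ctsD|].
    move=> x _; apply: le_trans (Re_le _) _.
    have q0 : 0 < x ^+ 2 + Y ^+ 2 by rewrite ltr_wpDl ?sqr_ge0 ?exprn_gt0.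
    apply: le_trans (@amgm (eta * (x ^+ 2 + Y ^+ 2)) _ (mulr_gt0 eta0 q0)) _.
    by rewrite sqn_weight nc_sqr /= invfM /sqn -[_ * _ * _ ^+ 2]mulrA.
  rewrite (IabD c1 c2) (IabZ _ cs) (IabZ _ ci).
  have k1 : Iab a b (fun x => sqn (fun z => z * G z) (x +i* Y)%C) <= M.
    by apply: le_trans (Iab_le_IR a b h2 (fun x => sqn_ge0 _ _)) h3.
  have k2 : eta * Iab a b (fun x => sqn (fun z => z * G z) (x +i* Y)%C) <= eta * (M + 1).
    by rewrite ler_pM2l // (le_trans k1) // lerDl.
  have k3 : eta^-1 * Iab a b (fun x => (x ^+ 2 + Y ^+ 2)^-1) <= eta^-1 * (pi / Y).
    by rewrite ler_pM2l ?invr_gt0 // atan_bound.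
  have k4 : eta * (M + 1) = eps / 4 by rewrite /eta; field; lra.
  have k5 : eta^-1 * (pi / Y) = eps / 4.
    rewrite /Y; clear -e0 p0 eta0; move: eta eta0 => eta' h.
    move: (pi : R) p0 => P p0; have [q1 q2 q3] : [/\ eps != 0, P != 0 & eta' != 0] by rewrite !gt_eqF.
    by field; rewrite ?q1 ?q2 ?q3.
  lra.
have hca := col a ia ha; have hcb := col b ib hb.
move: top hca hcb hE; rewrite !ler_norml => /andP[t1 t2] /andP[u1 u2] /andP[v1 v2] hE.
apply/andP; split; lra.
Qed.

(** A function with [G] and [z G] in the Hardy class decays fast enough for the contour of
    integration to be pushed to infinity. *)
Theorem line_integral_zero : IR (fun x => Re (G (x +i* 0)%C)) = 0.
Proof.
pose r x := Re (G (x +i* 0)%C); rewrite -/r.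
have ir : integ r := integ_real.
have /choice [p Hp] : forall n : nat, exists p : R * R,
    [/\ p.1 <= - n%:R, n%:R <= p.2 & `|Iab p.1 p.2 r| <= n.+1%:R^-1].
  move=> n; have n0 : 0 < n.+1%:R^-1 :> R by rewrite invr_gt0.
  by have [a [b [h1 h2 h3]]] := segment_small n n0; exists (a, b).
pose D n : set R := `[(p n).1, (p n).2]%classic.
have mD n : measurable (D n) by exact: measurable_itv.
have mr : measurable_fun setT (EFin \o r) by case/integrableP: ir.
pose f n (x : R) : \bar R := ((EFin \o r) \_ (D n)) x.
have fE n : (\int[mu]_x f n x)%E = (Iab (p n).1 (p n).2 r)%:E.
  by rewrite /f -integral_mkcond /Iab /Rintegral fineK //; exact: integrable_fin_num (integ_itv _ _ ir).
have lim1 : (\int[mu]_x f n x)%E @[n --> \oo] --> (\int[mu]_x (r x)%:E)%E.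
  apply: (@dominated_cvg _ _ _ mu setT measurableT f (EFin \o r) (fun x => `|r x|%:E)).
  - move=> n; apply/(measurable_restrictT _ (mD n)); exact: measurable_funTS.
  - move=> x _; apply: cvg_near_cst.
    have [N HN] : exists N : nat, `|x| <= N%:R.
      by exists (Num.truncn `|x|).+1; apply: ltW; apply: truncnS_gt.
    exists N => // n /= hn; rewrite /f patchE /D; case: ifPn => // /negP h; case: h.
    rewrite inE /= in_itv /=; have [h1 h2 _] := Hp n.
    have hNn : N%:R <= n%:R :> R by rewrite ler_nat.
    by move: HN; rewrite ler_norml => /andP[k1 k2]; apply/andP; split; lra.
  - by [].
  - exact: (integrable_abse ir).
  - move=> n x _; rewrite /f patchE; case: ifPn => _ /=; first by [].
    by rewrite normr0 lee_fin.
have lim2 : (\int[mu]_x f n x)%E @[n --> \oo] --> 0%E.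
  apply/fine_cvgP; split; first by apply: nearW => n; rewrite fE.
  apply/cvgrPdist_lt => eps /inv_succ_small [N HN]; exists N => // n /= hn.
  rewrite sub0r normrN fE /=; have [_ _ h] := Hp n; exact: le_lt_trans h (HN n hn).
have : (\int[mu]_x (r x)%:E)%E = 0%E by apply: (cvg_unique _ lim1 lim2).
by rewrite IR_E // => -[].
Qed.

End Zero.
End LineZero.

(** * The space [B(e)] *)

Section DBSpace.
Variable R : realType.
Local Notation C := R[i].
Local Notation nc := (@Normc.normc R).
Local Notation Re := (@complex.Re R).
Local Notation Im := (@complex.Im R).
Local Notation fn := (C -> C).
Variables (B : fspace R) (e : C -> C) (gamma : R).
Hypotheses (BS : Defs.subspace B) (BI : inner_product B).
Hypotheses (HB : hermite_biehler e) (Hreal : forall x : R, e x%:C%C != 0).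
Hypothesis Be : same_fspace B (dBe e).
Local Notation ip := (inner B).
Local Notation s := (s_ e gamma).

Lemma BE f : B f <-> [/\ entire f, hardy2 (fun z => f z / e z) & hardy2 (fun z => sharp f z / e z)].
Proof. by case: Be => -> _. Qed.

Lemma B_entire f : B f -> entire f. Proof. by case/BE. Qed.

Lemma sharpK (f : fn) : sharp (sharp f) = f.
Proof. by apply/funext => z; rewrite /sharp !conjcK. Qed.

Lemma B_sharp f : B f -> B (sharp f).
Proof. by case/BE => h1 h2 h3; apply/BE; split; [exact: sharp_entire|by []|rewrite sharpK]. Qed.

Lemma conj_cis t : conjc (cis t) = cis (- t) :> C.
Proof. by apply: complex_ext; rewrite /= ?cosN ?sinN. Qed.

Lemma nc_cis t : nc (cis t) = 1.
Proof. by rewrite /= cos2Dsin2 sqrtr1. Qed.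

Lemma conjcI : conjc 'i%C = - 'i%C :> C.
Proof. by apply: complex_ext; rewrite /= ?oppr0. Qed.

Lemma conjc_half_i : conjc ('i%C / 2) = - ('i%C / 2) :> C.
Proof.
rewrite conjc_div conjcI mulNr; congr (- (_ / _)).
by rewrite -[2]/((2 : nat)%:R) rmorph_nat.
Qed.

Lemma s_sharp : sharp s = s.
Proof.
apply/funext => z; rewrite /sharp /s_ conjcM conjc_half_i conjcB (conjcM (cis gamma)) (conjcM (cis (- gamma))) !conj_cis opprK.
by rewrite /sharp !conjcK; ring.
Qed.

Lemma s_entire : entire s.
Proof.
have he := @e_holo _ _ HB; have hs := sharp_entire he => z.
have h1 := holoM (@holo_cst R (cis gamma) z) (he z).
have h2 := holoM (@holo_cst R (cis (- gamma)) z) (hs z).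
exact: (holoM (@holo_cst R ('i%C / 2) z) (holoB h1 h2)).
Qed.

Lemma nc_half_i : nc ('i%C / 2) = 2^-1.
Proof.
rewrite nc_div; have -> : nc 'i%C = 1 by rewrite /= expr0n expr1n add0r sqrtr1.
have -> : nc 2 = 2 by rewrite (_ : 2 = (2 : R)%:C%C) ?nc_real ?normr_nat // rmorph_nat.
by rewrite div1r.
Qed.

Lemma s_le z : 0 <= Im z -> nc (s z) <= nc (e z).
Proof.
move=> hz; have hs : nc (sharp e z) <= nc (e z).
  rewrite /sharp nc_conj; move: hz; rewrite le_eqVlt => /predU1P[h|h].
    by have -> : conjc z = z by apply: complex_ext; rewrite ?ReImE // -h oppr0.
  by apply: ltW; have := HB.2 z h; rewrite !normE ltcR.
rewrite /s_ ncM nc_half_i.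
have : nc (cis gamma * e z - cis (- gamma) * sharp e z) <= nc (e z) + nc (sharp e z).
  by apply: le_trans (ncB _ _) _; rewrite !ncM !nc_cis !mul1r.
lra.
Qed.

Lemma s_ne0 z : Im z != 0 -> s z != 0.
Proof.
wlog hz : z / 0 < Im z => [H h|_].
  have [h1|h1] := ltP 0 (Im z); first exact: H.
  rewrite -s_sharp /sharp conjc_eq0; apply: H; rewrite Im_conj ?oppr_eq0 //.
  by rewrite oppr_gt0 lt_neqAle h h1.
rewrite /s_ mulf_neq0 //; first by rewrite -nc_gt0 nc_half_i invr_gt0.
rewrite subr_eq0; apply/eqP => /(congr1 nc); rewrite !ncM !nc_cis !mul1r => E.
by have := HB.2 z hz; rewrite !normE ltcR E /sharp nc_conj ltxx.
Qed.

(** Although [s] is not in [B], the quotient [s / e] is bounded on the upper half-plane,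
    and dividing by [z - w] makes it square integrable. This provides both the division
    property of [B] (with [c = 0]) and the resolvents of the extensions. *)
Lemma B_div f (c w : C) : B f -> f w = c * s w ->
  exists2 q, B q & forall z, (z - w) * q z = f z - c * s z.
Proof.
move=> hf hw; have [f1 f2 f3] := (BE f).1 hf.
have hh : entire (fun z => f z - c * s z).
  move=> z; have k1 : holomorphic_at f z := f1 z.
  have k0 : holomorphic_at s z by exact: s_entire.
  have k2 := holoM (@holo_cst R c z) k0.
  exact: (holoB k1 k2).
have [q [q1 q2]] := quot_entire w hh.
have q3 z : (z - w) * q z = f z - c * s z by rewrite q2 hw subrr subr0.
exists q => //; apply/BE.
have div (v a : C) (p g : fn) : entire p -> entire g -> hardy2 (fun z => g z / e z) ->
    (forall z, (z - v) * p z = g z - a * s z) -> hardy2 (fun z => p z / e z).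
  move=> hp hg Hg E; apply: (@hardy_div _ e HB Hreal p g v (2 * nc a ^+ 2)) => //.
    by rewrite mulr_ge0 ?sqr_ge0.
  move=> z hz; rewrite {1}/sqn E mulrBl -mulrA.
  have hs : nc (a * (s z / e z)) <= nc a.
    rewrite ncM -[leRHS]mulr1 ler_wpM2l ?nc_ge0 // nc_div ler_pdivrMr ?mul1r ?s_le ?(ltW hz) //.
    by rewrite nc_gt0 (e_ne0 HB Hreal (ltW hz)).
  have h1 := ncB (g z / e z) (a * (s z / e z)).
  apply: (@le_trans _ _ ((nc (g z / e z) + nc a) ^+ 2)).
    by rewrite ler_pXn2r ?nnegrE ?addr_ge0 ?nc_ge0 // (le_trans h1) // lerD2l.
  have := sqr_ge0 (nc (g z / e z) - nc a); rewrite /sqn; lra.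
split=> //; first exact: (div w c q f).
have sq := sharp_entire q1; have sf := sharp_entire f1.
apply: (div (conjc w) (conjc c) (sharp q) (sharp f) sq sf f3) => z.
have := congr1 conjc (q3 (conjc z)); rewrite conjcM !conjcB conjcK conjcM.
by rewrite -[in X in _ -> X]s_sharp.
Qed.

Definition over_e (f : fn) (x : R) : C := f x%:C%C / e x%:C%C.

Lemma over_e_integ f : B f -> integ (fun x => nc (over_e f x) ^+ 2).
Proof.
case/BE => f1 f2 f3.
have [M M0 HM] := hardy_lines (fun z hz => quo_ccont HB Hreal f1 hz) f2.
by have [] := HM 0 (lexx 0).
Qed.

Lemma over_e_cont f : entire f -> continuous (fun x => Re (over_e f x)) /\ continuous (fun x => Im (over_e f x)).
Proof.
move=> hf; have [] := @line_continuous R (fun z => f z / e z) 0 (fun x =>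
  @quo_ccont R e HB Hreal f (x +i* 0)%C hf (lexx 0)).
by [].
Qed.

Lemma prod_integ f g : B f -> B g ->
  integ (fun x => Re (conjc (over_e f x) * over_e g x)) /\ integ (fun x => Im (conjc (over_e f x) * over_e g x)).
Proof.
move=> hf hg; have [f1 f2] := over_e_cont (B_entire hf); have [g1 g2] := over_e_cont (B_entire hg).
have bd x : nc (conjc (over_e f x) * over_e g x) <= nc (over_e f x) ^+ 2 + nc (over_e g x) ^+ 2.
  rewrite ncM nc_conj; have := sqr_ge0 (nc (over_e f x) - nc (over_e g x)).
  have := mulr_ge0 (nc_ge0 (over_e f x)) (nc_ge0 (over_e g x)); lra.
have hi := integD (over_e_integ hf) (over_e_integ hg).
split; apply: integ_le hi.
- rewrite (_ : (fun x => _) = (fun x => Re (over_e f x) * Re (over_e g x) + Im (over_e f x) * Im (over_e g x))).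
    apply: continuous_measurable_fun => x.
    by apply: cvgD; apply: cvgM; [exact: f1|exact: g1|exact: f2|exact: g2].
  by apply/funext => x; rewrite !ReImE; ring.
- by move=> x; apply: le_trans (Re_le _) (bd x).
- rewrite (_ : (fun x => _) = (fun x => Re (over_e f x) * Im (over_e g x) - Im (over_e f x) * Re (over_e g x))).
    apply: continuous_measurable_fun => x.
    by apply: cvgB; apply: cvgM; [exact: f1|exact: g2|exact: f2|exact: g1].
  by apply/funext => x; rewrite !ReImE; ring.
- by move=> x; apply: le_trans (Im_le _) (bd x).
Qed.

Lemma ipE f g : B f -> B g -> ip f g =
  (IR (fun x => Re (conjc (over_e f x) * over_e g x)) +i* IR (fun x => Im (conjc (over_e f x) * over_e g x)))%C.
Proof.
move=> hf hg; case: Be => _ ->; [|exact: hf|exact: hg].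
have E x : conjc (f x%:C%C) * g x%:C%C / `|e x%:C%C| ^+ 2 = conjc (over_e f x) * over_e g x.
  have h := Hreal x.
  have -> : `|e x%:C%C| ^+ 2 = conjc (e x%:C%C) * e x%:C%C by rewrite mulc_conj normE rmorphXn.
  rewrite /over_e conjc_div; field.
  by rewrite h conjc_eq0 h.
by apply: complex_ext; rewrite /= /IR; congr Rintegral; apply/funext => x; rewrite E.
Qed.

Lemma ip_sharp f g : B f -> B g -> ip (sharp f) (sharp g) = ip g f.
Proof.
move=> hf hg; rewrite !ipE //; try exact: B_sharp.
have E x : conjc (over_e (sharp f) x) * over_e (sharp g) x = conjc (over_e g x) * over_e f x.
  have h := Hreal x.
  rewrite /over_e /sharp !conjcr !conjc_div conjcK; field.
  by rewrite h conjc_eq0 h.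
by apply: complex_ext; rewrite /= /IR; congr Rintegral; apply/funext => x; rewrite E.
Qed.

Lemma over_e_zero g : B g -> B (fun z => z * g z) ->
  integ (fun x => Re (over_e g x)) /\ IR (fun x => Re (over_e g x)) = 0.
Proof.
move=> /BE [g1 g2 g3] /BE [z1 z2 z3].
have [M1 M10 HM1] := hardy_lines (fun z hz => quo_ccont HB Hreal g1 hz) g2.
have [M2 M20 HM2] := hardy_lines (fun z hz => quo_ccont HB Hreal z1 hz) z2.
have hol z (hz : 0 <= Im z) := quo_holo HB Hreal g1 hz.
have H1 y : 0 <= y -> integ (fun x => sqn (fun z => g z / e z) (x +i* y)%C) /\
    IR (fun x => sqn (fun z => g z / e z) (x +i* y)%C) <= M1 + M2.
  by move=> /HM1 [a b]; split=> //; apply: le_trans b _; rewrite lerDl.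
have H2 y : 0 <= y -> integ (fun x => sqn (fun z => z * (g z / e z)) (x +i* y)%C) /\
    IR (fun x => sqn (fun z => z * (g z / e z)) (x +i* y)%C) <= M1 + M2.
  rewrite (_ : (fun z => z * (g z / e z)) = (fun z => z * g z / e z)); last first.
    by apply/funext => z; rewrite mulrA.
  by move=> /HM2 [a b]; split=> //; apply: le_trans b _; rewrite lerDr.
by split; [exact: (integ_real hol H1 H2)|exact: (line_integral_zero hol H1 H2)].
Qed.

(** Since [z] is real on the line of integration, the two sides differ by the integral of
    [c s] times the conjugate of [g1], divided by [|e|^2]. On the real line [s / |e|^2]
    is a combination of [1 / e] and of its conjugate, so that this integral is made of
    those of [g1 / e] and [g1^# / e], which vanish by [over_e_zero]. *)
Lemma mult_defect g1 g2 (c : C) : B g1 -> B (fun z => z * g1 z) -> B g2 ->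
  B (fun z => z * g2 z + c * s z) ->
  ip (fun z => z * g1 z) g2 = ip g1 (fun z => z * g2 z + c * s z).
Proof.
move=> h1 hz1 h2 hu.
pose zg1 := (fun z => z * g1 z) : fn; pose u := (fun z => z * g2 z + c * s z) : fn.
have [a1 a2] := prod_integ hz1 h2; have [b1 b2] := prod_integ h1 hu.
pose T x := conjc (over_e g1 x) * (c * over_e s x).
have ET x : conjc (over_e g1 x) * over_e u x = conjc (over_e zg1 x) * over_e g2 x + T x.
  have h := Hreal x.
  rewrite /over_e /u /zg1 /T /over_e !conjc_div conjcM conjcr; field.
  by rewrite h conjc_eq0 h.
(* The real and the imaginary part of the defect term both have this form, with
   [d = c] and [d = - i c]. *)
have half d : integ (fun x => Re (conjc (over_e g1 x) * (d * over_e s x))) /\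
    IR (fun x => Re (conjc (over_e g1 x) * (d * over_e s x))) = 0.
  pose be1 := d * ('i%C / 2) * cis gamma; pose be2 := - (d * ('i%C / 2) * cis (- gamma)).
  pose p1 := (conjc be1 \*o g1) : fn; pose p2 := (be2 \*o sharp g1) : fn.
  have zs : (fun z => z * sharp g1 z) = sharp zg1.
    by apply/funext => z; rewrite /zg1 /sharp conjcM conjcK.
  have [i1 e1] : integ (fun x => Re (over_e p1 x)) /\ IR (fun x => Re (over_e p1 x)) = 0.
    apply: over_e_zero; first exact: vsZ.
    rewrite (_ : (fun z => _) = conjc be1 \*o zg1); first exact: vsZ.
    by apply/funext => z; rewrite /p1 /zg1 /=; ring.
  have [i2 e2] : integ (fun x => Re (over_e p2 x)) /\ IR (fun x => Re (over_e p2 x)) = 0.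
    apply: over_e_zero; first by apply: vsZ => //; exact: B_sharp.
    rewrite (_ : (fun z => _) = be2 \*o sharp zg1); first by apply: vsZ => //; exact: B_sharp.
    by rewrite -zs; apply/funext => z; rewrite /p2 /=; ring.
  have E : (fun x => Re (conjc (over_e g1 x) * (d * over_e s x))) = (fun x => Re (over_e p1 x) + Re (over_e p2 x)).
    apply/funext => x; rewrite -(Re_conj (over_e p1 x)) -ReD; congr (Re _).
    have h := Hreal x.
    have h' : conjc (e x%:C%C) != 0 by rewrite conjc_eq0.
    have p1E : over_e p1 x = conjc be1 * over_e g1 x by rewrite /over_e mulrA.
    have p2E : over_e p2 x = be2 * (conjc (g1 x%:C%C) / e x%:C%C).
      by rewrite /over_e mulrA /p2 /sharp /= oppr0.
    have sE : over_e s x = 'i%C / 2 * (cis gamma - cis (- gamma) * (conjc (e x%:C%C) / e x%:C%C)).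
      by rewrite /over_e /s_ /sharp conjcr; field.
    rewrite p1E p2E sE (conjcM (conjc be1)) (conjcK be1) /over_e conjc_div /be1 /be2.
    move: (cis gamma) (cis (- gamma)) => c1 c2.
    by field; rewrite h h'.
  by rewrite E IRD // e1 e2 addr0; split=> //; exact: integD.
have [iRe zRe] := half c; have [iIm zIm] := half (- 'i%C * c).
have EIm : (fun x => Im (T x)) = (fun x => Re (conjc (over_e g1 x) * (- 'i%C * c * over_e s x))).
  apply/funext => x; rewrite /T.
  have -> : conjc (over_e g1 x) * (- 'i%C * c * over_e s x) = - 'i%C * (conjc (over_e g1 x) * (c * over_e s x)) by ring.
  by rewrite [RHS]ReM /= oppr0 mul0r sub0r mulN1r opprK.
rewrite !ipE //; apply: complex_ext => /=.
  rewrite (_ : (fun x => Re (conjc (over_e g1 x) * over_e u x)) =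
     (fun x => Re (conjc (over_e zg1 x) * over_e g2 x) + Re (T x))); last first.
    by apply/funext => x; rewrite ET ReD.
  by rewrite IRD // zRe addr0.
rewrite (_ : (fun x => Im (conjc (over_e g1 x) * over_e u x)) =
   (fun x => Im (conjc (over_e zg1 x) * over_e g2 x) + Im (T x))); last first.
  by apply/funext => x; rewrite ET ImD.
by rewrite IRD ?EIm // zIm addr0.
Qed.

End DBSpace.

(** * The selfadjoint extension and its relation to the adjoint *)

Section Extension.
Variable R : realType.
Local Notation C := R[i].
Local Notation nc := (@Normc.normc R).
Local Notation Re := (@complex.Re R).
Local Notation Im := (@complex.Im R).
Local Notation fn := (C -> C).
Variables (B : fspace R) (e : C -> C) (k : C -> C -> C) (w : C) (gamma : R).
Hypotheses (BS : Defs.subspace B) (BI : inner_product B) (BC : complete_space B).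
Hypothesis Bnz : nonzero_space B.
Hypotheses (HB : hermite_biehler e) (Hreal : forall x : R, e x%:C%C != 0).
Hypothesis Be : same_fspace B (dBe e).
Hypothesis kB : reproducing_kernel B k.
Hypothesis Sdense : densely_defined B (mult B).
Hypothesis wim : Im w != 0.
Local Notation ip := (inner B).
Local Notation nb := (ipnorm (inner B)).
Local Notation s := (s_ e gamma).
Local Notation S := (mult B).
Local Notation A := (S_ B e w gamma).
Local Notation Sa := (adjoint B (mult B)).

Let sw : s w != 0 := s_ne0 gamma HB wim.

Lemma multB f : dom S f -> B f /\ B (S f). Proof. by []. Qed.

(** Moving by a small imaginary amount suffices at a real point. *)
Lemma nonreal_near (h : fn) z0 : ccont h z0 -> h z0 != 0 -> exists2 v, Im v != 0 & h v != 0.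
Proof.
move=> hc h0; have [z0r|z0i] := eqVneq (Im z0) 0; last by exists z0.
have p0 : 0 < nc (h z0) by rewrite nc_gt0.
have [d d0 Hd] := hc _ p0.
exists (z0 + (0 +i* (d / 2))%C); first by rewrite ImD /= z0r add0r gt_eqF // divr_gt0.
apply/eqP => e0; have := Hd (z0 + (0 +i* (d / 2))%C).
rewrite e0 sub0r ncN ltxx addrAC subrr add0r.
have -> : (0 +i* (d / 2))%C = 'i%C * (d / 2)%:C%C by apply: complex_ext; rewrite !ReImE /=; ring.
have -> : nc ('i%C * (d / 2)%:C%C) = d / 2.
  rewrite ncM nc_real gtr0_norm ?divr_gt0 //.
  by rewrite (_ : nc 'i%C = 1) ?mul1r //= expr0n expr1n add0r sqrtr1.
have hd : d / 2 < d by lra.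
by move=> /(_ hd).
Qed.

Lemma entire_ext_off (f g : fn) v : entire f -> entire g -> (forall z, z != v -> f z = g z) -> f = g.
Proof.
move=> hf hg E; apply/funext => z; have [->|zv] := eqVneq z v; last exact: E.
apply/eqP; rewrite -subr_eq0; apply/negPn/negP => n0.
have p0 : 0 < nc (f v - g v) by rewrite nc_gt0.
have [d d0 Hd] := ccontB (holo_ccont (hf v)) (holo_ccont (hg v)) p0.
have d2 : 0 < d / 2 by rewrite divr_gt0.
have hv : v + (d / 2)%:C%C != v.
  by rewrite -subr_eq0 addrAC subrr add0r -nc_eq0 nc_real normr_eq0 gt_eqF.
have := Hd (v + (d / 2)%:C%C); rewrite (E _ hv) subrr sub0r ncN ltxx.
rewrite addrAC subrr add0r nc_real gtr0_norm //.
have hd : d / 2 < d by lra.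
by move=> /(_ hd).
Qed.

(** If [s] belonged to [B], it would be orthogonal to the dense domain of multiplication. *)
Lemma s_notin : ~ B s.
Proof.
move=> hs; have h0 := vs0 BS.
have : s = cst 0.
  apply: (orth_dense BS BI Sdense multB hs) => g [hg hzg].
  have E : (fun z => z * (cst 0 : fn) z + 1 * s z) = s by apply/funext => z; rewrite /= mulr0 add0r mul1r.
  have := @mult_defect R B e gamma BS HB Hreal Be g (cst 0) 1 hg hzg h0.
  rewrite E => /(_ hs); rewrite (ip0r BS BI hzg) => e0.
  by rewrite (ipC BI hg hs) -e0 conjc0.
by move=> /(congr1 (fun u : fn => u w)) /eqP; rewrite (negbTE sw).
Qed.

Lemma defect_unique g (c c' : C) : B (fun z => z * g z + c * s z) ->
  B (fun z => z * g z + c' * s z) -> c = c'.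
Proof.
move=> h h'; apply/eqP; rewrite -subr_eq0; apply/negPn/negP => n0; apply: s_notin.
have := vsZ BS (c - c')^-1 (vsB BS h h').
rewrite (_ : _ \*o _ = s) //; apply/funext => z /=.
by rewrite opprD addrACA subrr add0r -mulrBl mulrA mulVf // mul1r.
Qed.

(** The extension is multiplication up to a multiple of [s], and since [s] is not in [B]
    that multiple is determined by the function. *)
Lemma ext_dom g u : (exists2 f, B f & [/\ entire g,
    forall z, (z - w) * g z = f z - s z / s w * f w
    & u = fun z => z * g z + f w * (s z / s w)]) ->
  B g /\ exists2 c, u = (fun z => z * g z + c * s z) & B u.
Proof.
move=> [f hf [eg E ->]].
have hw : f w = (f w / s w) * s w by rewrite divfK.
have [q hq q2] := B_div HB Hreal Be hf hw.
have -> : g = q.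
  apply: (@entire_ext_off _ _ w eg (B_entire Be hq)) => z zw.
  have zw0 : z - w != 0 by rewrite subr_eq0.
  by apply: (mulfI zw0); rewrite E q2; field.
split=> //; exists (f w / s w); first by apply/funext => z; field.
have -> : (fun z => z * q z + f w * (s z / s w)) = (w \*o q) \+ f; last exact: vsL.
apply/funext => z /=; have := q2 z; have -> : f w * (s z / s w) = f w / s w * s z by field.
rewrite mulrBl => /eqP; rewrite subr_eq => /eqP ->; ring.
Qed.

Lemma extP g (c : C) : B g -> B (fun z => z * g z + c * s z) ->
  dom A g /\ A g = (fun z => z * g z + c * s z).
Proof.
move=> hg hu; set u := (fun z => z * g z + c * s z).
have ex : exists u, exists2 f, B f & [/\ entire g,
    forall z, (z - w) * g z = f z - s z / s w * f w
    & u = fun z => z * g z + f w * (s z / s w)].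
  exists u, (u \- (w \*o g)); first by apply: vsB => //; exact: vsZ.
  split; first exact: (B_entire Be hg).
    by move=> z; rewrite /u /=; field.
  by apply/funext => z; rewrite /u /=; field.
split; first exact: ex.
have := xgetPex (cst 0) ex; move=> /ext_dom [_ [c' E hB]].
rewrite E in hB; rewrite /= E.
by rewrite -(defect_unique hu hB).
Qed.

Lemma extE g : dom A g -> exists c, [/\ B g, B (A g) & A g = (fun z => z * g z + c * s z)].
Proof.
move=> [u /ext_dom [hg [c E hu]]]; exists c; rewrite E in hu.
by have [_ ->] := extP hg hu.
Qed.

Lemma extB g : dom A g -> B g /\ B (A g).
Proof. by move=> /extE [c []]. Qed.

Lemma ext_lin a g h : dom A g -> dom A h ->
  dom A ((a \*o g) \+ h) /\ A ((a \*o g) \+ h) = (a \*o A g) \+ A h.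
Proof.
move=> /extE [c [g1 g2 gE]] /extE [d [h1 h2 hE]].
have E : (a \*o A g) \+ A h = (fun z => z * ((a \*o g) \+ h) z + (a * c + d) * s z).
  by rewrite gE hE; apply/funext => z /=; ring.
rewrite E; apply: extP; first exact: vsL.
by rewrite -E; apply: vsL.
Qed.

Lemma ext_subspace : Defs.subspace (dom A).
Proof.
split; last by move=> a f g hf hg; case: (ext_lin a hf hg).
have h0 := vs0 BS; apply: (proj1 (@extP (cst 0) 0 h0 _)).
rewrite (_ : (fun z => _) = cst 0) //.
by apply/funext => z /=; rewrite mulr0 mul0r addr0.
Qed.

Lemma mult_ext f : dom S f -> dom A f /\ A f = S f.
Proof.
move=> [f1 f2]; have E : (fun z => z * f z) = (fun z => z * f z + 0 * s z).
  by apply/funext => z; rewrite mul0r addr0.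
by have := @extP f 0 f1; rewrite -E => /(_ f2).
Qed.

Lemma ext_adjoint g : dom A g -> dom Sa g /\ Sa g = A g.
Proof.
move=> /extE [c [g1 g2 gE]]; apply: (adjointP BS BI Sdense multB) => // f [f1 f2].
rewrite gE in g2 *; rewrite (ipC BI f1 g2).
rewrite -(mult_defect BS HB Hreal Be f1 f2 g1 g2) -(ipC BI) //.
Qed.

Lemma ext_sharp h : dom A h -> dom A (sharp h) /\ A (sharp h) = sharp (A h).
Proof.
move=> /extE [c [h1 h2 hE]].
have E : sharp (A h) = (fun z => z * sharp h z + conjc c * s z).
  rewrite hE; apply/funext => z; rewrite -[in RHS](s_sharp e gamma) /sharp.
  by rewrite conjcD !conjcM conjcK.
rewrite E; apply: extP; first exact: (B_sharp Be).
by rewrite -E; exact: (B_sharp Be).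
Qed.

Let Om g h := ip g (A h) - ip (A g) h.

Lemma OmC g h : dom A g -> dom A h -> Om h g = - conjc (Om g h).
Proof.
move=> /extB [g1 g2] /extB [h1 h2]; rewrite /Om conjcB -!(ipC BI) //; ring.
Qed.

Lemma OmL a g g' h : dom A g -> dom A g' -> dom A h ->
  Om ((a \*o g) \+ g') h = conjc a * Om g h + Om g' h.
Proof.
move=> dg dg' dh; have [g1 g2] := extB dg; have [k1 k2] := extB dg'; have [h1 h2] := extB dh.
rewrite /Om (ext_lin a dg dg').2 !(ipLl BS BI) //; ring.
Qed.

Lemma Om_mult g h : dom S g -> dom A h -> Om g h = 0.
Proof.
move=> dg dh; have [dA Ag] := mult_ext dg; have [h1 h2] := extB dh; have [g1 g2] := dg.
have [da ha] := ext_adjoint dh; have [_ _ E] := adjointE BS BI Sdense multB da.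
rewrite /Om Ag (ipC BI h2 g1) (ipC BI h1 g2) -ha.
by rewrite (E _ dg) subrr.
Qed.

(** Modulo the domain of multiplication, which does not contribute to the defect of
    symmetry [Om], all elements are multiples of a single [h], so it suffices that
    [Om h h] vanishes. Conjugation by [sharp] changes its sign, while [sharp h] is a
    unimodular multiple of [h]. *)
Lemma ext_sym g h : dom A g -> dom A h -> ip g (A h) = ip (A g) h.
Proof.
have red f g' c c' : dom A f -> dom A g' -> A f = (fun z => z * f z + c * s z) ->
    A g' = (fun z => z * g' z + c' * s z) -> c' != 0 ->
    exists2 m, dom S m & f = ((c / c') \*o g') \+ m.
  move=> df dg' Ef Eg c0; exists (f \- ((c / c') \*o g')); last by apply/funext => z /=; ring.
  have [f1 f2] := extB df; have [k1 k2] := extB dg'.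
  split; first by apply: vsB => //; exact: vsZ.
  rewrite (_ : (fun z => _) = A f \- ((c / c') \*o A g')); first by apply: vsB => //; exact: vsZ.
  by rewrite Ef Eg; apply/funext => z /=; field.
move=> dg dh; apply/eqP; rewrite -subr_eq0 -/(Om g h).
have [cg [g1 g2 gE]] := extE dg; have [c [h1 h2 hE]] := extE dh.
have [c0|c0] := eqVneq c 0.
  have dS : dom S h.
    by split=> //; move: h2; rewrite hE c0; congr (B _); apply/funext => z; rewrite mul0r addr0.
  by rewrite OmC // -[X in - X]conjcK; rewrite (Om_mult dS dg) ?conjc0 ?oppr0.
have [m dm ->] := red _ _ _ _ dg dh gE hE c0.
rewrite OmL //; last by case: (mult_ext dm).
rewrite (Om_mult dm dh) addr0 mulf_eq0; apply/orP; right.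
have [dsh shE] := ext_sharp dh.
have sE : A (sharp h) = (fun z => z * sharp h z + conjc c * s z).
  rewrite shE hE; apply/funext => z; rewrite -[in RHS](s_sharp e gamma) /sharp.
  by rewrite conjcD !conjcM conjcK.
have anti : Om (sharp h) (sharp h) = - Om h h.
  rewrite /Om shE !(ip_sharp Hreal Be) //; ring.
have [m' dm' E] := red _ _ _ _ dsh dh sE hE c0.
have dA' := (mult_ext dm').1.
have dbh : dom A ((conjc c / c) \*o h) by apply: vsZ => //; exact: ext_subspace.
have : Om (sharp h) (sharp h) = Om h h.
  rewrite {1}E OmL // (Om_mult dm' dsh) addr0 OmC // E OmL // (Om_mult dm' dh) addr0.
  rewrite [X in - X](conjcM _ (Om h h)) conjcK mulrN mulrA.
  have -> : conjc (conjc c / c) * (conjc c / c) = 1.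
    by rewrite conjc_div conjcK; field; rewrite c0 conjc_eq0.
  by rewrite mul1r -OmC.
rewrite anti => /eqP; rewrite eq_sym -subr_eq0 opprK -mulr2n mulrn_eq0 /=.
by [].
Qed.

Lemma ext_resolvent f v : B f -> Im v != 0 -> exists2 h, dom A h & A h = f \+ (v \*o h).
Proof.
move=> hf vi; have sv := s_ne0 gamma HB vi.
have hv : f v = (f v / s v) * s v by rewrite divfK.
have [q hq q2] := B_div HB Hreal Be hf hv.
have E : f \+ (v \*o q) = (fun z => z * q z + (f v / s v) * s z).
  by apply/funext => z /=; move: (q2 z); rewrite mulrBl => /eqP; rewrite subr_eq => /eqP ->; ring.
have [] := @extP q (f v / s v) hq; first by rewrite -E; apply: vsD => //; exact: vsZ.
by move=> h1 h2; exists q; rewrite // h2 E.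
Qed.

(** A symmetric operator for which [A - v] is onto at [v = w] and at its conjugate is
    selfadjoint: subtracting a solution at [w] leaves a vector orthogonal to the range at
    the conjugate point. *)
Lemma ext_max f g : B f -> B g -> (forall h, dom A h -> ip f (A h) = ip g h) ->
  dom A f /\ A f = g.
Proof.
move=> hf hg E.
have hgf : B (g \- (w \*o f)) by apply: vsB => //; exact: vsZ.
have [h0 dh0 Ah0] := ext_resolvent hgf wim.
have [h1 h2] := extB dh0.
have hd : B (f \- h0) by exact: vsB.
have key h : dom A h -> ip (f \- h0) (A h) = conjc w * ip (f \- h0) h.
  move=> dh; have [k1 k2] := extB dh.
  rewrite !(ipBl BS BI) // E // (ext_sym dh0 dh) Ah0 (ipDl BS BI) //; last exact: vsZ.
  rewrite (ipBl BS BI) //; last exact: vsZ.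
  by rewrite !(ipZl BS BI) //; ring.
have wi' : Im (conjc w) != 0 by rewrite Im_conj oppr_eq0.
have [h dh Ah] := ext_resolvent hd wi'.
have [k1 k2] := extB dh.
have := key h dh; rewrite Ah (ipDr BI) //; last exact: vsZ.
rewrite (ipZr BS BI) // => /eqP; rewrite -subr_eq0 addrK => /eqP /(ip_eq0 BI hd) d0.
have fh : f = h0.
  by apply/funext => z; have := congr1 (fun u : fn => u z) d0; rewrite /= => /eqP; rewrite subr_eq0 => /eqP.
rewrite fh in Ah0 *; split=> //; rewrite Ah0.
by apply/funext => z /=; ring.
Qed.

(** If all of [B] vanished at [w0], the quotients provided by [B_div] at another non-real
    point [v] would vanish there too, which forces [B] to vanish at [v]; but the
    non-real points determine an entire function. *)
Lemma nonvanish w0 : Im w0 != 0 -> exists2 f, B f & f w0 != 0.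
Proof.
move=> w0i; apply: contrapT => hN.
have van f : B f -> f w0 = 0.
  by move=> hf; apply/eqP/negPn/negP => h; apply: hN; exists f.
have van' f v : B f -> Im v != 0 -> f v = 0.
  move=> hf vi; have sv := s_ne0 gamma HB vi; have sw0 := s_ne0 gamma HB w0i.
  have hv : f v = (f v / s v) * s v by rewrite divfK.
  have [q hq q2] := B_div HB Hreal Be hf hv.
  have hu : B (f \+ ((v - w0) \*o q)) by apply: vsD => //; exact: vsZ.
  have := van _ hu; rewrite /=.
  have -> : f w0 + (v - w0) * q w0 = f v / s v * s w0.
    by rewrite -[v - w0]opprB mulNr q2 opprB addrC subrK.
  by move=> /eqP; rewrite (mulf_eq0 _ (s w0)) (mulf_eq0 _ (s v)^-1) invr_eq0 (negbTE sw0) (negbTE sv) !orbF => /eqP.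
have [f hf f0] := Bnz; apply: f0; apply/funext => z; apply/eqP/negPn/negP => h.
have fz : holomorphic_at f z by exact: (B_entire Be hf).
have [v vi] := nonreal_near (holo_ccont fz) h.
by rewrite (van' f v hf vi) eqxx.
Qed.

(** * Associated functions *)

Lemma assoc_zB (a b : fn) : B a -> B b -> assoc B (fun z => z * a z + b z).
Proof.
move=> ha hb; split.
  move=> z; have ea : holomorphic_at a z by exact: (B_entire Be ha).
  have eb : holomorphic_at b z by exact: (B_entire Be hb).
  have h1 := holoM (@holo_id R z) ea.
  have h2 := holoD h1 eb.
  exact: h2.
move=> f v hf _.
pose F := (v \*o ((a v \*o f) \- (f v \*o a))) \+ ((b v \*o f) \- (f v \*o b)).
have hF : B F by apply: vsL => //; apply: vsB => //; apply: vsZ.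
have Fv : F v = 0 * s v by rewrite /F /=; ring.
have [q hq q2] := B_div HB Hreal Be hF Fv.
exists (q \- (f v \*o a)); first by apply: vsB => //; exact: vsZ.
move=> z; rewrite /= mulrBr q2 /F /=; ring.
Qed.

(** At a point [v] where neither [h] nor some [f] of [B] vanishes, the quotient [g] in the
    definition of [assoc] gives [f(v) h = h(v) f - (z - v) g]. *)
Lemma assoc_decomp h : assoc B h -> exists a b, [/\ B a, B b & h = (fun z => z * a z + b z)].
Proof.
move=> [eh H]; have [h0|h0] := pselect (h = cst 0).
  exists (cst 0), (cst 0); split; [exact: vs0|exact: vs0|].
  by rewrite h0; apply/funext => z /=; rewrite mulr0 addr0.
have [z0 hz0] : exists z0, h z0 != 0.
  apply: contrapT => hN; apply: h0; apply/funext => z.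
  by apply/eqP/negPn/negP => hz; apply: hN; exists z.
have [v vi hv] := nonreal_near (holo_ccont (eh z0)) hz0.
have [f hf fv] := nonvanish vi.
have [g hg gE] := H f v hf hv.
exists (- (f v)^-1 \*o g), ((h v / f v \*o f) \+ (v / f v \*o g)).
split; [exact: vsZ|by apply: vsL => //; exact: vsZ|].
apply/funext => z /=; have := gE z => E.
have -> : h z = (h v * f z - (h v * f z - h z * f v)) / f v by field.
by rewrite -E; field.
Qed.

Lemma kernel_adjoint z : dom Sa (k^~ z) /\ Sa (k^~ z) = conjc z \*o k^~ z.
Proof.
have [kz kE] := kB z; apply: (adjointP BS BI Sdense multB) => //; first exact: vsZ.
move=> f [f1 f2]; rewrite -(kE _ f2) (ipZl BS BI) // conjcK.
by rewrite -(kE _ f1).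
Qed.

End Extension.

(** * The two dual spaces *)

Section Dual.
Variable R : realType.
Local Notation C := R[i].
Local Notation nc := (@Normc.normc R).
Local Notation fn := (C -> C).

(** A completion of [B] whose norm is the dual norm of [P] is [P] itself, seen through the
    Riesz isomorphism. *)
Lemma completion_dual (B P : fspace R) (N : fn -> R) (X : completion (carrier B) N) (J : fn -> fn) :
  Defs.subspace B -> inner_product B ->
  Defs.subspace P -> inner_product P -> complete_space P -> (forall f, P f -> B f) ->
  (forall f, B f -> P (J f)) -> (forall f g, B f -> P g -> inner P (J f) g = inner B f g) ->
  (forall f, B f -> N f = ipnorm (inner P) (J f)) ->
  exists V : X -> fn, [/\ forall phi, P (V phi), forall v, P v -> exists phi, V phi = v,
    injective V & forall phi h, P h -> pairing P phi h = inner P (V phi) h].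
Proof.
move=> BS BI PS PI PC PB JP Jip NJ.
have /choice [V HV] : forall phi : X, exists v, rep P J phi v :=
  rep_ex BS BI PS PI PC PB JP Jip NJ.
exists V; split.
- by move=> phi; case: (HV phi).
- move=> v hv; have [phi hphi] := rep_onto X BS BI PS PI PC PB JP Jip NJ hv.
  by exists phi; exact: (rep_fun BS BI PS PI PB JP Jip NJ (HV phi) hphi).
- move=> phi psi E; have h := HV phi; rewrite E in h.
  exact: (rep_inj BS BI PS PI PB JP Jip NJ h (HV psi)).
- by move=> phi h; exact: (pairing_spec BS BI PS PI PC PB JP Jip NJ (HV phi)).
Qed.

Variables (B : fspace R) (e : C -> C) (k : C -> C -> C) (w : C) (gamma : R).
Hypotheses (BS : Defs.subspace B) (BI : inner_product B) (BC : complete_space B).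
Hypothesis Bnz : nonzero_space B.
Hypotheses (HB : hermite_biehler e) (Hreal : forall x : R, e x%:C%C != 0).
Hypothesis Be : same_fspace B (dBe e).
Hypothesis kB : reproducing_kernel B k.
Hypothesis Sdense : densely_defined B (mult B).
Hypothesis wim : complex.Im w != 0.
Local Notation ip := (inner B).
Local Notation nb := (ipnorm (inner B)).
Local Notation S := (mult B).
Local Notation A := (S_ B e w gamma).
Local Notation Sa := (adjoint B (mult B)).
Local Notation P1 := (Fplus B).
Local Notation P2 := (Bplus2 B e w gamma).

Let Sa_closed : closed_op B Sa := adjoint_closed BS BI Sdense (@multB R B).
Let AS : Defs.subspace (dom A) := ext_subspace gamma BS BI HB Hreal Be Sdense wim.
Let AB f : dom A f -> B f /\ B (A f) := @extB _ _ _ _ _ BS BI HB Hreal Be Sdense wim f.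
Let AL a f g (hf : dom A f) (hg : dom A g) : A ((a \*o f) \+ g) = (a \*o A f) \+ A g :=
  (ext_lin BS BI HB Hreal Be Sdense wim a hf hg).2.
Let Asym f g : dom A f -> dom A g -> ip f (A g) = ip (A f) g := @ext_sym _ _ _ _ _ BS BI HB Hreal Be Sdense wim f g.
Let Amax f g : B f -> B g -> (forall h, dom A h -> ip f (A h) = ip g h) -> dom A f /\ A f = g :=
  @ext_max _ _ _ _ _ BS BI HB Hreal Be Sdense wim f g.
Let A_closed : closed_op B A := selfadjoint_closed BS BI AS AB AL Asym Amax.

Lemma Fminus_dual (Fm : completion (carrier B) (Fminus_norm B)) :
  exists V : Fm -> fn, [/\ forall psi, dom Sa (V psi), forall v, dom Sa v -> exists psi, V psi = v,
    injective V & forall psi h, dom Sa h -> pairF psi h = inner P1 (V psi) h].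
Proof.
have PS := graph_subspace Sa_closed; have PI := graph_inner_product BI Sa_closed.
have PC := graph_complete BI BC Sa_closed; have PB := domB Sa_closed.
have [J [JP Jip]] := dual_rep BS BI PS PI PC PB (graph_norm_dom BI Sa_closed).
apply: (completion_dual Fm BS BI PS PI PC PB JP Jip) => f hf.
exact: (dual_normE PS PI JP Jip hf).
Qed.

Lemma Bminus2_dual (Bm : completion (carrier B) (Bminus2_norm B e w gamma)) :
  exists V : Bm -> fn, [/\ forall phi, dom A (V phi), forall v, dom A v -> exists phi, V phi = v,
    injective V & forall phi h, dom A h -> pair2 phi h = inner P2 (V phi) h].
Proof.
have PS := graph_subspace A_closed; have PI := graph_inner_product BI A_closed.
have PC := graph_complete BI BC A_closed; have PB := domB A_closed.
have Jip := inv_sqr1_ip BS BI BC AS AB AL Asym Amax.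
have JP f (hf : B f) : dom A (inv_sqr1 A f) :=
  let: And3 h _ _ := inv_sqr1P BS BI BC AS AB AL Asym Amax hf in h.
apply: (completion_dual Bm BS BI PS PI PC PB JP Jip) => f hf.
rewrite /Bminus2_norm /norm_m2 /ipnorm; congr (Num.sqrt (complex.Re _)).
by rewrite -(Jip _ _ hf (JP _ hf)).
Qed.

(** The function [z |-> <k(., z), psi>] when [psi] is represented by [v] in the graph space
    of the adjoint. *)
Definition assoc_of (v : fn) : fn := fun z => z * Sa v z + v z.

Lemma assoc_of_B u v : dom Sa u -> dom Sa v -> assoc_of (u \- v) = assoc_of u \- assoc_of v.
Proof.
by move=> du dv; rewrite /assoc_of (op_B Sa_closed du dv); apply/funext => z /=; ring.
Qed.

Lemma assoc_of_assoc v : dom Sa v -> assoc B (assoc_of v).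
Proof.
move=> dv; have hv := domB Sa_closed dv; have hu := imB Sa_closed dv.
exact: (assoc_zB gamma BS HB Hreal Be).
Qed.

(** If [z u + v = 0] with [u] the adjoint applied to [v], then multiplication maps [u] to [- v],
    so that [- |v|^2 = |u|^2]. *)
Lemma assoc_of_inj u v : dom Sa u -> dom Sa v -> assoc_of u = assoc_of v -> u = v.
Proof.
move=> du dv E; have d := vsB (graph_subspace Sa_closed) du dv.
move: (assoc_of_B du dv); rewrite E subff; set f := u \- v in d *; move=> E0.
have [f1 f2 fE] := adjointE BS BI Sdense (@multB R B) d.
have zf : (fun z => z * Sa f z) = (-1) \*o f.
  apply/funext => z; have := congr1 (fun h : fn => h z) E0; rewrite /assoc_of /= mulN1r => /eqP.
  by rewrite addr_eq0 => /eqP.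
have dS : dom S (Sa f) by split=> //; rewrite zf; exact: vsZ.
have := fE _ dS; rewrite /mult /= zf (ipZr BS BI) // mulN1r => h.
have p1 := ip_ge0 BI f1; have p2 := ip_ge0 BI f2.
have f0 : f = cst 0.
  apply: (ip_eq0 BI f1); apply/eqP; rewrite eq_le p1 andbT.
  by rewrite -oppr_ge0 h.
apply/funext => z; have := congr1 (fun h : fn => h z) f0.
by rewrite /= => /eqP; rewrite subr_eq0 => /eqP.
Qed.

(** The functional [<a, S^* g> + <b, g>] attached to [z a + b] is bounded for the graph norm,
    and its values at the kernels are the conjugates of those of [z a + b]. *)
Lemma assoc_of_onto f : assoc B f -> exists2 v, dom Sa v & assoc_of v = f.
Proof.
move=> /(assoc_decomp gamma BS Bnz HB Hreal Be) [a [b [ha hb ->]]].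
have PS := graph_subspace Sa_closed; have PI := graph_inner_product BI Sa_closed.
have PC := graph_complete BI BC Sa_closed; have PB := domB Sa_closed.
have IB := imB Sa_closed.
have [|||v [dv E _]] := @riesz _ P1 PS PI PC (dom Sa) (fun g => ip a (Sa g) + ip b g) (nb a + nb b) PS.
- by [].
- move=> c g h dg dh; rewrite (op_linear Sa_closed) //.
  have g1 := PB _ dg; have g2 := IB _ dg; have h1 := PB _ dh; have h2 := IB _ dh.
  by rewrite !(ipLr BI) //; ring.
- move=> g dg; have g1 := PB _ dg; have g2 := IB _ dg.
  apply: le_trans (ncD _ _) _; rewrite mulrDl; apply: lerD.
    apply: le_trans (cauchy_schwarz BS BI ha g2) _.
    by rewrite ler_wpM2l ?norm_ge0 // (graph_norm_im BI Sa_closed).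
  apply: le_trans (cauchy_schwarz BS BI hb g1) _.
  by rewrite ler_wpM2l ?norm_ge0 // (graph_norm_dom BI Sa_closed).
exists v => //; apply/funext => z; have [kz kE] := kB z.
have [dk Sk] := kernel_adjoint BS BI kB Sdense z.
have v1 := PB _ dv; have v2 := IB _ dv.
have : ip a (Sa (k^~ z)) + ip b (k^~ z) = ip (Sa v) (Sa (k^~ z)) + ip v (k^~ z) := E _ dk.
rewrite Sk !(ipZr BS BI) // => /(congr1 (@conjc R)); rewrite !conjcD !conjcM conjcK.
rewrite -(ipC BI ha kz) -(ipC BI hb kz) -(ipC BI v1 kz) -(ipC BI v2 kz).
by rewrite -!kE // => ->.
Qed.

Section Pairing.
Variable Fm : completion (carrier B) (Fminus_norm B).

Lemma assoc_pairF_of v h : dom Sa v -> dom Sa h ->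
  assoc_pairF k Fm (assoc_of v) h = inner P1 v h.
Proof.
have [V [VP Vonto Vinj Vpair]] := Fminus_dual Fm.
have E psi : Fm_fun k psi = assoc_of (V psi).
  apply/funext => z; have [kz kE] := kB z; have [dk Sk] := kernel_adjoint BS BI kB Sdense z.
  have v1 := domB Sa_closed (VP psi); have v2 := imB Sa_closed (VP psi).
  rewrite /Fm_fun Vpair //= /graph_inner Sk (ipZr BS BI) // conjcD conjcM conjcK.
  by rewrite -(ipC BI v1 kz) -(ipC BI v2 kz) -!kE.
move=> dv dh; rewrite /assoc_pairF Vpair //; congr (inner P1 _ h).
have [psi psiE] := Vonto _ dv.
have ex : exists psi : Fm, Fm_fun k psi = assoc_of v by exists psi; rewrite E psiE.
have := xgetPex 0 ex; rewrite /= E; exact: assoc_of_inj.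
Qed.

(** The space divided out consists of the functionals that vanish on the smaller domain. *)
Lemma M0_of u v : dom Sa u -> dom Sa v ->
  M0 e k w gamma Fm (assoc_of u \- assoc_of v) <->
  forall h, dom A h -> inner P1 u h = inner P1 v h.
Proof.
move=> du dv; have PS := graph_subspace Sa_closed; have PI := graph_inner_product BI Sa_closed.
have d := vsB PS du dv; rewrite -assoc_of_B //; split.
  move=> [_ H] h dh; have [da _] := ext_adjoint BS BI HB Hreal Be Sdense wim dh.
  have := H _ dh; rewrite assoc_pairF_of // (ipBl PS PI) // => /eqP.
  by rewrite subr_eq0 => /eqP.
move=> H; split; first exact: assoc_of_assoc.
move=> h dh; have [da _] := ext_adjoint BS BI HB Hreal Be Sdense wim dh.
by rewrite assoc_pairF_of // (ipBl PS PI) // H // subrr.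
Qed.

Definition coset (v : fn) : set fn :=
  [set f | assoc B f /\ M0 e k w gamma Fm (f \- assoc_of v)].

Lemma quotient_coset F : quotient (assoc B) (M0 e k w gamma Fm) F <->
  exists2 v, dom Sa v & F = coset v.
Proof.
split=> [[f /assoc_of_onto [v dv <-] ->]|[v dv ->]]; first by exists v.
by exists (assoc_of v) => //; exact: assoc_of_assoc.
Qed.

Lemma in_coset u v : dom Sa u -> dom Sa v ->
  coset v (assoc_of u) <-> forall h, dom A h -> inner P1 u h = inner P1 v h.
Proof.
move=> du dv; split=> [[_ /M0_of]|H]; first exact.
by split; [exact: assoc_of_assoc|apply/M0_of].
Qed.

Lemma graph_inner_ext g h : dom A g -> dom A h -> inner P1 g h = inner P2 g h.
Proof.
move=> dg dh; have [_ Eg] := ext_adjoint BS BI HB Hreal Be Sdense wim dg.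
have [_ Eh] := ext_adjoint BS BI HB Hreal Be Sdense wim dh.
by rewrite /= /graph_inner Eg Eh.
Qed.

(** Both dual spaces consist of vectors: [phi] is a vector of the domain of the extension,
    a coset comes from a vector of the larger domain of the adjoint, and a coset represents
    [phi] when the two vectors define the same functional on the smaller domain. *)
Lemma dual_quotient (Bm : completion (carrier B) (Bminus2_norm B e w gamma)) :
  (forall F, quotient (assoc B) (M0 e k w gamma Fm) F ->
     exists! phi : Bm, represents k Fm F phi) /\
  (forall phi : Bm, exists! F,
     quotient (assoc B) (M0 e k w gamma Fm) F /\ represents k Fm F phi).
Proof.
have dA h : dom A h -> dom Sa h.
  by move=> /(ext_adjoint BS BI HB Hreal Be Sdense wim) [].
have [V [VP Vonto Vinj Vpair]] := Bminus2_dual Bm.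
have PS := graph_subspace A_closed; have PI := graph_inner_product BI A_closed.
have PC := graph_complete BI BC A_closed.
have P1S := graph_subspace Sa_closed; have P1I := graph_inner_product BI Sa_closed.
have repP v phi : dom Sa v -> represents k Fm (coset v) phi <->
    forall h, dom A h -> inner P2 (V phi) h = inner P1 v h.
  move=> dv; split=> H.
    move=> h dh; rewrite -Vpair // (H (assoc_of v) h) ?assoc_pairF_of //; first exact: dA.
    by apply/in_coset.
  move=> _ h [/assoc_of_onto [u du <-] hu] dh.
  have dh' : dom A h by [].
  rewrite Vpair // H // assoc_pairF_of //; last exact: dA.
  by have /M0_of -> := hu.
split.
  move=> _ /quotient_coset [v dv ->].
  have [|||u [du uE _]] := @riesz _ P2 PS PI PC (dom A) (inner P1 v) (ipnorm (inner P1) v) PS.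
  - by [].
  - by move=> a g h dg dh; rewrite (ipLr P1I) //; apply: dA.
  - move=> g dg; apply: le_trans (cauchy_schwarz P1S P1I dv (dA _ dg)) _.
    by rewrite [ipnorm (inner P2) g]/ipnorm -graph_inner_ext.
  have [phi phiE] := Vonto _ du.
  exists phi; split; first by apply/repP => // h dh; rewrite phiE uE.
  move=> psi hpsi; have H := (repP v psi dv).1 hpsi.
  apply: Vinj; apply: (ip_ext PS PI (VP _) (VP _)) => h dh.
  by rewrite phiE (H h dh) uE.
move=> phi; have dv := dA _ (VP phi).
exists (coset (V phi)); split.
  split; first by apply/quotient_coset; exists (V phi).
  by apply/repP => // h dh; rewrite graph_inner_ext.
move=> _ [/quotient_coset [v dv' ->] hv]; have H := (repP v phi dv').1 hv.
have E h : dom A h -> inner P1 (V phi) h = inner P1 v h.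
  by move=> dh; rewrite graph_inner_ext // H.
apply/seteqP; split=> [_ [/assoc_of_onto [u du <-] /M0_of hu]|_ [/assoc_of_onto [u du <-] /M0_of hu]];
  apply/in_coset => // h dh; by rewrite hu // E.
Qed.

End Pairing.
End Dual.

Theorem theorem3p7 (R : realType) (B : fspace R) (e : R[i] -> R[i])
  (k : R[i] -> R[i] -> R[i]) (w : R[i]) (gamma : R)
  (B_dB : dB_space B) (B_nonzero : nonzero_space B)
  (e_HB : hermite_biehler e) (e_real : forall x : R, e x%:C%C != 0)
  (B_e : same_fspace B (dBe e)) (k_B : reproducing_kernel B k)
  (S_dense : densely_defined B (mult B))
  (w_nonreal : complex.Im w != 0) (gamma_range : 0 <= gamma < pi)
  (Fm : completion (carrier B) (Fminus_norm B))
  (Bm : completion (carrier B) (Bminus2_norm B e w gamma)) :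
  (forall F, quotient (assoc B) (M0 e k w gamma Fm) F ->
     exists! phi : Bm, represents k Fm F phi) /\
  (forall phi : Bm, exists! F,
     quotient (assoc B) (M0 e k w gamma Fm) F /\ represents k Fm F phi).
Proof.
have [_ [BS BI BC] _ _ _] := B_dB.
exact: (dual_quotient BS BI BC B_nonzero e_HB e_real B_e k_B S_dense w_nonreal Fm Bm).
Qed.
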